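(* Let $p>1$, $q=p/(p-1)$, $T>0$, $\mathcal X=C_0([0,T];\mathbb R^d)$, and let $\mu\in\mathscr P(\mathcal X)$ satisfy $E_\mu[\sup_{t\in[0,T]}|X_t|^p]<\infty$. Assume: (i) $L:[0,+\infty)\to[0,+\infty]$ is continuous, non-decreasing, $L(0)=0$ and $\liminf_{u\to\infty}L(u)/u^p=+\infty$; (ii) $f:\mathcal X\to\mathbb R$ belongs to $\mathbb D^1_b$, and there is a constant $C$ such that $|f(\omega)|\le C(1+\|\omega\|_\infty^p)$ for all $\omega\in\mathcal X$, and for all $t\in[0,T]$ the map $\mathbb D_tf$ is continuous and $|\mathbb D_tf(\omega)|\le C(1+\|\omega\|_\infty^{p-1})$ for all $\omega\in\mathcal X$. For $\delta>0$ let $$V(\delta)=\sup_{\nu\in\mathscr P(\mathcal X)}\Big\{E_\nu[f(X)]-L_\delta\big(d_{\mathfrak c}(\mu,\nu)^{1/p}\big)\Big\},\qquad V(0)=E_\mu[f(X)],$$ where $d_{\mathfrak c}$ is the causal transport cost associated with $$c(\omega,\eta)=\begin{cases}\|\omega-\eta\|_{W_0^{1,p}}^p,&\omega-\eta\in W_0^{1,p},\\+\infty,&\text{otherwise.}\end{cases}$$ Then, as $\delta\to0^+$, $V(\delta)=V(0)+\Upsilon\delta+o(\delta)$, where $$\Upsilon=\lim_{\delta\to0}\frac{V(\delta)-V(0)}{\delta}=L^*\big(\|{}^{\mathrm o}\mathbb Df\|_{L^q(\mu)}\big),\qquad \|{}^{\mathrm o}\mathbb Df\|_{L^q(\mu)}=\Big(\int_0^TE_\mu\big[|{}^{\mathrm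 o}\mathbb D_tf(X)|_*^q\big]\,dt\Big)^{1/q},$$ and ${}^{\mathrm o}\mathbb Df$ is the optional projection, under $\mu$ and $(\mathcal F_t)$, of the process $t\mapsto\mathbb D_tf(X)$ (so ${}^{\mathrm o}\mathbb D_tf(X)=E_\mu[\mathbb D_tf(X)\mid\mathcal F_t]$ a.s.\ for each $t$).
   Context: $\mathcal X=C_0([0,T];\mathbb R^d)$ is the space of continuous paths starting at $0$, with the uniform topology, canonical process $X$, and filtration $(\mathcal F_t)_{t\in[0,T]}$ the right-continuous augmentation of the natural filtration. $\mathscr P(\mathcal X)$ is the set of Borel probability measures. On $\mathbb R^d$, $|\cdot|$ is the $l_p$-norm and $|\cdot|_*$ the $l_q$-norm. $W_0^{1,p}$ is the Sobolev space of absolutely continuous paths starting at $0$ with $\|\omega\|_{W_0^{1,p}}=\|\dot\omega\|_{L^p}<\infty$. Causal couplings: let $(\mathcal Y,(\mathcal G_t))$ be a copy of $(\mathcal X,(\mathcal F_t))$ with canonical process $Y$. A coupling $\pi$ of $\mu$ and $\nu$, disintegrated as $\pi(dx,dy)=\mu(dx)\pi_y(x,dy)$, is causal if for every $t\in[0,T]$ and $U\in\mathcal G_t$ the map $x\mapsto\pi_y(x,U)$ is measurable with respect to the $\mu$-completion of $\mathcal F_t$; $\Pi_{\mathfrak c}(\mu,\nu)$ is the set of such couplings, and $d_{\mathfrak c}(\mu,\nu)=\inf_{\pi\in\Pi_{\mathfrak c}(\mu,\nu)}E_\pi[c(X,Y)]$. Pathwise Malliavin derivative: let $D([0,T];\mathbb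 R^d)$ be the space of càdlàg paths. A functional $\tilde f:D([0,T];\mathbb R^d)\to\mathbb R$ is pathwise Malliavin differentiable if there is $\mathbb D\tilde f:D([0,T];\mathbb R^d)\times[0,T]\to\mathbb R^d$ with $$\langle\mathbb D_t\tilde f(\omega),e\rangle=\lim_{\varepsilon\to0}\frac{\tilde f(\omega+\varepsilon e\mathbf 1_{[t,T]})-\tilde f(\omega)}{\varepsilon}\quad\text{for all }\omega\in D([0,T];\mathbb R^d),\ e\in\mathbb R^d.$$ A functional $F$ on $[0,T]\times D([0,T];\mathbb R^d)$ has a left limit at $t$ if for every $\omega^n\to\omega$ uniformly and $t^n$ increasing to $t$ the limit $\lim_nF(t^n,\omega^n)=:F(t-,\omega)$ exists; $F$ is boundedness preserving if $\sup_{t\in[0,T]}\sup_{\|\omega\|_\infty<K}|F(t,\omega)|<\infty$ for every $K$. $\mathbb D^1_b$ is the set of functionals $f:C_0([0,T];\mathbb R^d)\to\mathbb R$ admitting an extension $\tilde f$ to $D([0,T];\mathbb R^d)$ which is pathwise Malliavin differentiable, such that $\tilde f$ and all $\mathbb D_t\tilde f$, $t\in[0,T]$, are continuous for the uniform topology, and $\mathbb D\tilde f$ has a left limit at every $t\in[0,T]$ and is boundedness preserving. For such $f$, $\mathbb D_tf(\omega):=\mathbb D_t\tilde f(\omega)$ for $\omega\in C_0([0,T];\mathbb R^d)$. Penalty: $L_\delta(u)=\delta L(u/\delta)$, with $L(+\infty)=+\infty$; measures $\nu$ with infinite penalty contribute $-\infty$ to the supremum. $L^*(v)=\sup_{u\ge0}\{uv-L(u)\}$.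 *)

(* Defs.v *)
From HB Require Import structures.
From mathcomp Require Import all_boot all_order all_algebra.
From mathcomp Require Import all_classical all_reals all_analysis.
From mathcomp Require Import measurable_realfun.

Set Implicit Arguments.
Unset Strict Implicit.
Unset Printing Implicit Defensive.

Import Order.TTheory GRing.Theory Num.Theory.
Import numFieldTopology.Exports numFieldNormedType.Exports.

Local Open Scope classical_set_scope.
Local Open Scope ring_scope.

Section paths.
Variables (R : realType) (T : R) (d : nat).

(* A path on [0, T] is encoded as a function on R that is frozen outside
   [0, T] (see [frozen]), so that it is determined by its values on [0, T]
   and Leibniz equality of paths is equality on [0, T]. *)
Definition clamp (t : R) : R := Num.max 0 (Num.min t T).

Definition frozen (w : R -> 'rV[R]_d) : Prop := forall t, w t = w (clamp t).

Definition cadlag_on (V : topologicalType) (w : R -> V) : Prop :=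
  (forall t : R, 0 <= t < T -> w s @[s --> t^'+] --> w t) /\
  (forall t : R, 0 < t <= T -> exists l : V, w s @[s --> t^'-] --> l).

Record cadlag_path := CadlagPath {
  cadlag_val :> R -> 'rV[R]_d ;
  cadlag_frozen : frozen cadlag_val ;
  cadlag_valP : cadlag_on cadlag_val }.

(* For a frozen function, continuity on R and on [0, T] are equivalent. *)
Record C0_path := C0Path {
  C0_val :> R -> 'rV[R]_d ;
  C0_frozen : frozen C0_val ;
  C0_start : C0_val 0 = 0 ;
  C0_continuous : continuous C0_val }.

HB.instance Definition _ := gen_eqMixin cadlag_path.
HB.instance Definition _ := gen_choiceMixin cadlag_path.
HB.instance Definition _ := gen_eqMixin C0_path.
HB.instance Definition _ := gen_choiceMixin C0_path.

Definition cadlag_uniform (w : cadlag_path) : {uniform` `[0, T] -> 'rV[R]_d} :=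
  cadlag_val w.
Definition C0_uniform (w : C0_path) : {uniform` `[0, T] -> 'rV[R]_d} :=
  C0_val w.

HB.instance Definition _ :=
  Uniform.copy cadlag_path (initial_topology cadlag_uniform).
HB.instance Definition _ := Uniform.copy C0_path (initial_topology C0_uniform).

Lemma cst0_frozen : frozen (fun=> 0). Proof. by []. Qed.
Lemma cst0_continuous : continuous (fun _ : R => 0 : 'rV[R]_d).
Proof. by move=> x; exact: cvg_cst. Qed.

HB.instance Definition _ := isPointed.Build C0_path
  (C0Path cst0_frozen erefl cst0_continuous).

(* The Borel sigma-algebra of the uniform topology. *)
HB.instance Definition _ :=
  Measurable.copy C0_path (g_sigma_algebraType (@open C0_path)).

Lemma C0_cadlag_on (w : C0_path) : cadlag_on w.
Proof.
split=> t _; first exact/cvg_at_right_filter/C0_continuous.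
by exists (w t); exact/cvg_at_left_filter/C0_continuous.
Qed.

Definition cadlag_of_C0 (w : C0_path) : cadlag_path :=
  CadlagPath (C0_frozen w) (C0_cadlag_on w).

(* w + e 1_{[t, T]}, for t in [0, T]. *)
Definition bump_fun (w : R -> 'rV[R]_d) (t : R) (e : 'rV[R]_d) (s : R) :=
  w s + (if t <= clamp s then e else 0).

Lemma clamp_id (s : R) : 0 <= s <= T -> clamp s = s.
Proof. by case/andP=> s0 sT; rewrite /clamp (min_idPl _)// (max_idPr _). Qed.

Lemma clampK (s : R) : clamp (clamp s) = clamp s.
Proof.
case: (leP 0 T) => T0.
  by apply: clamp_id; rewrite /clamp le_max lexx/= ge_max T0 ge_min lexx orbT.
have minT x : Num.min x T <= 0 by rewrite ge_min (ltW T0) orbT.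
by rewrite /clamp !(max_idPl _).
Qed.

Lemma bump_frozen w t e : frozen w -> frozen (bump_fun w t e).
Proof. by move=> wf s; rewrite /bump_fun clampK {1}wf. Qed.

Lemma bump_cadlag w t e : cadlag_on w -> cadlag_on (bump_fun w t e).
Proof.
move=> [wr wl]; split=> s /andP[s0 sT].
  have near_id : \forall x \near s^'+, clamp x = x.
    near=> x; apply: clamp_id; apply/andP; split.
      by rewrite (le_trans s0)//; near: x; exact: nbhs_right_ge.
    by near: x; exact: nbhs_right_le.
  apply: cvgD; first by apply: wr; rewrite s0.
  rewrite clamp_id; last by rewrite s0 ltW.
  suff near_s : \forall x \near s^'+,
      (if t <= clamp x then e else 0) = (if t <= s then e else 0).
    exact: cvg_near_cst near_s.
  case: (leP t s) => ts; near=> x; rewrite (near near_id)//.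
    by rewrite ifT// (le_trans ts)//; near: x; exact: nbhs_right_ge.
  by rewrite ifF//; apply/negbTE; rewrite -ltNge; near: x; exact: nbhs_right_lt.
have [|l wsl] := wl s; first by rewrite s0.
have near_id : \forall x \near s^'-, clamp x = x.
  near=> x; apply: clamp_id; apply/andP; split.
    by near: x; exact: nbhs_left_ge.
  by rewrite (le_trans _ sT)//; near: x; exact: nbhs_left_le.
case: (leP s t) => ts.
  exists (l + 0); apply: cvgD => //.
  suff near_s : \forall x \near s^'-, (if t <= clamp x then e else 0) = 0.
    exact: cvg_near_cst near_s.
  near=> x; rewrite (near near_id)// ifF//; apply/negbTE; rewrite -ltNge.
  by rewrite (lt_le_trans _ ts)//; near: x; exact: nbhs_left_lt.
exists (l + e); apply: cvgD => //.
suff near_s : \forall x \near s^'-, (if t <= clamp x then e else 0) = e.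
  exact: cvg_near_cst near_s.
near=> x; rewrite (near near_id)// ifT//.
by near: x; exact: nbhs_left_ge.
Unshelve. all: by end_near. Qed.

End paths.

Section norms.
Variables (R : realType) (d : nat).

Definition lnorm (r : R) (x : 'rV[R]_d) : R :=
  (\sum_(i < d) `|x 0 i| `^ r) `^ r^-1.

Definition dotv (x y : 'rV[R]_d) : R := \sum_(i < d) x 0 i * y 0 i.

Definition sup_lnorm (T p : R) (w : R -> 'rV[R]_d) : R :=
  sup [set lnorm p (w t) | t in `[0, T]].

Definition abs_continuous (T p : R) (h : R -> 'rV[R]_d) : Prop :=
  forall e : R, 0 < e -> exists2 eta : R, 0 < eta &
    forall (n : nat) (a b : 'I_n -> R),
      (forall i, 0 <= a i /\ a i <= b i /\ b i <= T) ->
      (forall i j, i != j -> b i <= a j \/ b j <= a i) ->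
      \sum_(i < n) (b i - a i) < eta ->
      \sum_(i < n) lnorm p (h (b i) - h (a i)) < e.

(* Componentwise; at points where a coordinate is not differentiable (a null
   set if h is absolutely continuous) [derive1] is an arbitrary constant. *)
Definition path_derive (h : R -> 'rV[R]_d) (t : R) : 'rV[R]_d :=
  \row_i derive1 (fun s => h s 0 i) t.

Definition W1p_norm (T p : R) (h : R -> 'rV[R]_d) : \bar R :=
  ((\int[lebesgue_measure]_(t in `[0%R, T])
      (lnorm p (path_derive h t) `^ p)%:E) `^ p^-1)%E.

Definition W1p (T p : R) (h : R -> 'rV[R]_d) : Prop :=
  [/\ h 0 = 0, abs_continuous T p h & (W1p_norm T p h < +oo)%E].

Definition cost (T p : R) (w1 w2 : R -> 'rV[R]_d) : \bar R :=
  let h := fun t => w1 t - w2 t in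
  if `[< W1p T p h >] then (W1p_norm T p h `^ p)%E else +oo%E.

End norms.

Section filtration.
Variables (R : realType) (T : R) (d : nat).
Local Notation X := (C0_path T d).

Definition natural_filtration (t : R) : set (set X) :=
  <<s [set A | exists r (i : 'I_d) (B : set R),
        [/\ 0 <= r <= t, measurable B & A = [set w : X | B (w r 0 i)]]] >>.

(* F_t = F^0_{t+}; paths being frozen after T, this is F^0_T for t = T. *)
Definition filtration (t : R) : set (set X) :=
  \bigcap_(s in [set s | t < s]) natural_filtration s.

(* The completing null sets are those of the whole Borel sigma-algebra, so that
   causality does not depend on the chosen version of the disintegration. *)
Definition completion (mu : probability X R) (G : set (set X)) : set (set X) :=
  [set A | exists2 B, G B & mu.-negligible ((A `\` B) `|` (B `\` A))].

Definition coupling (mu nu : probability X R) (pi : probability (X * X)%type R)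
  : Prop :=
  (forall A, measurable A -> pi (fst @^-1` A) = mu A) /\
  (forall B, measurable B -> pi (snd @^-1` B) = nu B).

Definition disintegration (mu : probability X R)
    (pi : probability (X * X)%type R) (k : R.-pker X ~> X) : Prop :=
  forall A B, measurable A -> measurable B ->
    pi (A `*` B) = (\int[mu]_(x in A) k x B)%E.

Definition causal_coupling (mu nu : probability X R)
    (pi : probability (X * X)%type R) : Prop :=
  coupling mu nu pi /\
  exists2 k : R.-pker X ~> X, disintegration mu pi k &
    forall t, 0 <= t <= T -> forall U, filtration t U ->
      forall B : set (\bar R), measurable B ->
        completion mu (filtration t) ((fun x => k x U) @^-1` B).

Definition causal_cost (p : R) (mu nu : probability X R) : \bar R :=
  ereal_inf [set (\int[pi]_z cost T p z.1 z.2)%E | pi in causal_coupling mu nu].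

(* Processes are indexed by R; only times in [0, T] matter. *)
Definition adapted (Z : R -> X -> R) : Prop :=
  forall t, 0 <= t <= T -> forall B, measurable B -> filtration t (Z t @^-1` B).

(* The optional sigma-algebra, on [0, T] x X. *)
Definition optional_sigma : set (set (R * X)) :=
  <<s `[0, T] `*` setT,
    [set A | exists (Z : R -> X -> R) (B : set R),
      [/\ adapted Z, forall w, cadlag_on T (Z ^~ w), measurable B &
          A = [set u | 0 <= u.1 <= T /\ B (Z u.1 u.2)]]] >>.

Definition optional (Y : R -> X -> R) : Prop :=
  forall B, measurable B ->
    optional_sigma [set u | 0 <= u.1 <= T /\ B (Y u.1 u.2)].

Definition stopping_time (tau : X -> \bar R) : Prop :=
  (forall w, tau w = +oo%E \/ exists2 t, 0 <= t <= T & tau w = t%:E) /\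
  (forall t, 0 <= t <= T -> filtration t [set w | (tau w <= t%:E)%E]).

Definition stopped_sigma (tau : X -> \bar R) : set (set X) :=
  [set A | measurable A /\ forall t, 0 <= t <= T ->
             filtration t (A `&` [set w | (tau w <= t%:E)%E])].

(* H_tau 1_{tau < oo} *)
Definition at_time (tau : X -> \bar R) (H : R -> X -> R) (w : X) : R :=
  if tau w is t%:E then H t w else 0.

(* Y is a version of E_mu[Z | G]. *)
Definition is_cond_exp (mu : probability X R) (G : set (set X))
    (Z Y : X -> R) : Prop :=
  [/\ mu.-integrable setT (EFin \o Z), mu.-integrable setT (EFin \o Y),
      forall B, measurable B -> G (Y @^-1` B) &
      forall A, G A -> (\int[mu]_(w in A) (Y w)%:E = \int[mu]_(w in A) (Z w)%:E)%E].

Definition optional_projection (mu : probability X R)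
    (H oH : R -> X -> 'rV[R]_d) : Prop :=
  forall i : 'I_d,
    let Hi := fun t w => H t w 0 i in
    let oHi := fun t w => oH t w 0 i in
    optional oHi /\
    forall tau, stopping_time tau ->
      is_cond_exp mu (stopped_sigma tau) (at_time tau Hi) (at_time tau oHi).

Definition process_norm (q : R) (mu : probability X R)
    (H : R -> X -> 'rV[R]_d) : \bar R :=
  ((\int[lebesgue_measure]_(t in `[0%R, T])
      \int[mu]_w (lnorm q (H t w) `^ q)%:E) `^ q^-1)%E.

End filtration.

Section malliavin.
Variables (R : realType) (T : R) (d : nat).
Local Notation X := (C0_path T d).
Local Notation D := (cadlag_path T d).

Definition bump (w : D) (t : R) (e : 'rV[R]_d) : D :=
  CadlagPath (bump_frozen t e (cadlag_frozen w))
             (bump_cadlag t e (cadlag_valP w)).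

Definition pathwise_malliavin (ft : D -> R) (Df : R -> D -> 'rV[R]_d) : Prop :=
  forall t, 0 <= t <= T -> forall (w : D) (e : 'rV[R]_d),
    (ft (bump w t (eps *: e)) - ft w) / eps @[eps --> 0^'] --> dotv (Df t w) e.

(* Times increase strictly to t, hence stay < t: a limit from the left. The
   common limit l is F(t-, w); at t = 0 the condition is void. *)
Definition has_left_limit (F : R -> D -> 'rV[R]_d) (t : R) : Prop :=
  forall w : D, exists l : 'rV[R]_d, forall (tn : nat -> R) (wn : nat -> D),
    (forall n, 0 <= tn n) -> increasing_seq tn -> tn @ \oo --> t ->
    wn @ \oo --> w -> F (tn n) (wn n) @[n --> \oo] --> l.

Definition boundedness_preserving (p : R) (F : R -> D -> 'rV[R]_d) : Prop :=
  forall K : R, exists M : R, forall t (w : D), 0 <= t <= T ->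
    sup_lnorm T p w < K -> lnorm p (F t w) <= M.

(* f belongs to the class D^1_b, with extension ft and derivative Df. *)
Definition D1b_with (p : R) (f : X -> R) (ft : D -> R)
    (Df : R -> D -> 'rV[R]_d) : Prop :=
  [/\ forall w, ft (cadlag_of_C0 w) = f w,
      pathwise_malliavin ft Df,
      continuous ft /\ (forall t, 0 <= t <= T -> continuous (Df t)),
      forall t, 0 <= t <= T -> has_left_limit Df t &
      boundedness_preserving p Df].

End malliavin.

Section penalty.
Variables (R : realType) (L : R -> \bar R).
Local Open Scope ereal_scope.

(* L extended by L(+oo) = +oo; only used at arguments in [0, +oo]. *)
Definition penalty (u : \bar R) : \bar R := if u is u%:E then L u else +oo.

Definition scaled_penalty (delta : R) (u : \bar R) : \bar R :=
  delta%:E * penalty (u * (delta^-1)%:E).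

Definition conjugate (v : \bar R) : \bar R :=
  ereal_sup [set u%:E * v - L u | u in [set u : R | (0 <= u)%R]].

Definition penalty_spec (p : R) : Prop :=
  [/\ forall u : R, (0 <= u)%R -> 0 <= L u,
      {within `[0%R, +oo[, continuous L},
      forall u v : R, (0 <= u)%R -> (u <= v)%R -> L u <= L v,
      L 0%R = 0 &
      limf_einf (fun u : R => L u * ((u `^ p)^-1)%:E) (+oo%R : set_system R) = +oo].

(* An infinite penalty contributes -oo: in [\bar R], x - +oo = -oo for all x. *)
Definition robust_value (T : R) (d : nat) (p : R) (mu : probability (C0_path T d) R)
    (f : C0_path T d -> R) (delta : R) : \bar R :=
  ereal_sup [set \int[nu]_w (f w)%:E
                 - scaled_penalty delta (causal_cost p mu nu `^ p^-1)
            | nu in [set: probability (C0_path T d) R]].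

End penalty.

(* Main.v *)
Require Import Defs.
From HB Require Import structures.
From mathcomp Require Import all_boot all_order all_algebra.
From mathcomp Require Import all_classical all_reals all_analysis.
From mathcomp Require Import measurable_realfun.
From mathcomp Require Import ring lra.

Set Implicit Arguments.
Unset Strict Implicit.
Unset Printing Implicit Defensive.

Import Order.TTheory GRing.Theory Num.Theory.
Import numFieldTopology.Exports numFieldNormedType.Exports.

Local Open Scope classical_set_scope.
Local Open Scope ring_scope.

(* Let y be a path with h = y - x in W_0^{1,p}. Adding the increments of h to x
   one after the other, as bumps at the times of a fine partition tau, turns x
   into y up to a small error, and the mean value theorem gives
     f y - f x = sum_j <D_{tau_{j+1}} f(x), h(tau_{j+1}) - h(tau_j)> + error.
   By Young's inequality the error is at most
     kappa^q / q * gap(x, y) + kappa^-p / p * ||h||^p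
   for every kappa > 0, where gap(x, y) is the integral over t of
   |D_t f(x + h(. /\ t)) - D_t f(x)|_q^q. Under any coupling of cost a whose
   first marginal is mu, the expected gap is at most e + K_e a for each e > 0.

   Upper bound: under a causal coupling the increments of h over [s, t] are
   orthogonal to (D_t f - oD_t f)(x), so that D f may be replaced by oD f in the
   sum above. With Young's inequality and optimal constants this gives
   E_nu f - E_mu f <= (||oD f||_q + (e + K_e a)^{1/q}) a^{1/p}. The superlinear
   growth of L confines a^{1/p} / delta to a bounded set.

   Lower bound: drifting x at the speed c sgn(oD) |oD|^{q-1}, with oD frozen at
   the left end of each cell of a partition, is adapted, hence gives a causal
   coupling, and c can be chosen so that its cost is (delta u)^p.

   The map t |-> E |oD_t f|_q^q is only known to be bounded and measurable, so its
   Riemann sums need not converge to its integral: partitions whose cells have a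
   common length are translated by a well chosen shift. *)

(** * The fundamental theorem of calculus for absolutely continuous functions *)

Section absolute_continuity.
Context {R : realType}.
Implicit Types (T : R) (h F : R -> R) (l : seq (R * R)).
Local Notation lambda := (@lebesgue_measure R).
Local Notation TV := total_variation.

(** The cost only enters through the sums of |increment of h|^p / length^(p-1) along partitions:
    [path_derive] is not known to be measurable, whereas these sums are, and Jensen's inequality
    bounds them by the cost. This is what the fundamental theorem of calculus is needed for. In
    time, D f has nothing but left limits; these still make it jointly continuous along the stopped
    paths outside a countable set of times, which is enough for the gap sums to converge. The bound
    e + K_e a holds because the gap vanishes as y tends to x and has p-growth: it is at most e + K
    sup|h|^p unless x lies in an exceptional set, whose weight depends on mu only. Right end points
    come with the bumps and suit the upper bound, since the increment over a cell is known at its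
    right end; an adapted speed must be read at left end points, and the mismatch is an oscillation
    of D f(x) in time, small in mean for fine meshes. In the lower bound kappa is a multiple of
    delta^(1/q), so that with a = (delta u)^p every error is a small multiple of delta. *)

Definition abs_cont (T : R) (h : R -> R) : Prop :=
  forall e : R, 0 < e -> exists2 eta : R, 0 < eta &
    forall l, all (fun x => [&& 0 <= x.1, x.1 <= x.2 & x.2 <= T]) l ->
      pairwise (fun x y => x.2 <= y.1) l ->
      \sum_(x <- l) (x.2 - x.1) < eta -> \sum_(x <- l) `|h x.2 - h x.1| < e.

Definition partition_pairs (a : R) (s : seq R) := zip (a :: s) s.

Lemma partition_pairs_bnd a b s x : itv_partition a b s ->
  x \in partition_pairs a s -> [&& a <= x.1, x.1 <= x.2 & x.2 <= b].
Proof.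
elim: s a => //= c s ih a /[dup] /itv_partition_cons cbs [/= /andP[ac _] _].
have cb := itv_partition_le cbs.
rewrite /partition_pairs /= inE => /orP[/eqP->/=|]; first by rewrite lexx ltW.
by move/(ih _ cbs) => /and3P[cx -> ->]; rewrite (le_trans (ltW ac) cx).
Qed.

Lemma partition_pairs_pairwise a b s : itv_partition a b s ->
  pairwise (fun x y : R * R => x.2 <= y.1) (partition_pairs a s).
Proof.
elim: s a => //= c s ih a /[dup] /itv_partition_cons cbs [/= /andP[ac _] _].
rewrite /partition_pairs /= -/(partition_pairs c s) ih// andbT.
by apply/allP => x /(partition_pairs_bnd cbs) /and3P[].
Qed.

Lemma partition_pairs_variation a b f s : itv_partition a b s ->
  variation a b f s = \sum_(x <- partition_pairs a s) `|f x.2 - f x.1|.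
Proof.
move=> abs; rewrite variation_zip//; elim: s a abs => [|c s ih] a abs.
  by rewrite /partition_pairs /= !big_nil.
by rewrite /partition_pairs /= !big_cons/= -/(partition_pairs c s) -ih//;
  exact: itv_partition_cons abs.
Qed.

Lemma partition_pairs_length a b s : itv_partition a b s ->
  \sum_(x <- partition_pairs a s) (x.2 - x.1) = b - a.
Proof.
elim: s a => [|c s ih] a abs.
  by rewrite /partition_pairs big_nil (itv_partition_nil abs) subrr.
rewrite /partition_pairs /= big_cons/= -/(partition_pairs c s) ih//.
  by rewrite addrC subrKA.
exact: itv_partition_cons abs.
Qed.

(** Cutting each interval of the family further keeps the intervals disjoint and their total length
    unchanged, so absolute continuity applies to the flattened list of all subintervals. *)
Lemma abs_cont_variation T h : abs_cont T h -> forall e : R, 0 < e ->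
  exists2 eta : R, 0 < eta &
  forall l (s : R * R -> seq R),
    all (fun x => [&& 0 <= x.1, x.1 <= x.2 & x.2 <= T]) l ->
    (forall x, x \in l -> itv_partition x.1 x.2 (s x)) ->
    pairwise (fun x y => x.2 <= y.1) l ->
    \sum_(x <- l) (x.2 - x.1) < eta ->
    \sum_(x <- l) variation x.1 x.2 h (s x) <= e.
Proof.
move=> hac e e0; have [eta eta0 H] := hac e e0; exists eta => // l s lT ls lp leta.
pose l' := flatten [seq partition_pairs x.1 (s x) | x <- l].
have -> : \sum_(x <- l) variation x.1 x.2 h (s x) =
    \sum_(x <- l') `|h x.2 - h x.1|.
  rewrite /l' big_flatten/= big_map big_seq [RHS]big_seq.
  by apply: eq_bigr => x xl; rewrite partition_pairs_variation//; exact: ls.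
apply/ltW/H.
- apply/allP => x /flatten_mapP[y yl] /(partition_pairs_bnd (ls _ yl)).
  move=> /and3P[yx -> xy]; have /and3P[y0 _ yT] := allP lT _ yl.
  by rewrite (le_trans y0 yx) (le_trans xy yT).
- move: lp ls; rewrite /l' {l' lT leta}; elim: l => //= x l ih /andP[xl lp] ls.
  rewrite pairwise_cat ih//; last by move=> y yl; apply: ls; rewrite inE yl orbT.
  rewrite (partition_pairs_pairwise (ls _ (mem_head _ _))) !andbT.
  apply/allrelP => y z /(partition_pairs_bnd (ls _ (mem_head _ _))) /and3P[_ _ yx].
  move=> /flatten_mapP[w wl] zw.
  have /(partition_pairs_bnd)/(_ zw) /and3P[wz _ _] : itv_partition w.1 w.2 (s w).
    by apply: ls; rewrite inE wl orbT.
  by rewrite (le_trans yx)// (le_trans _ wz)//; exact: (allP xl).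
- apply: le_lt_trans leta; rewrite /l' big_flatten/= big_map big_seq [leRHS]big_seq.
  by apply: ler_sum => x xl; rewrite (partition_pairs_length (ls _ xl)).
Qed.

(** A sum of suprema is a supremum over simultaneous choices. Nonemptiness keeps every supremum away
    from -oo, so that one term at a time can be moved across the inequality. *)
Lemma sum_ereal_sup_le (I : eqType) (l : seq I) (S : I -> set R) (e : R) :
  (forall x, x \in l -> S x !=set0) ->
  (forall y : seq R, all2 (fun x z => `[< S x z >]) l y -> \sum_(z <- y) z <= e) ->
  (\sum_(x <- l) ereal_sup [set z%:E | z in S x] <= e%:E)%E.
Proof.
elim: l e => [|x l ih] e S0 H.
  by rewrite big_nil lee_fin; have := H [::] isT; rewrite big_nil.
rewrite big_cons.
have [x1 Sx1] := S0 x (mem_head _ _).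
have S0' z : z \in l -> S z !=set0 by move=> zl; apply: S0; rewrite inE zl orbT.
have bnd z : S x z -> (\sum_(x <- l) ereal_sup [set z%:E | z in S x] <= (e - z)%:E)%E.
  move=> Sxz; apply: ih => // y Sy.
  have := H (z :: y); rewrite /= Sy asboolT// => /(_ isT).
  by rewrite big_cons lerBrDl.
have fin : (\sum_(x <- l) ereal_sup [set z%:E | z in S x])%E \is a fin_num.
  rewrite fin_numE; apply/andP; split; last first.
    by apply/eqP => h; have := bnd _ Sx1; rewrite h.
  apply/eqP => /esum_eqNyP [i [il _ iNy]].
  have [z Siz] := S0' _ il.
  have : (z%:E <= ereal_sup [set z%:E | z in S i])%E.
    by apply: ereal_sup_ubound; exists z.
  by rewrite iNy.
rewrite -leeBrDr//; apply: ge_ereal_sup => _ [z Sxz <-].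
by rewrite leeBrDr// -leeBrDl// -EFinB bnd.
Qed.

Lemma abs_cont_TV T h : abs_cont T h -> forall e : R, 0 < e ->
  exists2 eta : R, 0 < eta &
  forall l, all (fun x => [&& 0 <= x.1, x.1 < x.2 & x.2 <= T]) l ->
    pairwise (fun x y => x.2 <= y.1) l ->
    \sum_(x <- l) (x.2 - x.1) < eta ->
    (\sum_(x <- l) TV x.1 x.2 h <= e%:E)%E.
Proof.
move=> hac e e0; have [eta eta0 H] := abs_cont_variation hac e0.
exists eta => // l lT lp leta.
apply: sum_ereal_sup_le.
  by move=> x /(allP lT)/and3P[_ ? _]; exact: variations_neq0.
move=> y ly.
(* The partition [s] is a function of the interval, so two copies of one interval could not carry
   different partitions. Disjoint intervals of positive length are distinct. *)
have ul : uniq l.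
  elim: l lT lp {leta ly} => //= x l ih /andP[xT lT] /andP[xl lp].
  rewrite ih// andbT; apply/negP => /(allP xl).
  by case/and3P: xT => _ xx _; rewrite leNgt xx.
have [s sl sy] : exists2 s : R * R -> seq R,
    (forall x, x \in l -> itv_partition x.1 x.2 (s x)) &
    \sum_(z <- y) z = \sum_(x <- l) variation x.1 x.2 h (s x).
  elim: l ul y ly {lT lp leta} => [_ [|//] _|x l ih /= /andP[xl ul] [//|z y] /andP[]].
    by exists (fun=> [::]) => //; rewrite !big_nil.
  move=> /asboolP[t xt xz] /(ih ul)[s sl sy].
  exists (fun u => if u == x then t else s u).
    by move=> u; rewrite inE; case: eqP => [->|_]//= /sl.
  rewrite !big_cons eqxx xz sy; congr (_ + _); rewrite big_seq [RHS]big_seq.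
  by apply: eq_bigr => u ul'; case: eqP => // ux; rewrite -ux ul' in xl.
rewrite sy; apply: H => //.
by apply: sub_all lT => x /and3P[-> /ltW -> ->].
Qed.

(** A cell shorter than the [eta] attached to e = 1 has variation at most 1, and finitely many such
    cells cover [0, T]. *)
Lemma abs_cont_bounded_variation T h : 0 < T -> abs_cont T h ->
  bounded_variation 0 T h.
Proof.
move=> T0 hac; have [eta eta0 H] := abs_cont_TV hac ltr01.
have sT (a b : R) : 0 <= a -> a <= b -> b <= T -> b - a < eta -> (TV a b h <= 1)%E.
  move=> a0; rewrite le_eqVlt => /predU1P[<- _ _|ab bT abe].
    by rewrite total_variationxx.
  have := H [:: (a, b)]; rewrite /= !big_seq1/= a0 ab bT => /(_ isT isT abe).
  by [].
have [N NT] : exists N : nat, T / N.+1%:R < eta.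
  exists (Num.bound (T / eta)); rewrite ltr_pdivrMr// mulrC -ltr_pdivrMr//.
  rewrite (lt_le_trans (archi_boundP _))//; first by rewrite divr_ge0// ltW.
  by rewrite ler_nat.
have pN k : (k <= N.+1)%N -> k%:R * (T / N.+1%:R) <= T.
  by move=> kN; rewrite mulrCA ger_pMr// ler_pdivrMr// mul1r ler_nat.
have TN0 : 0 <= T / N.+1%:R by rewrite divr_ge0// ltW.
have : forall k, (k <= N.+1)%N -> (TV 0 (k%:R * (T / N.+1%:R)) h <= k%:R%:E)%E.
  elim=> [_|k ih kN]; first by rewrite mul0r total_variationxx.
  rewrite (@total_variationD _ 0 _ (k%:R * (T / N.+1%:R))); last 2 first.
  - by rewrite mulr_ge0.
  - by rewrite ler_wpM2r// ler_nat.
  rewrite -[X in (_ <= X%:E)%E]natr1 EFinD leeD ?ih ?(ltnW kN)// sT//.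
  - by rewrite mulr_ge0.
  - by rewrite ler_wpM2r// ler_nat.
  - exact: pN.
  - by rewrite -mulrBl -natr1 addrAC subrr add0r mul1r.
move=> /(_ N.+1 (leqnn _)); rewrite mulrC divfK// => TVT.
apply/bounded_variationP; first exact: ltW.
rewrite ge0_fin_numE ?total_variation_ge0 ?ltW//.
exact: le_lt_trans TVT (ltry _).
Qed.

Lemma lebesgue_stieltjes_itv (F : cumulative R R) a b : a <= b ->
  lebesgue_stieltjes_measure F `]a, b]%classic = (F b - F a)%:E.
Proof.
move=> ab; rewrite /lebesgue_stieltjes_measure/= /measure_extension/=.
rewrite measurable_mu_extE/=; first by rewrite wlength_itv_bnd.
by exists (a, b).
Qed.

(* A null set is covered by an open set of small measure; inside it, only the
   cells of a uniform partition that it contains matter. *)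
Lemma abs_cont_null T (F : cumulative R R) : 0 < T -> abs_cont T F ->
  forall A, measurable A -> A `<=` `]0, T] -> lambda A = 0%E ->
  lebesgue_stieltjes_measure F A = 0%E.
Proof.
move=> T0 Fac A mA AT A0; pose nu := lebesgue_stieltjes_measure F.
apply/eqP; rewrite eq_le measure_ge0 andbT.
apply/lee_addgt0Pr => e e0; rewrite add0e.
have [eta eta0 H] := Fac e e0.
have A0y : (lambda A < +oo)%E by rewrite A0.
have [U [oU AU UA]] := @lebesgue_regularity_outer R A eta mA A0y eta0.
have mU : measurable U by exact: open_measurable.
have {}UA : (lambda U < eta%:E)%E.
  apply: le_lt_trans UA; rewrite -[U in leLHS](setDUK AU).
  apply: (le_trans (measureU2 _ _ _)) => //=; first exact: measurableD.
  by rewrite [X in (X + _ <= _)%E]A0 add0e.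
pose t n k : R := k%:R * (T / n.+1%:R).
have tS n k : t n k <= t n k.+1.
  by rewrite ler_wpM2r ?ler_nat// divr_ge0// ltW.
have tle n i j : (i <= j)%N -> t n i <= t n j.
  by move=> ij; rewrite ler_wpM2r ?ler_nat// divr_ge0// ltW.
have tT n : t n n.+1 = T by rewrite /t mulrC divfK.
pose P n k := `[< `]t n k, t n k.+1] `<=` U >].
pose J n k : set R := if P n k then `]t n k, t n k.+1]%classic else set0.
have mJ n k : measurable (J n k) by rewrite /J; case: ifP.
have tJ n : trivIset [set: nat] (J n).
  apply/trivIsetP => i j _ _; wlog ij : i j / (i < j)%N.
    move=> h; rewrite neq_ltn => /orP[ij|ji]; first by apply: h => //; rewrite ltn_eqF.
    by rewrite setIC; apply: h => //; rewrite ltn_eqF.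
  move=> _; rewrite /J; case: ifP => _; last by rewrite set0I.
  case: ifP => _; last by rewrite setI0.
  rewrite -subset0 => x [] /=; rewrite !in_itv/= => /andP[_ xi] /andP[jx _].
  by have := le_lt_trans (tle n _ _ ij) jx; rewrite ltNge xi.
pose W n := \big[setU/set0]_(k < n.+1) J n k.
have mW n : measurable (W n) by exact: bigsetU_measurable.
have nuW n : (nu (W n) <= e%:E)%E.
  apply: (le_trans (Boole_inequality _ _)); first by move=> i _; exact: mJ.
  pose l := [seq (t n k, t n k.+1) | k <- index_iota 0 n.+1 & P n k].
  have -> : (\sum_(k < n.+1) nu (J n k))%E = (\sum_(x <- l) (F x.2 - F x.1))%:E.
    rewrite /l big_map big_filter -sumEFin -(big_mkord xpredT (fun k => nu (J n k))).
    rewrite [RHS]big_mkcond; apply: eq_bigr => k _.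
    by rewrite /J; case: ifP => _; rewrite ?measure0//; exact: lebesgue_stieltjes_itv.
  have lmono : \sum_(x <- l) (F x.2 - F x.1) <= \sum_(x <- l) `|F x.2 - F x.1|.
    by apply: ler_sum => x _; exact: ler_norm.
  rewrite lee_fin (le_trans lmono)// ltW// H//.
  - apply/allP => x /mapP[k]; rewrite mem_filter mem_index_iota/= => /andP[_ kn] ->/=.
    rewrite tS mulr_ge0 ?divr_ge0 ?(ltW T0)//=.
    by apply: (le_trans (tle n k.+1 n.+1 kn)); rewrite tT.
  - rewrite pairwise_map; apply: (@sub_pairwise _ ltn); first by move=> i j; exact: tle.
    apply: pairwise_filter; rewrite -sorted_pairwise; last exact: ltn_trans.
    exact: iota_ltn_sorted.
  - rewrite -lte_fin; apply: le_lt_trans UA.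
    have -> : (\sum_(x <- l) (x.2 - x.1))%:E = lambda (W n).
      rewrite /W (measure_bigsetU lambda (mJ n) (tJ n)) /l big_map big_filter -sumEFin.
      rewrite -[RHS](big_mkord xpredT (fun k => lambda (J n k))).
      rewrite [LHS]big_mkcond; apply: eq_bigr => k _.
      rewrite /J; case: ifP => _; rewrite ?measure0// lebesgue_measure_itv/= lte_fin.
      case: ltP => [//|]; rewrite le_eqVlt ltNge tS orbF => /eqP->.
      by rewrite subrr.
    apply: le_measure; [by rewrite inE; exact: mW|by rewrite inE|].
    rewrite /W -bigcup_mkord => x [k _]; rewrite /J; case: ifP => // /asboolP.
    by move=> h /h.
(* The sets [W n] need not increase with n. Their tail intersections do, and a point of A, having a
   whole ball in U, lies in [W n] for all large n. *)
pose I m := \bigcap_(n in [set n | (m <= n)%N]) W n.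
have mI m : measurable (I m) by apply: bigcap_measurableType => n _; exact: mW.
have AI : A `<=` \bigcup_m I m.
  move=> x Ax; have := AT _ Ax; rewrite /= in_itv/= => /andP[x0 xT].
  have [r /= r0 rU] := oU _ (AU _ Ax).
  exists (Num.bound (T / r)) => // n /= rn.
  have tr : T / n.+1%:R < r.
    rewrite ltr_pdivrMr// mulrC -ltr_pdivrMr//.
    rewrite (lt_le_trans (archi_boundP _))//; first by rewrite divr_ge0// ltW.
    by rewrite ler_nat (leq_trans rn).
  have exk : exists k, x <= t n k.+1 by exists n; rewrite tT.
  have [k xk kmin] := ex_minnP exk.
  have kx : t n k < x.
    case: k xk kmin => [_ _|k _ kmin]; first by rewrite /t mul0r.
    by rewrite ltNge; apply/negP => /kmin; rewrite ltnn.
  rewrite /W -bigcup_mkord; exists k => /=; first by rewrite ltnS kmin// tT.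
  rewrite /J ifT/= ?in_itv/= ?kx//; apply/asboolP => y /=; rewrite in_itv/= => /andP[ky yk].
  apply: rU; rewrite /ball/= ltr_norml.
  have : t n k.+1 - t n k = T / n.+1%:R by rewrite /t -mulrBl -natr1 addrAC subrr add0r mul1r.
  move: ky yk kx xk tr; move: (t n k) (t n k.+1) (T / _) => u v w *.
  by apply/andP; split; lra.
have mUI : measurable (\bigcup_m I m) by exact: bigcupT_measurable.
apply: (@le_trans _ _ (nu (\bigcup_m I m))).
  by apply: le_measure => //; rewrite inE; [exact: mA|exact: mUI].
have Ihomo : {homo I : n m / (n <= m)%N >-> (n <= m)%O}.
  by move=> n m nm; apply/subsetPset => x Ix k /= mk; apply: Ix => /=; exact: leq_trans mk.
have L := @nondecreasing_cvg_mu _ _ _ nu I mI mUI Ihomo.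
rewrite -[X in (X <= _)%E](cvg_lim (@ereal_hausdorff R) L).
apply: lime_le; first by apply/cvg_ex; eexists; exact: L.
apply: nearW => m /=; apply: le_trans (nuW m); apply: le_measure; [by rewrite inE; exact: mI|by rewrite inE; exact: mW|].
by move=> x; apply => /=.
Qed.

(** The density is the Radon-Nikodym derivative of the Stieltjes measure of F restricted to ]0, T].
    The restriction makes this measure finite and allows ]-oo, x] in place of ]0, x], the form used
    by the differentiation theorem. *)
Lemma abs_cont_density T (F : cumulative R R) : 0 < T -> abs_cont T F ->
  exists g : R -> R, [/\ forall x, 0 <= g x,
    lambda.-integrable setT (EFin \o g) &
    forall x, 0 <= x <= T -> (F x - F 0)%:E = (\int[lambda]_(t in `]-oo, x]) (g t)%:E)%E].
Proof.
move=> T0 Fac; pose D : set (measurableTypeR R) := `]0, T]%classic.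
have mD : measurable D by exact: measurable_itv.
have finD : (lebesgue_stieltjes_measure F D < +oo)%E.
  by rewrite lebesgue_stieltjes_itv ?ltry// ltW.
pose nu : {finite_measure set measurableTypeR R -> \bar R} :=
  [the {finite_measure set _ -> \bar R} of mfrestr mD finD].
have nul : nu `<< lambda.
  move=> A A0 B mB BA; rewrite /nu/= /mfrestr/= /mrestr/=.
  apply: (abs_cont_null T0 Fac); first exact: measurableI.
    by move=> x [].
  apply: (subset_measure0 _ mB) => //; [exact: measurableI|].
  exact: A0.
have [f [f0 ffin fint fE]] := radon_nikodym_sigma_finite nul.
have fK x : (fine (f x))%:E = f x by rewrite fineK.
exists (fine \o f); split => [x /=||x /andP[x0 xT]].
- by rewrite fine_ge0.
- by apply: eq_integrable fint => // x _ /=; rewrite fK.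
- under eq_integral do rewrite /= fK.
  rewrite -fE; last exact: measurable_itv.
  rewrite /nu/= /mfrestr/= /mrestr/= -lebesgue_stieltjes_itv//; congr (_ _).
  apply/seteqP; split => y /=; rewrite /D/= !in_itv/=.
    by move=> /andP[y0 yx]; rewrite y0 yx (le_trans yx xT).
  by move=> [-> /andP[-> _]].
Qed.

Lemma clamp_continuous T : continuous (clamp T).
Proof.
move=> x; apply: (@continuous_max _ R (fun=> 0) (fun t => Num.min t T) x).
  exact: cvg_cst.
by apply: (@continuous_min _ R id (fun=> T) x); [exact: cvg_id|exact: cvg_cst].
Qed.

Lemma clamp_itv T t : 0 <= T -> 0 <= clamp T t <= T.
Proof. by move=> T0; rewrite /clamp le_max lexx/= ge_max T0 ge_min lexx orbT. Qed.

Lemma le_clamp T s t : s <= t -> clamp T s <= clamp T t.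
Proof.
move=> st; rewrite /clamp ge_max le_max lexx/= le_max.
by rewrite le_min !ge_min lexx orbT andbT st orbT.
Qed.

Lemma clamp_dist T s t : 0 <= T -> `|clamp T s - clamp T t| <= `|s - t|.
Proof.
move=> T0; have clE u : clamp T u = if u < 0 then 0 else if u < T then u else T.
  rewrite /clamp; case: (ltP u 0) => u0.
    by rewrite min_l ?max_l ?(ltW u0)//; exact: le_trans (ltW u0) T0.
  by case: (ltP u T) => uT; rewrite max_r.
wlog st : s t / s <= t => [hw|].
  by case: (leP s t) => [|/ltW] st; [exact: hw|rewrite distrC [leRHS]distrC; exact: hw].
rewrite !ler0_norm ?subr_le0 ?le_clamp// !clE.
by case: (ltP s 0) => s0; case: (ltP t 0) => t0; case: (ltP s T) => sT; case: (ltP t T) => tT;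
  lra.
Qed.

(** By additivity, an increment of the variation function is the variation over the interval.
    Degenerate intervals are dropped, because [abs_cont_TV] takes proper ones, and e is halved to
    recover a strict inequality. *)
Lemma abs_cont_total_variation T h : 0 < T -> abs_cont T h ->
  abs_cont T (fun t => fine (TV 0 (clamp T t) h)).
Proof.
move=> T0 hac e e0; have e20 : 0 < e / 2 by rewrite divr_gt0.
have [eta eta0 H] := abs_cont_TV hac e20; exists eta => // l lT lp leta.
have bv := abs_cont_bounded_variation T0 hac.
have fTV a b : 0 <= a -> a <= b -> b <= T -> TV a b h \is a fin_num.
  move=> a0 ab bT; apply/bounded_variationP => //.
  exact: (bounded_variationl ab bT (bounded_variationr a0 (le_trans ab bT) bv)).
pose l' := [seq x <- l | x.1 < x.2].
have sumE (G : R * R -> R) : (forall x, x.1 = x.2 -> G x = 0) ->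
    \sum_(x <- l) G x = \sum_(x <- l') G x.
  move=> G0; rewrite big_filter [RHS]big_mkcond/= big_seq [RHS]big_seq.
  apply: eq_bigr => x /(allP lT)/and3P[_ xx _]; case: ltP => // xx'.
  by apply/G0/eqP; rewrite eq_le xx.
rewrite sumE; last by move=> x ->; rewrite subrr normr0.
apply: (@le_lt_trans _ _ (e / 2)); last by rewrite ltr_pdivrMr// mulr2n mulrDr mulr1 ltrDl.
rewrite -lee_fin -sumEFin.
have -> : (\sum_(x <- l') `|fine (TV 0 (clamp T x.2) h) - fine (TV 0 (clamp T x.1) h)|%:E =
    \sum_(x <- l') TV x.1 x.2 h)%E.
  rewrite big_seq [RHS]big_seq; apply: eq_bigr => x; rewrite mem_filter => /andP[xx].
  move=> /(allP lT)/and3P[x0 _ xT].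
  rewrite !clamp_id ?x0 ?xT ?(le_trans x0 (ltW xx)) ?(le_trans (ltW xx) xT)//.
  rewrite (@total_variationD _ 0 x.2 x.1)//; last exact: ltW.
  rewrite fineD ?fTV ?(ltW xx) ?(le_trans (ltW xx) xT)//.
  rewrite addrAC subrr add0r ger0_norm ?fineK ?fTV// ?(ltW xx)//.
  by rewrite fine_ge0// total_variation_ge0// ltW.
apply: H.
- apply/allP => x; rewrite mem_filter => /andP[xx] /(allP lT)/and3P[-> _ ->].
  by rewrite xx.
- exact: pairwise_filter.
- by rewrite -sumE// => x ->; rewrite subrr.
Qed.

Lemma abs_contD T f g : abs_cont T f -> abs_cont T g -> abs_cont T (f \+ g).
Proof.
move=> fac gac e e0; have e20 : 0 < e / 2 by rewrite divr_gt0.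
have [u u0 U] := fac _ e20; have [v v0 V] := gac _ e20.
exists (Num.min u v); first by rewrite lt_min u0.
move=> l lT lp; rewrite lt_min => /andP[lu lv].
rewrite (splitr e); apply: le_lt_trans (ltrD (U _ lT lp lu) (V _ lT lp lv)).
rewrite -big_split; apply: ler_sum => x _ /=.
by rewrite opprD addrACA; exact: ler_normD.
Qed.

Lemma abs_contN T f : abs_cont T f -> abs_cont T (\- f).
Proof.
move=> fac e e0; have [u u0 U] := fac _ e0; exists u => // l lT lp lu.
apply: le_lt_trans (U _ lT lp lu); apply: ler_sum => x _ /=.
by rewrite opprK addrC distrC.
Qed.

(** Jordan decomposition: with V the variation function, V and V - h are nondecreasing, continuous
    and absolutely continuous. The difference of their densities is a density of h, and Lebesgue's
    differentiation theorem identifies it with the derivative. *)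
Lemma abs_cont_FTC T h : 0 < T -> abs_cont T h -> continuous h ->
  (forall t, h t = h (clamp T t)) ->
  exists g : R -> R, [/\ lambda.-integrable setT (EFin \o g),
    forall x, 0 <= x <= T -> h x - h 0 = \int[lambda]_(t in `]-oo, x]) (g t) &
    {ae lambda, forall x, 0 < x < T -> derive1 h x = g x}].
Proof.
move=> T0 hac hc hf; have bv := abs_cont_bounded_variation T0 hac.
pose V t := fine (TV 0 (clamp T t) h).
have clT t : 0 <= clamp T t <= T by apply: clamp_itv; exact: ltW.
have fTV a b : 0 <= a -> a <= b -> b <= T -> TV a b h \is a fin_num.
  move=> a0 ab bT; apply/bounded_variationP => //.
  exact: (bounded_variationl ab bT (bounded_variationr a0 (le_trans ab bT) bv)).
have dV a b : a <= b -> V b - V a = fine (TV (clamp T a) (clamp T b) h).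
  move=> /(le_clamp T) ab; have /andP[a0 aT] := clT a; have /andP[b0 bT] := clT b.
  rewrite /V (@total_variationD _ 0 (clamp T b) (clamp T a))//.
  by rewrite fineD ?fTV// addrAC subrr add0r.
have ndV : {homo V : a b / a <= b}.
  move=> a b ab; rewrite -subr_ge0 dV// fine_ge0// total_variation_ge0//.
  exact: le_clamp.
have cV : continuous V.
  have cTV := @total_variation_continuous R 0 T h T0 (continuous_subspaceT hc) bv.
  move=> x; apply: (@cvg_comp _ _ _ (clamp T) (fun t => fine (TV 0 t h)) _
    (within `[0, T] (nbhs (clamp T x)))).
    move=> A /= nA; have /= := @clamp_continuous T x _ nA.
    by apply: (@filterS _ (nbhs x)) => y; apply => /=; rewrite in_itv/=; exact: clT.
  by have := cTV (clamp T x); rewrite /continuous_at nbhs_subspace_in//= in_itv/=.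
have ndW : {homo (V \- h) : a b / a <= b}.
  move=> a b ab; suff : h b - h a <= V b - V a by rewrite /=; lra.
  rewrite dV// (hf b) (hf a).
  apply: (le_trans (ler_norm _)); rewrite -lee_fin fineK.
    by apply: total_variation_ge; exact: le_clamp.
  have /andP[a0 aT] := clT a; have /andP[b0 bT] := clT b.
  by apply: fTV => //; exact: le_clamp.
pose VV : cumulative R R := HB.pack V (isCumulative.Build R _ R V ndV (right_continuousW cV)).
have cW : continuous (V \- h) by move=> x; apply: cvgB; [exact: cV|exact: hc].
pose WW : cumulative R R := HB.pack (V \- h) (isCumulative.Build R _ R _ ndW (right_continuousW cW)).
have Vac : abs_cont T VV by exact: abs_cont_total_variation.
have Wac : abs_cont T WW by apply: abs_contD => //; exact: abs_contN.
have [g1 [g10 g1i g1E]] := abs_cont_density T0 Vac.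
have [g2 [g20 g2i g2E]] := abs_cont_density T0 Wac.
have gi : lambda.-integrable setT (EFin \o (g1 \- g2)).
  by rewrite (_ : _ \o _ = (EFin \o g1) \- (EFin \o g2))%E//; exact: integrableB.
have hE x : 0 <= x <= T -> h x - h 0 = \int[lambda]_(t in `]-oo, x]) ((g1 \- g2) t).
  move=> xT; apply/EFin_inj => /=.
  have -> : h x - h 0 = (VV x - VV 0) - (WW x - WW 0) by rewrite /=; ring.
  rewrite EFinB g1E// g2E//.
  rewrite -integralB//=; last 2 first.
    exact: integrableS g1i.
    exact: integrableS g2i.
  rewrite /Rintegral fineK//; apply: integrable_fin_num => //.
  exact: (integrableS _ _ _ gi).
exists (g1 \- g2); split => //.
have loc : locally_integrable setT (g1 \- g2).
  by apply: open_integrable_locally => //; exact: openT.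
have gy (y : R) : lambda.-integrable `]-oo, y] (EFin \o (g1 \- g2)).
  exact: integrableS gi.
have := FTC1Ny gy loc.
apply: filterS; first exact: (ae_filter_ringOfSetsType lambda).
move=> x /= [dx <-] /andP[x0 xT].
rewrite !derive1E.
set G := (X in _ = 'D_1 X x).
(* The primitive [G] equals h - h 0 only on [0, T], hence near the interior point x; this is all
   that a derivative sees. *)
have -> : 'D_1 G x = 'D_1 (G \+ cst (h 0)) x by rewrite deriveD// derive_cst addr0.
apply: near_eq_derive; near=> y; rewrite /= /cst.
suff -> : G y = h y - h 0 by rewrite subrK.
apply/esym/hE/andP; split; apply: ltW; near: y.
  exact: lt_nbhsr.
exact: lt_nbhsl.
Unshelve. all: by end_near. Qed.

End absolute_continuity.

(** * Integrals of possibly non-measurable functions *)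

Section lower_integral.
Context d (X : measurableType d) (R : realType) (mu : {measure set X -> \bar R}).

(* The integral of a nonnegative function is a lower integral, so the larger
   function need not be measurable. *)
Lemma ge0_le_lower_integral (D : set X) (f g : X -> \bar R) :
  (forall x, D x -> (0 <= f x)%E) -> (forall x, D x -> (f x <= g x)%E) ->
  (\int[mu]_(x in D) f x <= \int[mu]_(x in D) g x)%E.
Proof.
move=> f0 fg; have g0 x : D x -> (0 <= g x)%E.
  by move=> Dx; exact: le_trans (f0 _ Dx) (fg _ Dx).
rewrite !ge0_integralE//; apply: ereal_sup_le => _ [h hf <-].
exists h => //= x; apply: le_trans (hf x) _.
by rewrite !patchE; case: ifPn => // /[!inE]; exact: fg.
Qed.

(** Deleting the null set from the smaller function, which is measurable, leaves its integral
    unchanged; what remains is a pointwise comparison, for which the larger one may be arbitrary. *)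
Lemma ge0_ae_le_lower_integral (D N : set X) (f g : X -> \bar R) :
  measurable D -> mu.-negligible N -> measurable_fun D f ->
  (forall x, D x -> (0 <= f x)%E) -> (forall x, D x -> (0 <= g x)%E) ->
  (forall x, D x -> ~ N x -> (f x <= g x)%E) ->
  (\int[mu]_(x in D) f x <= \int[mu]_(x in D) g x)%E.
Proof.
move=> mD [B [mB B0 NB]] mf f0 g0 fg.
rewrite (@ge0_negligible_integral _ _ _ mu D B)//.
apply: (@le_trans _ _ (\int[mu]_(x in D) (f \_ (~` B)) x)%E).
  by rewrite setDE integral_mkcondr.
apply: ge0_le_lower_integral => x Dx; rewrite patchE; case: ifPn => //.
- by move=> _; exact: f0.
- by rewrite inE => Bx; apply: fg => // /NB.
- by move=> _; exact: g0.
Qed.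

End lower_integral.

Section integrable_real.
Context d (X : measurableType d) (R : realType) (mu : {measure set X -> \bar R}).
Variables (D : set X) (mD : measurable D).
Implicit Types f g : X -> R.
Local Notation rint f := (mu.-integrable D (EFin \o f)).

Lemma integrable_realD f g : rint f -> rint g -> rint (fun x => f x + g x).
Proof. exact: integrableD. Qed.

Lemma integrable_realB f g : rint f -> rint g -> rint (fun x => f x - g x).
Proof. exact: integrableB. Qed.

Lemma integrable_realZl c f : rint f -> rint (fun x => c * f x).
Proof. exact: integrableZl. Qed.

Lemma integrable_real_sum (I : Type) (s : seq I) (f : I -> X -> R) :
  (forall i, rint (f i)) -> rint (fun x => \sum_(i <- s) f i x).
Proof.
move=> fi; elim: s => [|i s ih].
  by under [X in integrable _ _ X]funext => x do rewrite /= big_nil; exact: integrable0.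
under [X in integrable _ _ X]funext => x do rewrite /= big_cons.
exact: integrable_realD.
Qed.

Lemma integrable_real_le f g : measurable_fun D f -> rint g ->
  (forall x, D x -> `|f x| <= g x) -> rint f.
Proof.
move=> mf gi fg; apply: le_integrable gi => //; first exact/measurable_EFinP.
move=> x Dx /=; rewrite lee_fin; apply: le_trans (fg x Dx) _; exact: ler_norm.
Qed.

Lemma integrable_real_measurable f : rint f -> measurable_fun D f.
Proof. by move=> /measurable_int/measurable_EFinP. Qed.

End integrable_real.

Lemma measurable_norm_powR d (X : measurableType d) (R : realType) (D : set X)
    (f : X -> R) (p : R) :
  measurable_fun D f -> measurable_fun D (fun x => `|f x| `^ p).
Proof.
move=> mf; apply: (measurableT_comp (@measurable_powR R p)).
exact: measurableT_comp.
Qed.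

(** * The energy of increments is bounded by the cost *)

Section energy.
Context {R : realType}.
Local Notation lambda := (@lebesgue_measure R).

(** With m the mean of |g|, Young's inequality for |g| and m^(p-1) integrates to m^p (b - a) <= J /
    p + m^p (b - a) / q, where J is the integral of |g|^p, and 1 - 1/q = 1/p. This is Jensen's
    argument with the tangent at m. *)
Lemma Rintegral_jensen (p a b : R) (g : R -> R) : 1 < p -> a < b ->
  lambda.-integrable `]a, b] (EFin \o g) ->
  ((`|\int[lambda]_(t in `]a, b]) g t| `^ p / (b - a) `^ (p - 1))%:E <=
   \int[lambda]_(t in `]a, b]) (`|g t| `^ p)%:E)%E.
Proof.
move=> p1 ab gi; have p0 : 0 < p by exact: lt_trans p1.
set I := (X in (_ <= X)%E); have [->|Iy] := eqVneq I +oo%E; first exact: leey.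
have mg : measurable_fun `]a, b] g.
  by apply/measurable_EFinP; exact: measurable_int gi.
have I0 : (0 <= I)%E by apply: integral_ge0 => t _; rewrite lee_fin powR_ge0.
have gpi : lambda.-integrable `]a, b] (EFin \o (fun t => `|g t| `^ p)).
  apply/integrableP; split.
    by apply/measurable_EFinP; exact: measurable_norm_powR.
  under eq_integral do rewrite gee0_abs ?lee_fin ?powR_ge0//.
  by rewrite -/I ltey.
have absi : lambda.-integrable `]a, b] (EFin \o (fun t => `|g t|)).
  exact: integrable_norm gi.
pose m := (\int[lambda]_(t in `]a, b]) `|g t|) / (b - a).
have ba : 0 < b - a by rewrite subr_gt0.
have A0 : 0 <= \int[lambda]_(t in `]a, b]) `|g t| by exact: Rintegral_ge0.
have m0 : 0 <= m by rewrite divr_ge0// ltW.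
pose q := p / (p - 1).
have pm1 : 0 < p - 1 by rewrite subr_gt0.
have q0 : 0 < q by rewrite divr_gt0.
have pq : p^-1 + q^-1 = 1 
  by rewrite /q invf_div -[X in X + _]mul1r -mulrDl addrC subrK divff ?gt_eqF.
have young t : `|g t| * m `^ (p - 1) <= `|g t| `^ p / p + m `^ p / q.
  have := @conjugate_powR R `|g t| (m `^ (p - 1)) p q (normr_ge0 _) (powR_ge0 _ _) p0 q0 pq.
  by rewrite -powRrM mulrCA divff ?gt_eqF// mulr1.
have lab : lambda `]a, b]%classic = (b - a)%:E.
  by rewrite lebesgue_measure_itv/= lte_fin ab EFinB.
have ci (c : R) : lambda.-integrable `]a, b] (EFin \o (fun=> c)).
  have laby : (lambda `]a, b]%classic < +oo)%E by rewrite lab ltry.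
  apply: (measurable_bounded_integrable _ laby) => //.
  by exists `|c|; split=> [|M cM x _]; [exact: num_real|exact: ltW].
have : \int[lambda]_(t in `]a, b]) (`|g t| * m `^ (p - 1)) <=
       \int[lambda]_(t in `]a, b]) (`|g t| `^ p / p + m `^ p / q).
  apply: le_Rintegral => //.
  - exact: (integrableZr _ _ absi).
  - by apply: integrable_realD => //; exact: (integrableZr _ _ gpi).
rewrite RintegralZr// RintegralD//; last exact: (integrableZr _ _ gpi).
have cE (c : R) : \int[lambda]_(_ in `]a, b]) c = c * (b - a).
  by rewrite Rintegral_cst//; congr (_ * _); exact: (congr1 fine lab).
rewrite RintegralZr// cE.
have Am : \int[lambda]_(t in `]a, b]) `|g t| = m * (b - a) by rewrite /m divfK// gt_eqF.
rewrite Am mulrAC mulr_powRB1//.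
have -> : q^-1 = 1 - p^-1 by rewrite -pq addrAC subrr add0r.
set J := Rintegral _ _ _ => mJ.
have {}mJ : m `^ p * (b - a) <= J.
  suff : p^-1 * (m `^ p * (b - a)) <= p^-1 * J by rewrite ler_pM2l ?invr_gt0.
  by move: mJ; lra.
have IJ : I = J%:E.
  rewrite /J /Rintegral fineK// ge0_fin_numE; first by rewrite -/I ltey.
  exact: I0.
rewrite IJ lee_fin; apply: le_trans mJ.
have bap : (b - a) `^ p = (b - a) * (b - a) `^ (p - 1) by rewrite mulr_powRB1// ltW.
have bap0 : 0 < (b - a) `^ (p - 1) by rewrite powR_gt0.
rewrite ler_pdivrMr//.
rewrite (_ : _ * _ * _ = m `^ p * (b - a) `^ p); last by rewrite bap mulrA.
rewrite -powRM//; last exact: ltW.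
rewrite -Am; apply: ge0_ler_powR; rewrite ?nnegrE//; first exact: ltW.
exact: le_normr_Rintegral.
Qed.

(* The second conjunct is stated off a null set because [derive1 h] is not known
   to be measurable. *)
Lemma abs_cont_energy (p T : R) (h : R -> R) :
  1 < p -> 0 < T -> abs_cont T h -> continuous h ->
  (forall t, h t = h (clamp T t)) ->
  exists G : R -> R, [/\ measurable_fun setT G,
    {ae lambda, forall t, 0 < t < T -> `|derive1 h t| `^ p = G t},
    (forall t, 0 <= G t) &
    forall (n : nat) (tau : nat -> R),
    0 <= tau 0%N -> tau n <= T -> (forall j, (j < n)%N -> tau j < tau j.+1) ->
    ((\sum_(j < n) `|h (tau j.+1) - h (tau j)| `^ p / (tau j.+1 - tau j) `^ (p - 1))%:E
     <= \int[lambda]_(t in `[0%R, T]) (G t)%:E)%E].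
Proof.
move=> p1 T0 hac hc hf.
have [g [gi hE aeE]] := abs_cont_FTC T0 hac hc hf.
have mG : measurable_fun setT (fun t => `|g t| `^ p).
  apply: measurable_norm_powR.
  by apply/measurable_EFinP; exact: measurable_int gi.
have mg : measurable_fun setT (fun t => (`|g t| `^ p)%:E) by exact/measurable_EFinP.
exists (fun t => `|g t| `^ p); split=> //.
  apply: filterS aeE; first exact: (ae_filter_ringOfSetsType lambda).
  by move=> t /= gE /gE ->.
move=> n tau tau0 tauT tauS.
have taule i j : (i <= j)%N -> (j <= n)%N -> tau i <= tau j.
  elim: j => [|j ih]; first by rewrite leqn0 => /eqP->.
  rewrite leq_eqVlt => /predU1P[->//|ij] jn.
  by rewrite (le_trans (ih ij (ltnW jn)))// ltW// tauS.
have tau_itv j : (j <= n)%N -> 0 <= tau j <= T.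
  by move=> jn; rewrite (le_trans tau0 (taule _ _ _ jn))// (le_trans (taule _ _ jn _)).
pose D j : set R := if (j < n)%N then `]tau j, tau j.+1]%classic else set0.
have mD j : measurable (D j) by rewrite /D; case: ifP.
have tD : trivIset setT D.
  apply/trivIsetP => i j _ _; wlog ij : i j / (i < j)%N.
    move=> w; rewrite neq_ltn => /orP[ij|ji]; first by apply: w => //; rewrite ltn_eqF.
    by rewrite setIC; apply: w => //; rewrite ltn_eqF.
  move=> _; rewrite /D; case: ltnP => _; last by rewrite set0I.
  case: ltnP => jn; last by rewrite setI0.
  rewrite -subset0 => x [] /=; rewrite !in_itv/= => /andP[_ xi] /andP[jx _].
  by have := le_lt_trans (taule _ _ ij (ltnW jn)) jx; rewrite ltNge xi.
apply: (@le_trans _ _ (\int[lambda]_(t in \big[setU/set0]_(j <- index_iota 0 n) D j) (`|g t| `^ p)%:E)%E).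
  rewrite (ge0_integral_bigsetU lambda mD (iota_uniq _ _)); last 3 first.
  - exact: sub_trivIset tD.
  - exact: measurable_funTS.
  - by move=> t _; rewrite lee_fin powR_ge0.
  rewrite -sumEFin big_mkord; apply: lee_sum => j _.
  have jn := ltn_ord j.
  have -> : h (tau j.+1) - h (tau j) = \int[lambda]_(t in `]tau j, tau j.+1]) g t.
    have -> : h (tau j.+1) - h (tau j) = (h (tau j.+1) - h 0) - (h (tau j) - h 0) by ring.
    rewrite !hE ?tau_itv// ?(ltnW jn)//.
    rewrite (Rintegral_itvB (a := -oo%O) (b := BRight (tau j.+1)))//; first exact: integrableS gi.
    by rewrite bnd_simp ltW// tauS.
  rewrite /D jn; apply: Rintegral_jensen => //; first exact: tauS.
  exact: integrableS gi.
apply: ge0_subset_integral => //.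
- by apply: bigsetU_measurable => j _; exact: mD.
- exact: measurable_funTS.
rewrite big_mkord -bigcup_mkord => t [j jn]; rewrite /D; case: ifP => // _ /=.
rewrite !in_itv/= => /andP[jt tj].
have /andP[j0 _] := tau_itv _ (ltnW jn); have /andP[_ jT] := tau_itv _ jn.
by rewrite (le_trans j0 (ltW jt)) (le_trans tj jT).
Qed.

Lemma lnorm_powR d (r : R) (x : 'rV[R]_d) : 0 < r ->
  lnorm r x `^ r = \sum_(i < d) `|x 0 i| `^ r.
Proof.
move=> r0; rewrite /lnorm -powRrM mulVf ?gt_eqF// powRr1//.
by apply: sumr_ge0 => i _; exact: powR_ge0.
Qed.

Lemma coord_le_lnorm d (r : R) (x : 'rV[R]_d) i : 0 < r -> `|x 0 i| <= lnorm r x.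
Proof.
move=> r0; have : `|x 0 i| `^ r <= lnorm r x `^ r.
  rewrite lnorm_powR// (bigD1 i)//= lerDl; apply: sumr_ge0 => j _; exact: powR_ge0.
move=> h; rewrite leNgt; apply/negP => /(gt0_ltr_powR r0).
by rewrite !nnegrE ltNge h => /(_ (powR_ge0 _ _) (normr_ge0 _)).
Qed.

(** A list of ordered intervals is a particular finite family of non-overlapping intervals, so the
    definition by families implies the one by lists. *)
Lemma abs_continuous_coord d (T p : R) (h : R -> 'rV[R]_d) i : 0 < p ->
  abs_continuous T p h -> abs_cont T (fun t => h t 0 i).
Proof.
move=> p0 hac e e0; have [eta eta0 H] := hac e e0; exists eta => // l lT lp leta.
pose n := size l; pose a (k : 'I_n) := (nth (0, 0) l k).1.
pose b (k : 'I_n) := (nth (0, 0) l k).2.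
have sumE (G : R * R -> R) : \sum_(x <- l) G x = \sum_(k < n) G (a k, b k).
  rewrite (big_nth (0, 0)) big_mkord; apply: eq_bigr => k _.
  by rewrite /a /b -surjective_pairing.
have ab k : [&& 0 <= a k, a k <= b k & b k <= T] by apply: (all_nthP (0, 0) lT).
have lt_ab (j k : 'I_n) : (j < k)%N -> b j <= a k.
  by move=> jk; move/(pairwiseP (0, 0)): lp; apply; rewrite ?inE.
rewrite sumE; apply: le_lt_trans (H n a b _ _ _).
- apply: ler_sum => k _ /=; apply: le_trans (coord_le_lnorm _ i p0).
  by rewrite !mxE.
- by move=> k; have /and3P[] := ab k.
- by move=> j k; rewrite -val_eqE/= neq_ltn => /orP[] /lt_ab; [left|right].
- by rewrite -(sumE (fun x => x.2 - x.1)).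
Qed.

Lemma poweRVK (p : R) (x : \bar R) : 0 < p -> (0 <= x)%E -> ((x `^ p^-1) `^ p = x)%E.
Proof.
move=> p0 x0; rewrite -poweRrM ?mulVf ?gt_eqF// ?poweRe1//.
Qed.

(** Coordinatewise energy bounds add up to a bound by the integral of the measurable sum of the
    [G i]; almost everywhere this sum is the integrand of the cost. *)
Lemma cost_energy d (p T : R) (x y : C0_path T d) : 1 < p -> 0 < T ->
  forall (n : nat) (tau : nat -> R),
  0 <= tau 0%N -> tau n <= T -> (forall j, (j < n)%N -> tau j < tau j.+1) ->
  ((\sum_(j < n) \sum_(i < d)
     `|(x (tau j.+1) 0 i - y (tau j.+1) 0 i) - (x (tau j) 0 i - y (tau j) 0 i)| `^ p
      / (tau j.+1 - tau j) `^ (p - 1))%:E <= cost T p x y)%E.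
Proof.
move=> p1 T0 n tau tau0 tauT tauS; have p0 : 0 < p by exact: lt_trans p1.
rewrite /cost; case: ifPn => [/asboolP[h0 hac _]|_]; last exact: leey.
rewrite /W1p_norm poweRVK//; last first.
  by apply: integral_ge0 => t _; rewrite lee_fin powR_ge0.
set h := (fun t => x t - y t) in h0 hac *.
have coordc (w : C0_path T d) (i : 'I_d) : continuous (fun t => w t 0 i).
  move=> t; apply: (@cvg_comp _ _ _ w (fun M : 'rV[R]_d => M 0 i) _ (nbhs (w t))).
    exact: C0_continuous.
  exact: coord_continuous.
have hc i : continuous (fun t => h t 0 i).
  rewrite (_ : (fun t => _) = (fun t => x t 0 i - y t 0 i)).
    by move=> t; apply: cvgB; exact: coordc.
  by apply/funext => t; rewrite /h !mxE.
have hf i t : h t 0 i = h (clamp T t) 0 i by rewrite /h (C0_frozen x t) (C0_frozen y t).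
have hi i := abs_continuous_coord i p0 hac.
have [G GP] := choice (fun i => abs_cont_energy p1 T0 (hi i) (hc i) (hf i)).
apply: (@le_trans _ _ (\int[lambda]_(t in `[0%R, T]) (\sum_(i < d) G i t)%:E)%E).
  under eq_integral do rewrite -sumEFin.
  rewrite ge0_integral_sum//; last 2 first.
  - by move=> i; apply/measurable_EFinP; apply: measurable_funTS; have [] := GP i.
  - by move=> i t _; rewrite lee_fin; have [] := GP i.
  rewrite exchange_big/= -sumEFin; apply: lee_sum => i _.
  have [_ _ _ /(_ n tau tau0 tauT tauS)] := GP i.
  have xyE t : h t 0 i = x t 0 i - y t 0 i by rewrite /h !mxE.
  move=> en; apply: le_trans en; rewrite lee_fin; apply: ler_sum => j _.
  by rewrite !xyE.
have aeG : {ae lambda, forall t, forall i, 0 < t < T ->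
    `|derive1 (fun s => h s 0 i) t| `^ p = G i t}.
  (* The exceptional sets of the coordinates are united over all naturals; indices at least d are
     vacuous. *)
  have /ae_foralln : forall k : nat, {ae lambda, forall t, forall i : 'I_d, i = k :> nat ->
      0 < t < T -> `|derive1 (fun s => h s 0 i) t| `^ p = G i t}.
    move=> k; have [kd|dk] := ltnP k d; last first.
      apply: aeW => t i ik; have := ltn_ord i; rewrite ik ltnNge dk.
      by [].
    have [_ GE _ _] := GP (Ordinal kd).
    apply: filterS GE; first exact: (ae_filter_ringOfSetsType lambda).
    by move=> t /= Gt i ik; rewrite (_ : i = Ordinal kd)//; exact: val_inj.
  move=> aeH; apply: (negligibleS _ aeH) => t.
  by apply: contra_not => Gt i; exact: Gt.
pose P := [set t : R | forall i, 0 < t < T ->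
    `|derive1 (fun s => h s 0 i) t| `^ p = G i t].
(* The end points 0 and T join the exceptional set because the derivatives are identified on the
   open interval only. *)
apply: (@ge0_ae_le_lower_integral _ _ _ _ _ (~` P `|` [set 0; T] : set (measurableTypeR R))).
- exact: measurable_itv.
- apply: negligibleU; first exact: aeG.
  apply/negligibleP; first exact: measurableU.
  by apply: countable_lebesgue_measure0; apply: finite_set_countable.
- apply/measurable_EFinP; apply: measurable_funTS; apply: measurable_sum => i.
  by have [] := GP i.
- by move=> t _; rewrite lee_fin sumr_ge0// => i _; have [] := GP i.
- by move=> t _; rewrite lee_fin powR_ge0.
- move=> t /=; rewrite in_itv/= => /andP[t0 tT] /not_orP[/contrapT Pt /not_orP[nt0 ntT]].
  rewrite lee_fin lnorm_powR//; apply: ler_sum => i _.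
  rewrite /path_derive mxE Pt// !lt_neqAle t0 tT !andbT; apply/andP; split.
    by apply/eqP => /esym.
  exact/eqP.
Qed.

End energy.

Lemma countable_bigcapT_measurable d (Y : measurableType d) (I : countType)
    (F : I -> set Y) : (forall i, measurable (F i)) -> measurable (\bigcap_i F i).
Proof.
move=> mF; rewrite -[X in measurable X]setCK setC_bigcap; apply: measurableC.
apply: countable_bigcupT_measurable => [|i]; first exact: countableP.
exact: measurableC.
Qed.

Lemma ltr_dist_itv (R : realType) (x y e : R) : x - e < y -> y < x + e -> `|x - y| < e.
Proof. by move=> *; rewrite ltr_norml; apply/andP; split; lra. Qed.

(** * Topology and measurability of the path space *)

Section path_space.
Context {R : realType} {T : R} {d : nat}.
Hypothesis T0 : 0 < T.
Local Notation X := (C0_path T d).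
Local Notation D := (cadlag_path T d).
Implicit Types (x y : X) (s t e : R) (i : 'I_d).

(** The carrier [S] is generic so that the description serves continuous and cadlag paths alike. *)
Lemma uniform_nbhs_coordP (S : choiceType) (v : S -> R -> 'rV[R]_d)
    (F : S -> {uniform` `[0, T] -> 'rV[R]_d}) (w : S) (A : set S) : (forall u, F u = v u) ->
  nbhs (w : initial_topology F) A <->
  exists2 eta : R, 0 < eta &
    forall w', (forall t i, 0 <= t <= T -> `|v w' t 0 i - v w t 0 i| < eta) -> A w'.
Proof.
move=> Fv; split.
  move=> [_ [[B oB <-] Bw BA]].
  have /uniform_nbhs[E [entE EB]] : nbhs (F w) B by exact: open_nbhs_nbhs.
  have [eta /= eta0 etaE] : filter_from [set x : R | 0 < x]
      (fun e => [set xy : 'rV[R]_d * 'rV[R]_d | ball xy.1 e xy.2]) E.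
    by rewrite entourage_from_ballE.
  exists eta => // w' ww'; apply/BA/EB => t /= tT; apply: etaE => /=; split => //.
  move=> j i; rewrite /ball/= !Fv (ord1 j) distrC; apply: ww'.
  by move: tT; rewrite in_itv.
move=> [eta eta0 H].
have : nbhs (F w) [set h : R -> 'rV[R]_d | forall t, `[0, T]%classic t -> ball (v w t) eta (h t)].
  apply/uniform_nbhs; exists [set xy : 'rV[R]_d * 'rV[R]_d | ball xy.1 eta xy.2]; split.
    by rewrite -entourage_from_ballE; exists eta.
  by move=> h /= hw t tT; rewrite -Fv; exact: hw.
move=> nb; have [B [oB Bw BA]] := @initial_continuous _ _ F w _ nb.
exists B; split=> // w' /BA /= ww'; apply: H => t i tT; have /ww'[_ /(_ 0 i)] : `[0, T]%classic t by rewrite /= in_itv.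
by rewrite /ball/= Fv distrC.
Qed.

Lemma nbhs_C0P x (A : set X) : nbhs x A <->
  exists2 eta : R, 0 < eta &
    forall y, (forall t i, 0 <= t <= T -> `|y t 0 i - x t 0 i| < eta) -> A y.
Proof. exact: uniform_nbhs_coordP. Qed.

Lemma nbhs_cadlagP (w : D) (A : set D) : nbhs w A <->
  exists2 eta : R, 0 < eta &
    forall w' : D, (forall t i, 0 <= t <= T -> `|w' t 0 i - w t 0 i| < eta) -> A w'.
Proof. exact: uniform_nbhs_coordP. Qed.

Lemma C0_path_eq x y : (forall t i, 0 <= t <= T -> x t 0 i = y t 0 i) -> x = y.
Proof.
move=> xy; have : C0_val x = C0_val y.
  apply/funext => t; rewrite (C0_frozen x) (C0_frozen y); apply/rowP => i.
  by apply: xy; apply: clamp_itv; exact: ltW.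
case: x y {xy} => [f f1 f2 f3] [g g1 g2 g3] /= fg; subst g.
by congr C0Path; exact: Prop_irrelevance.
Qed.

Lemma cadlag_path_eq (w w' : D) : (forall t, w t = w' t) -> w = w'.
Proof.
move=> /funext; case: w w' => [f f1 f2] [g g1 g2] /= fg; subst g.
by congr CadlagPath; exact: Prop_irrelevance.
Qed.

Lemma C0_coord_continuous x i : continuous (fun t => x t 0 i).
Proof.
move=> t; apply: (@cvg_comp _ _ _ x (fun M : 'rV[R]_d => M 0 i) _ (nbhs (x t))).
  exact: C0_continuous.
exact: coord_continuous.
Qed.

(** Heine's theorem on the compact [0, T]; since the clamp is 1-Lipschitz, the modulus extends to
    all real times. *)
Lemma C0_unif_continuous x e : 0 < e -> exists2 delta : R, 0 < delta &
  forall s t i, `|s - t| < delta -> `|x s 0 i - x t 0 i| < e.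
Proof.
move=> e0.
have : \forall delta \near (0 : R)^'+, forall t, `[0, T]%classic t ->
    forall s, `|s - t| < delta -> forall i, `|x s 0 i - x t 0 i| < e.
  have cT : compact `[0, T]%classic by exact: segment_compact.
  move/compact_near_coveringP : cT; apply => t _.
  have e20 : 0 < e / 2 by rewrite divr_gt0.
  have : \forall s \near t, forall i, `|x t 0 i - x s 0 i| < e / 2.
    have xc := @C0_continuous _ _ _ x t.
    have : nbhs (x t) [set M : 'rV[R]_d | ball (x t) (e / 2) M] by exact: nbhsx_ballx.
    by move=> /xc; apply: (@filterS _ (nbhs t)) => s [_ H] i; exact: H.
  move=> [r /= r0 H].
  exists ([set t' | `|t - t'| < r / 2], [set delta | delta < r / 2]).
    split => /=; first by exists (r / 2) => //=; rewrite divr_gt0.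
    by apply: nbhs_right_lt; rewrite divr_gt0.
  move=> [t' delta] [/= tt' dr] s st i.
  have -> : x s 0 i - x t' 0 i = (x t 0 i - x t' 0 i) - (x t 0 i - x s 0 i) by ring.
  rewrite (splitr e); apply: le_lt_trans (ler_normB _ _) _; apply: ltrD; apply: H => /=.
    by rewrite (lt_trans tt')// ltr_pdivrMr// ltr_pMr// ltrDl.
  have -> : t - s = (t - t') - (s - t') by ring.
  rewrite (splitr r); apply: le_lt_trans (ler_normB _ _) _; apply: ltrD => //.
  exact: lt_trans dr.
move=> near_d; have near_gt0 : \forall delta \near (0 : R)^'+, 0 < delta by exact: nbhs_right_gt.
have [delta [H d0]] := @filter_ex _ _ _ _ (filterI near_d near_gt0).
exists delta => // s t i st; rewrite (C0_frozen x s) (C0_frozen x t).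
apply: H; first by rewrite /= in_itv/=; apply: clamp_itv; exact: ltW.
by apply: le_lt_trans st; apply: clamp_dist; exact: ltW.
Qed.

Lemma C0_bounded x : exists2 M : R, 0 <= M & forall t i, `|x t 0 i| <= M.
Proof.
have H i : exists M : R, forall t, 0 <= t <= T -> `|x t 0 i| <= M.
  have [|c _ cM] := @EVT_max R (fun t => `|x t 0 i|) 0 T (ltW T0).
    apply: continuous_subspaceT => t.
    by apply: (@cvg_norm _ R^o); exact: C0_coord_continuous.
  by exists `|x c 0 i| => t tT; apply: cM; rewrite in_itv.
have [M MP] := choice H; exists (\sum_i `|M i|); first exact: sumr_ge0.
move=> t i; rewrite (C0_frozen x).
apply: (le_trans (MP i _ (clamp_itv _ (ltW T0)))).
apply: (le_trans (ler_norm _)); rewrite (bigD1 i)//= lerDl; exact: sumr_ge0.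
Qed.

(** The uniform norm for the maximum norm on coordinates, equivalent to [sup_lnorm] on continuous
    paths. The value 0 is adjoined so that the set is nonempty even when d = 0. *)
Definition psup (v : R -> 'rV[R]_d) : R :=
  sup [set r | r = 0 \/ exists t i, 0 <= t <= T /\ r = `|v t 0 i|].

Lemma psup_le (v : R -> 'rV[R]_d) (M : R) : 0 <= M ->
  (forall t i, 0 <= t <= T -> `|v t 0 i| <= M) -> psup v <= M.
Proof.
move=> M0 vM; apply: ge_sup; first by exists 0; left.
by move=> _ [->//|[t [i [tT ->]]]]; exact: vM.
Qed.

Lemma psup_ubound (v : R -> 'rV[R]_d) (M : R) :
  (forall t i, 0 <= t <= T -> `|v t 0 i| <= M) ->
  forall r, (r = 0 \/ exists t i, 0 <= t <= T /\ r = `|v t 0 i|) -> r <= psup v.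
Proof.
move=> vM r rv; apply: ub_le_sup => //; exists (Num.max M 0).
move=> _ [->|[t [i [tT ->]]]]; first by rewrite le_max lexx orbT.
by rewrite le_max vM.
Qed.

Lemma psup_ge (v : R -> 'rV[R]_d) (M : R) :
  (forall t i, 0 <= t <= T -> `|v t 0 i| <= M) ->
  forall t i, 0 <= t <= T -> `|v t 0 i| <= psup v.
Proof. by move=> vM t i tT; apply: (psup_ubound vM); right; exists t, i. Qed.

Lemma psup_C0_ge x t i : `|x t 0 i| <= psup x.
Proof.
have [M _ xM] := C0_bounded x; rewrite (C0_frozen x).
by apply: (psup_ge (M := M)) => //; apply: clamp_itv; exact: ltW.
Qed.

Lemma psup_C0_ge0 x : 0 <= psup x.
Proof. by have [M _ xM] := C0_bounded x; apply: (psup_ubound (M := M)) => //; left. Qed.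

Lemma psup_sub_ge x y t i : `|y t 0 i - x t 0 i| <= psup (fun s => y s - x s).
Proof.
have [M _ xM] := C0_bounded x; have [N _ yN] := C0_bounded y.
rewrite (C0_frozen x) (C0_frozen y).
have -> : y (clamp T t) 0 i - x (clamp T t) 0 i = (y (clamp T t) - x (clamp T t)) 0 i.
  by rewrite !mxE.
apply: (psup_ge (v := fun s => y s - x s) (M := M + N)) => [s j _|]; last first.
  by apply: clamp_itv; exact: ltW.
by rewrite !mxE (le_trans (ler_normB _ _))// addrC lerD.
Qed.

Lemma psup_sub_ge0 x y : 0 <= psup (fun s => y s - x s).
Proof.
have [M _ xM] := C0_bounded x; have [N _ yN] := C0_bounded y.
apply: (psup_ubound (M := M + N)) => [s j _|]; last by left.
by rewrite !mxE (le_trans (ler_normB _ _))// addrC lerD.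
Qed.

Lemma lnorm_le (r M : R) (v : 'rV[R]_d) : 0 < r -> 0 <= M ->
  (forall i, `|v 0 i| <= M) -> lnorm r v <= d%:R `^ r^-1 * M.
Proof.
move=> r0 M0 vM; rewrite /lnorm.
have -> : d%:R `^ r^-1 * M = (d%:R * M `^ r) `^ r^-1.
  by rewrite powRM ?powR_ge0// -powRrM mulfV ?gt_eqF// powRr1.
apply: ge0_ler_powR; rewrite ?invr_ge0 ?(ltW r0)// ?nnegrE ?mulr_ge0 ?powR_ge0//.
  by apply: sumr_ge0 => i _; exact: powR_ge0.
apply: (@le_trans _ _ (\sum_(i < d) M `^ r)); last first.
  by rewrite sumr_const card_ord mulr_natl.
apply: ler_sum => i _; apply: ge0_ler_powR; rewrite ?nnegrE// ltW//.
Qed.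

Lemma sup_lnorm_le (r M : R) (v : R -> 'rV[R]_d) : 0 < r -> 0 <= M ->
  (forall t i, 0 <= t <= T -> `|v t 0 i| <= M) ->
  sup_lnorm T r v <= d%:R `^ r^-1 * M.
Proof.
move=> r0 M0 vM; apply: ge_sup.
  by exists (lnorm r (v 0)), 0 => //=; rewrite in_itv/= lexx ltW.
move=> _ [t /= tT <-]; apply: lnorm_le => // i; apply: vM.
by move: tT; rewrite in_itv.
Qed.

Lemma psup_le_sup_lnorm (r : R) x : 0 < r -> psup x <= sup_lnorm T r x.
Proof.
move=> r0; have [M M0 xM] := C0_bounded x.
have ub t : 0 <= t <= T -> lnorm r (x t) <= sup_lnorm T r x.
  move=> tT; apply: ub_le_sup; last by exists t => //=; rewrite in_itv.
  by exists (d%:R `^ r^-1 * M) => _ [s _ <-]; exact: lnorm_le.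
apply: psup_le.
  have t0 : 0 <= (0 : R) <= T by rewrite lexx ltW.
  by apply: le_trans (ub 0 t0); exact: powR_ge0.
by move=> t i tT; apply: le_trans (ub _ tT); exact: coord_le_lnorm.
Qed.

Lemma continuous_le_rat (g : R -> R) (c : R) : continuous g ->
  (forall s : rat, 0 <= (ratr s : R) <= T -> g (ratr s) <= c) ->
  forall t, 0 <= t <= T -> g t <= c.
Proof.
move=> gc H t /andP[t0 tT]; rewrite leNgt; apply/negP => ct.
have /gc [r /= r0 rB] : nbhs (g t) [set z | c < z] by exact: lt_nbhsr.
pose a := Num.max 0 (t - r); pose b := Num.min T (t + r).
have ab : a < b.
  have aux (u v w : R) : 0 < u -> 0 <= v -> v <= u -> 0 < w ->
      [/\ 0 < u, 0 < v + w, v - w < u & v - w < v + w] by move=> *; split; lra.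
  by have [] := aux T t r T0 t0 tT r0; rewrite /a /b gt_max !lt_min => -> -> -> ->.
have [s] := rat_in_itvoo ab; rewrite in_itv/= /a /b gt_max lt_min.
move=> /andP[/andP[s0 ts] /andP[sT st]].
have : c < g (ratr s).
  by apply: rB => /=; exact: ltr_dist_itv.
by rewrite ltNge H// (ltW s0) (ltW sT).
Qed.

(** A countable substitute for balls, which makes separability explicit: the paths that stay, at
    rational times, within 1/(k.2+1) of a rational step function constant on cells of length
    1/(k.1.1+1). The centre need not be a continuous path. *)
Definition rat_cell (k : nat * seq (seq rat) * nat) : set X :=
  [set w : X | forall (s : rat) i, 0 <= (ratr s : R) <= T ->
     `|w (ratr s) 0 i -
       ratr (nth 0 (nth [::] k.1.2 (Num.trunc (ratr s * k.1.1.+1%:R : R))) i)|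
     <= k.2.+1%:R^-1].

Lemma rat_cell_dist k x y : rat_cell k x -> rat_cell k y ->
  forall t i, 0 <= t <= T -> `|y t 0 i - x t 0 i| <= 2 / k.2.+1%:R.
Proof.
move=> kx ky t i; pose g s := `|y s 0 i - x s 0 i|.
apply: (continuous_le_rat (g := g)).
  move=> s; apply: (@cvg_norm _ R^o); apply: cvgB; exact: C0_coord_continuous.
move=> s sT; have := ky s i sT; have := kx s i sT; set q := ratr (nth _ _ _).
rewrite /g => xq yq.
have -> : y (ratr s) 0 i - x (ratr s) 0 i = (y (ratr s) 0 i - q) - (x (ratr s) 0 i - q).
  by ring.
by rewrite (le_trans (ler_normB _ _))// (mulrDl 1 1) mul1r lerD.
Qed.

Lemma rat_cell_ex x r : exists k, k.2 = r /\ rat_cell k x.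
Proof.
have e0 : 0 < (r.+1%:R : R)^-1 / 2 by rewrite divr_gt0.
have [delta delta0 H] := C0_unif_continuous x e0.
pose n := Num.bound delta^-1.
have nd : (n.+1%:R : R)^-1 < delta.
  rewrite invf_plt ?posrE//; apply: lt_le_trans (archi_boundP _) _.
    by rewrite invr_ge0 ltW.
  by rewrite ler_nat.
have qex (k : nat) i : exists q : rat, `|x (k%:R / n.+1%:R) 0 i - ratr q| < r.+1%:R^-1 / 2.
  have ab : x (k%:R / n.+1%:R) 0 i - r.+1%:R^-1 / 2 < x (k%:R / n.+1%:R) 0 i + r.+1%:R^-1 / 2.
    by move: e0; set u := (_^-1 / 2) => u0; lra.
  have [q] := rat_in_itvoo ab; rewrite in_itv/= => /andP[q1 q2]; exists q.
  exact: ltr_dist_itv.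
have [q qP] := choice (fun ki : nat * 'I_d => qex ki.1 ki.2).
pose K := (Num.trunc (T * n.+1%:R)).+1.
exists (n, mkseq (fun k => [seq q (k, i) | i <- enum 'I_d]) K, r); split=> //= s i sT.
have s0 : 0 <= ratr s * n.+1%:R :> R by case/andP: sT => s0 _; rewrite mulr_ge0.
have := truncn_itv s0; set k := Num.trunc _ => /andP[ks sk].
have kK : (k < K)%N.
  by rewrite ltnS le_truncn// ler_wpM2r//; case/andP: sT.
rewrite nth_mkseq// (nth_map i) ?size_enum_ord// nth_ord_enum.
have -> : x (ratr s) 0 i - ratr (q (k, i)) =
    (x (ratr s) 0 i - x (k%:R / n.+1%:R) 0 i) + (x (k%:R / n.+1%:R) 0 i - ratr (q (k, i))).
  by ring.
rewrite (splitr (r.+1%:R^-1)); apply: le_trans (ler_normD _ _) _; apply: lerD; apply: ltW; last exact: (qP (k, i)).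
apply: H; apply: le_lt_trans nd; rewrite ger0_norm ?subr_ge0 ?ler_pdivrMr//.
rewrite lerBlDr.
have -> : n.+1%:R^-1 + k%:R / n.+1%:R = k.+1%:R / n.+1%:R :> R 
  by rewrite -[k.+1%:R]natr1 mulrDl mul1r addrC.
by rewrite ler_pdivlMr// ltW.
Qed.

(** An open set is a countable union of the rational cells it contains, and belonging to a cell is a
    condition on countably many evaluations. Hence evaluations generate the Borel sigma-algebra. *)
Lemma measurable_fun_C0 d' (Y : measurableType d') (Phi : Y -> X) :
  (forall t i, 0 <= t <= T -> measurable_fun setT (fun u => Phi u t 0 i)) ->
  measurable_fun setT Phi.
Proof.
move=> mPhi; apply: (measurability (@open X)) => // _ [U oU <-]; rewrite setTI.
pose A := [set k | rat_cell k `<=` U].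
have -> : U = \bigcup_k (if k \in A then rat_cell k else set0).
  apply/seteqP; split => [x Ux|x [k _]]; last first.
    by case: ifPn => //; rewrite inE => kU /kU.
  have /nbhs_C0P[eta eta0 H] : nbhs x U by exact: open_nbhs_nbhs.
  pose r := Num.bound (2 / eta); have [k [kr kx]] := rat_cell_ex x r.
  exists k => //; rewrite ifT// inE => y ky; apply: H => t i tT.
  apply: (le_lt_trans (rat_cell_dist kx ky i tT)); rewrite kr.
  rewrite ltr_pdivrMr// mulrC -ltr_pdivrMr//; apply: lt_le_trans (archi_boundP _) _.
    by rewrite divr_ge0// ltW.
  by rewrite ler_nat.
rewrite preimage_bigcup; apply: countable_bigcupT_measurable => [|k]; first exact: countableP.
case: ifPn => _; last by rewrite preimage_set0.
have -> : Phi @^-1` rat_cell k = \bigcap_(s : rat) \bigcap_i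
   [set y : Y | 0 <= (ratr s : R) <= T ->
     `|Phi y (ratr s) 0 i -
       ratr (nth 0 (nth [::] k.1.2 (Num.trunc (ratr s * k.1.1.+1%:R : R))) i)|
     <= k.2.+1%:R^-1].
  apply/seteqP; split => [y H s _ i _|y H s i]; first exact: H.
  exact: H.
apply: countable_bigcapT_measurable => s; apply: countable_bigcapT_measurable => i.
have [sT|sT] := boolP (0 <= (ratr s : R) <= T); last first.
  by rewrite (_ : [set y : Y | _] = setT)//; apply/seteqP; split.
set c := ratr (nth _ _ _).
rewrite (_ : [set y : Y | _] = (fun y : Y => `|Phi y (ratr s) 0 i - c|) @^-1` `]-oo, k.2.+1%:R^-1]).
  rewrite -[X in measurable X]setTI.
  have : measurable_fun setT (fun y : Y => `|Phi y (ratr s) 0 i - c|).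
    apply: measurableT_comp => //; apply: measurable_funB => //; exact: mPhi.
  by apply.
by apply/seteqP; split => [y /(_ isT)|y] /=; rewrite in_itv/=.
Qed.

Lemma continuous_C0_measurable (F : X -> R) : continuous F -> measurable_fun setT F.
Proof.
move=> /continuousP Fc; apply: (measurability (@RGenOInfty.G R)).
  exact: RGenOInfty.measurableE.
move=> _ [_ [r ->] <-]; rewrite setTI.
by rewrite set_itvE; apply: sub_sigma_algebra; apply: Fc; exact: open_gt.
Qed.

Lemma C0_coord_eval_continuous t i : continuous (fun x : X => x t 0 i).
Proof.
move=> x A /= [e /= e0 eA]; apply/nbhs_C0P; exists e => // y xy; apply: eA.
by rewrite /= distrC (C0_frozen x) (C0_frozen y); apply: xy; apply: clamp_itv; exact: ltW.
Qed.

Lemma measurable_coord t i : measurable_fun setT (fun x : X => x t 0 i).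
Proof. apply: continuous_C0_measurable; exact: C0_coord_eval_continuous. Qed.

Lemma measurable_psup d' (Y : measurableType d') (V : Y -> R -> 'rV[R]_d) :
  (forall u i, continuous (fun t => V u t 0 i)) ->
  (forall t i, measurable_fun setT (fun u => V u t 0 i)) ->
  measurable_fun setT (fun u => psup (V u)).
Proof.
move=> Vc mV; apply: (measurability (@RGenOInfty.G R)).
  exact: RGenOInfty.measurableE.
move=> _ [_ [r ->] <-]; rewrite setTI.
have bnd (y : Y) : exists M : R, forall t i, 0 <= t <= T -> `|V y t 0 i| <= M.
  have H i : exists M : R, forall t, 0 <= t <= T -> `|V y t 0 i| <= M.
    have [|c _ cM] := @EVT_max R (fun t => `|V y t 0 i|) 0 T (ltW T0).
      by apply: continuous_subspaceT => t; apply: (@cvg_norm _ R^o); exact: Vc.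
    by exists `|V y c 0 i| => t tT; apply: cM; rewrite in_itv.
  have [M MP] := choice H; exists (\sum_i `|M i|) => t i tT.
  apply: (le_trans (MP i _ tT)); apply: (le_trans (ler_norm _)).
  by rewrite (bigD1 i)//= lerDl; exact: sumr_ge0.
have [r0|r0] := ltP r 0.
  rewrite (_ : _ @^-1` _ = setT)//; apply/seteqP; split => // y _ /=.
  rewrite in_itv/= andbT (lt_le_trans r0)//; have [M VM] := bnd y.
  by apply: (psup_ubound VM); left.
have -> : (fun u => psup (V u)) @^-1` `]r, +oo[ =
    ~` (\bigcap_(s : rat) \bigcap_i [set y : Y | 0 <= (ratr s : R) <= T -> `|V y (ratr s) 0 i| <= r]).
  apply/seteqP; split => [y /=|y].
    rewrite in_itv/= andbT => + H; rewrite ltNge => /negP; apply; apply: psup_le => // t i tT.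
    apply: (@continuous_le_rat (fun t => `|V y t 0 i|)) => //.
      by move=> u; apply: (@cvg_norm _ R^o); exact: Vc.
    by move=> s sT; exact: H.
  move=> H; rewrite /= in_itv/= andbT ltNge; apply/negP => yr; apply: H => s _ i _ sT.
  by apply: le_trans yr; have [M VM] := bnd y; exact: (psup_ge VM).
apply: measurableC; apply: countable_bigcapT_measurable => s; apply: countable_bigcapT_measurable => i.
have [sT|sT] := boolP (0 <= (ratr s : R) <= T); last first.
  by rewrite (_ : [set y : Y | _] = setT)//; apply/seteqP; split.
rewrite (_ : [set y : Y | _] = (fun y : Y => `|V y (ratr s) 0 i|) @^-1` `]-oo, r]).
  rewrite -[X in measurable X]setTI.
  have : measurable_fun setT (fun y : Y => `|V y (ratr s) 0 i|) by exact: measurableT_comp.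
  by apply.
by apply/seteqP; split => [y /(_ isT)|y] /=; rewrite in_itv/=.
Qed.

End path_space.

Lemma real_dominated_cvg d (Y : measurableType d) (R : realType)
    (mu : {measure set Y -> \bar R}) (D N : set Y) (f_ : nat -> Y -> R) (f g : Y -> R) :
  measurable D -> mu.-negligible N ->
  (forall n, measurable_fun D (f_ n)) -> measurable_fun D f ->
  mu.-integrable D (EFin \o g) ->
  (forall n x, D x -> `|f_ n x| <= g x) ->
  (forall x, D x -> ~ N x -> f_ n x @[n --> \oo] --> f x) ->
  mu.-integrable D (EFin \o f) /\
  \int[mu]_(x in D) f_ n x @[n --> \oo] --> \int[mu]_(x in D) f x.
Proof.
move=> mD N0 mf_ mf gi fg fcvg.
have [|||| fi _ cv] := @dominated_convergence _ Y R mu D mD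
    (fun n x => (f_ n x)%:E) (EFin \o f) (EFin \o g) _ _ _ gi.
- by move=> n; apply/measurable_EFinP.
- exact/measurable_EFinP.
- apply: (negligibleS _ N0) => x /= nx; apply: contrapT => Nx; apply: nx => Dx.
  apply: cvg_EFin; first exact: nearW.
  exact: fcvg.
- by apply: aeW => x n Dx /=; rewrite lee_fin; exact: fg.
split=> //; apply: fine_cvg; apply: cvg_trans cv _.
by rewrite /Rintegral fineK//; exact: integrable_fin_num.
Qed.

Lemma Rintegral_sum d (Y : measurableType d) (R : realType)
    (mu : {measure set Y -> \bar R}) (D : set Y) (I : Type) (s : seq I) (f : I -> Y -> R) :
  measurable D -> (forall i, mu.-integrable D (EFin \o f i)) ->
  \int[mu]_(x in D) (\sum_(i <- s) f i x) = \sum_(i <- s) \int[mu]_(x in D) f i x.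
Proof.
move=> mD fi; elim: s => [|i s ih].
  by rewrite big_nil; under eq_Rintegral do rewrite big_nil; rewrite Rintegral_cst// mul0r.
rewrite big_cons -ih -RintegralD//; last exact: integrable_real_sum.
by apply: eq_Rintegral => x _; rewrite big_cons.
Qed.

(** * Partitions and Riemann sums *)

Section riemann.
Context {R : realType}.
Implicit Types (T : R) (B : set R).
Local Notation lambda := (@lebesgue_measure R).

(** Each t in B gets a rational just below t, inside the gap that B leaves there. It lies above
    every smaller point of B, so different points get different rationals. *)
Lemma left_isolated_countable T B : B `<=` `[0, T] ->
  (forall t, 0 <= t <= T -> exists2 eta : R, 0 < eta &
     forall s, t - eta < s < t -> ~ B s) ->
  countable B.
Proof.
move=> BT H.
have qex t : exists q : rat, B t -> ratr q < t /\ forall s, s < t -> B s -> s < ratr q.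
  have [Bt|nBt] := pselect (B t); last by exists 0.
  have /H[eta eta0 He] : 0 <= t <= T by have := BT _ Bt; rewrite /= in_itv.
  have /rat_in_itvoo[q] : t - eta < t by rewrite ltrBlDr ltrDl.
  rewrite in_itv/= => /andP[q1 q2]; exists q => _; split => // s st Bs.
  apply: le_lt_trans q1; rewrite leNgt; apply/negP => es.
  by apply: (He s) => //; rewrite es st.
have [q qP] := choice qex.
apply/countable_injP; exists (fun t => pickle (q t)) => s t; rewrite !inE => Bs Bt.
move=> /(pcan_inj pickleK) qst.
have [qs Hs] := qP _ Bs; have [qt Ht] := qP _ Bt.
apply/eqP; rewrite eq_le !leNgt; apply/andP; split; apply/negP => lt_st.
  by have := Hs _ lt_st Bt; rewrite qst ltNge (ltW qt).
by have := Ht _ lt_st Bs; rewrite -qst ltNge (ltW qs).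
Qed.

Lemma integrable_cst_itv (a b c : R) : lambda.-integrable `]a, b] (EFin \o (fun=> c)).
Proof.
have laby : (lambda `]a, b]%classic < +oo)%E.
  by rewrite lebesgue_measure_itv/=; case: ifP => _; rewrite ?ltry// -EFinB ltry.
apply: (measurable_bounded_integrable _ laby) => //.
by exists `|c|; split=> [|M cM x _]; [exact: num_real|exact: ltW].
Qed.

Definition is_partition T (n : nat) (tau : nat -> R) : Prop :=
  [/\ tau 0%N = 0, tau n = T & forall j, (j < n)%N -> tau j < tau j.+1].

Lemma partition_le T n tau i j : is_partition T n tau -> (i <= j)%N -> (j <= n)%N ->
  tau i <= tau j.
Proof.
move=> [_ _ tauS]; elim: j => [|j ih]; first by rewrite leqn0 => /eqP->.
rewrite leq_eqVlt => /predU1P[->//|ij] jn.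
by rewrite (le_trans (ih ij (ltnW jn)))// ltW// tauS.
Qed.

Lemma partition_itv T n tau j : is_partition T n tau -> (j <= n)%N -> 0 <= tau j <= T.
Proof.
move=> tP jn; have [t0 tn _] := tP.
have := partition_le tP (leq0n j) jn; have := partition_le tP jn (leqnn n).
by rewrite t0 tn => -> ->.
Qed.

Lemma partition_cell T n tau t : is_partition T n tau -> 0 < t <= T ->
  exists2 j, (j < n)%N & tau j < t <= tau j.+1.
Proof.
move=> [tau0 tauT tauS] /andP[t0 tT].
have ex : exists k, t <= tau k by exists n; rewrite tauT.
have [[|k] tk kmin] := ex_minnP ex; first by move: tk; rewrite tau0 leNgt t0.
exists k; first by apply: (leq_trans _ (kmin n _)); rewrite ?tauT.
by rewrite tk andbT ltNge; apply/negP => /kmin; rewrite ltnn.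
Qed.

Lemma partition_cell_unique T n tau t i j : is_partition T n tau ->
  (i < n)%N -> (j < n)%N -> tau i < t <= tau i.+1 -> tau j < t <= tau j.+1 -> i = j.
Proof.
move=> tP + + /andP[it ti] /andP[jt tj]; wlog ij : i j it ti jt tj / (i < j)%N.
  move=> hw iN jN; have [ij|ji|//] := ltngtP i j; first exact: hw.
  by apply/esym; exact: hw.
move=> iN jN; have ij' := partition_le tP ij (ltnW jN).
by have := lt_le_trans jt ti; rewrite ltNge ij'.
Qed.

Definition step_fun (n : nat) (tau b : nat -> R) (t : R) : R :=
  \sum_(j < n) b j * \1_(`]tau j, tau j.+1]%classic : set R) t.

Lemma step_funE T n tau b t j : is_partition T n tau -> (j < n)%N ->
  tau j < t <= tau j.+1 -> step_fun n tau b t = b j.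
Proof.
move=> tP jn tj; rewrite /step_fun (bigD1 (Ordinal jn))//= indicE mem_set/=; last first.
  by rewrite in_itv.
rewrite mulr1 big1 ?addr0// => k kj; rewrite indicE memNset ?mulr0//=.
rewrite in_itv/= => tk; move/eqP : kj; apply; apply: val_inj => /=.
exact: (partition_cell_unique tP _ jn tk tj).
Qed.

Lemma measurable_step_fun n tau b : measurable_fun setT (step_fun n tau b).
Proof.
by apply: measurable_sum => j; apply: measurable_funM => //.
Qed.

Lemma Rintegral_step_fun T n tau b : is_partition T n tau ->
  \int[lambda]_(t in `]0, T]) step_fun n tau b t =
  \sum_(j < n) (tau j.+1 - tau j) * b j.
Proof.
move=> tP; have [_ _ tauS] := tP.
have ci (c : R) : lambda.-integrable `]0, T] (EFin \o (fun=> c)).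
  exact: integrable_cst_itv.
have indi (j : 'I_n) : lambda.-integrable `]0, T]
    (EFin \o (\1_(`]tau j, tau j.+1]%classic : set R) : R -> R)).
  apply: (integrable_real_le _ _ (ci 1)).
  - exact: measurable_itv.
  - by apply: measurable_indic; exact: measurable_itv.
  - by move=> t _; rewrite indicE ger0_norm ?ler0n// lern1 leq_b1.
have bi (j : 'I_n) : lambda.-integrable `]0, T]
    (EFin \o (fun t => b j * \1_(`]tau j, tau j.+1]%classic : set R) t)).
  by apply: integrable_realZl => //; exact: measurable_itv.
rewrite Rintegral_sum//; apply: eq_bigr => j _; rewrite RintegralZl// mulrC; congr (_ * _).
rewrite /Rintegral integral_indic//.
rewrite (_ : _ `&` _ = `]tau j, tau j.+1]%classic); last first.
  have /andP[t0 _] := partition_itv tP (ltnW (ltn_ord j)).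
  have /andP[_ tT] := partition_itv tP (ltn_ord j).
  apply/seteqP; split => [t []//|t] /=; rewrite !in_itv/= => /andP[jt tj].
  by rewrite jt tj (le_lt_trans t0 jt) (le_trans tj tT).
have lamE : lambda `]tau j, tau j.+1]%classic = (tau j.+1 - tau j)%:E.
  by rewrite lebesgue_measure_itv/= lte_fin tauS// EFinB.
exact: (congr1 fine lamE).
Qed.

(** Dominated convergence for the step functions that carry the sums. Measurability of f is a
    conclusion: off a countable set f is a limit of step functions, and every subset of a countable
    set is Borel. *)
Lemma riemann_cvg T (n : nat -> nat) (tau b : nat -> nat -> R) (f : R -> R) B (K : R) :
  0 < T -> (forall M, is_partition T (n M) (tau M)) ->
  countable B -> (forall M j, (j < n M)%N -> `|b M j| <= K) ->
  (forall t, 0 < t <= T -> ~ B t -> forall e, 0 < e -> exists M0, forall M, (M0 <= M)%N ->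
     forall j, (j < n M)%N -> tau M j < t <= tau M j.+1 -> `|f t - b M j| <= e) ->
  measurable_fun `]0, T] f /\
  \sum_(j < n M) (tau M j.+1 - tau M j) * b M j @[M --> \oo] -->
   \int[lambda]_(t in `]0, T]) f t.
Proof.
move=> T0 tP cB bK H.
have mB : measurable B by apply: countable_measurable => //; exact: measurable_set1.
pose F M := step_fun (n M) (tau M) (b M).
have FE M t : 0 < t <= T -> exists2 j, (j < n M)%N & tau M j < t <= tau M j.+1 /\ F M t = b M j.
  move=> tT; have [j jn tj] := partition_cell (tP M) tT.
  by exists j => //; split => //; exact: step_funE tj.
have cvF t : 0 < t <= T -> ~ B t -> F M t @[M --> \oo] --> f t.
  move=> tT nB; apply/cvgrPdist_le => e e0; have [M0 HM] := H t tT nB e e0.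
  exists M0 => // M /= MM; have [j jn [tj ->]] := FE M t tT.
  exact: HM.
have mf : measurable_fun `]0, T] f.
  rewrite -(setDUK (@subIsetl _ `]0, T]%classic B)) (_ : `]0, T] `\` _ = `]0, T] `\` B); last first.
    by apply/seteqP; split => t /= [tT nB]; split=> //; [move=> Bt; apply: nB|case].
  apply/measurable_funU; [exact: measurableI|exact: measurableD|split].
    move=> _ Y mY; apply: countable_measurable; first exact: measurable_set1.
    by apply: sub_countable cB; apply: subset_card_le => t [[]].
  apply: (@measurable_fun_cvg _ _ _ _ F).
    by move=> M; apply: measurable_funTS; exact: measurable_step_fun.
  by move=> t /= [tT nB]; apply: cvF.
split => //; under eq_cvg do rewrite -(Rintegral_step_fun _ (tP _)).
have [|||||||_ //] := @real_dominated_cvg _ _ _ lambda `]0, T]%classic B F f (fun=> K).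
- exact: measurable_itv.
- by apply/negligibleP => //; exact: countable_lebesgue_measure0.
- by move=> M; apply: measurable_funTS; exact: measurable_step_fun.
- exact: mf.
- exact: integrable_cst_itv.
- move=> M t /=; rewrite in_itv/= => /(FE M)[j jn [_ ->]]; exact: bK.
- by move=> t /=; rewrite in_itv/=; exact: cvF.
Qed.

End riemann.

(** * Bumps along a partition *)

Section pathwise.
Context {R : realType} {T : R} {d : nat}.
Hypothesis T0 : 0 < T.
Local Notation X := (C0_path T d).
Local Notation D := (cadlag_path T d).
Local Notation lambda := (@lebesgue_measure R).
Implicit Types (x y : X) (s t e : R) (i : 'I_d).

Definition close_paths (v w : R -> 'rV[R]_d) (eta : R) : Prop :=
  forall t i, 0 <= t <= T -> `|v t 0 i - w t 0 i| < eta.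

(** If no [eta] worked for some e, counterexamples picked one after the other would form a sequence
    of the kind quantified over in [has_left_limit], without convergence to l. *)
Lemma has_left_limit_near (F : R -> D -> 'rV[R]_d) t : has_left_limit F t ->
  forall w : D, exists l : 'rV[R]_d, forall e, 0 < e -> exists2 eta : R, 0 < eta &
    forall s (w' : D), 0 <= s -> t - eta < s < t -> close_paths w' w eta ->
      forall i, `|F s w' 0 i - l 0 i| <= e.
Proof.
move=> Ft w; have [l Fl] := Ft w; exists l => e e0; apply: contrapT => neta.
have bad (eta : R) : exists sw : R * D, 0 < eta ->
    [/\ 0 <= sw.1, t - eta < sw.1 < t, close_paths sw.2 w eta &
      exists i, e < `|F sw.1 sw.2 0 i - l 0 i|].
  have [eta0|eta0] := ltP 0 eta; last by exists (0, w).
  apply: contrapT => nsw; apply: neta; exists eta => // s w' s0 st ww' i.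
  rewrite leNgt; apply/negP => ei; apply: nsw; exists (s, w') => _; split => //.
  by exists i.
have [g gP] := choice bad.
(* The radius t - (u n').1 forces the next time beyond the current one, so that times increase
   strictly; the radius 1/(n'+2) forces convergence of times and paths. *)
pose u := fix u n := if n is n'.+1 then g (Num.min n'.+2%:R^-1 (t - (u n').1)) else g 1.
have uP n : exists2 eta : R, 0 < eta <= n.+1%:R^-1 & u n = g eta.
  elim: n => [|n [eta /andP[eta0 etan] un]]; first by exists 1 => //; rewrite invr1 ltr01 lexx.
  exists (Num.min n.+2%:R^-1 (t - (u n).1)) => //.
  rewrite lt_min invr_gt0 ltr0n/= ge_min lexx andbT subr_gt0 un.
  by have [_ /andP[]] := gP _ eta0.
have u0 n : 0 <= (u n).1 by have [eta /andP[eta0 _] ->] := uP n; have [] := gP _ eta0.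
have ut n : (u n).1 < t by have [eta /andP[eta0 _] ->] := uP n; have [_ /andP[]] := gP _ eta0.
have tu n : t - n.+1%:R^-1 < (u n).1.
  have [eta /andP[eta0 etan] ->] := uP n; have [_ /andP[h _] _ _] := gP _ eta0.
  by apply: le_lt_trans h; rewrite lerD2l lerN2.
have uincr : increasing_seq (fun n => (u n).1).
  apply/increasing_seqP => n.
  have m0 : 0 < Num.min n.+2%:R^-1 (t - (u n).1) by rewrite lt_min invr_gt0 ltr0n/= subr_gt0.
  have [_ /andP[h _] _ _] := gP _ m0; apply: le_lt_trans h => /=.
  by rewrite lerBrDl -lerBrDr ge_min lexx orbT.
have small e' : 0 < e' -> exists N, forall n, (N <= n)%N -> n.+1%:R^-1 < e'.
  move=> e'0; exists (Num.bound e'^-1) => n Nn; rewrite invf_plt ?posrE//.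
  apply: lt_le_trans (archi_boundP _) _; first by rewrite invr_ge0 ltW.
  by rewrite ler_nat (leq_trans Nn).
have cu : (u n).1 @[n --> \oo] --> t.
  apply/cvgrPdist_lt => e' e'0; have [N HN] := small _ e'0; exists N => // n /= Nn.
  rewrite ger0_norm ?subr_ge0 ?(ltW (ut n))//.
  by apply: lt_trans (HN _ Nn); rewrite ltrBlDr -ltrBlDl.
have cw : (u n).2 @[n --> \oo] --> w.
  move=> A /nbhs_cadlagP[eta eta0 HA]; have [N HN] := small _ eta0.
  exists N => // n /= Nn; apply: HA => s i sT.
  have [eta' /andP[eta'0 eta'n] un] := uP n; have [_ _ h _] := gP _ eta'0.
  by rewrite un (lt_trans (h s i sT))// (le_lt_trans eta'n)// HN.
have cF := Fl _ (fun n => (u n).2) u0 uincr cu cw.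
have : nbhs l [set M : 'rV[R]_d | forall i, `|M 0 i - l 0 i| < e].
  have : nbhs l [set M : 'rV[R]_d | ball l e M] by exact: nbhsx_ballx.
  by apply: filterS => M [_ Ml] i; have := Ml 0 i; rewrite /ball/= distrC.
move=> /cF [N _ /(_ N (leqnn N))] /= H.
have [eta /andP[eta0 _] uN] := uP N; have [_ _ _ [i]] := gP _ eta0.
by rewrite -uN ltNge (ltW (H i)).
Qed.

(** With h = y - x this is x + h(. /\ s): it follows y up to time s and then moves parallel to x. *)
Definition stop_fun (x y : R -> 'rV[R]_d) (s t : R) : 'rV[R]_d :=
  x t + (y (Num.min (clamp T t) s) - x (Num.min (clamp T t) s)).

Lemma clamp0 : clamp T 0 = 0.
Proof. by apply: clamp_id; rewrite lexx ltW. Qed.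

Lemma clamp_le0 s : s <= 0 -> clamp T s = 0.
Proof.
move=> s0; apply/eqP; rewrite eq_le; have /andP[-> _] := clamp_itv s (ltW T0).
by rewrite -[leRHS]clamp0 le_clamp.
Qed.

Lemma stop_frozen x y s : frozen T (stop_fun x y s).
Proof. by move=> t; rewrite /stop_fun clampK -(C0_frozen x t). Qed.

Lemma stop_start x y s : stop_fun x y s 0 = 0.
Proof.
have z (w : X) : w (Num.min (clamp T 0) s) = 0.
  by rewrite (C0_frozen w) clamp0 clamp_le0 ?C0_start// ge_min lexx.
by rewrite /stop_fun !z C0_start subrr addr0.
Qed.

Lemma stop_continuous x y s : continuous (stop_fun x y s).
Proof.
have mc : continuous (fun t => Num.min (clamp T t) s).
  move=> t; apply: (@continuous_min _ R (clamp T) (fun=> s) t); last exact: cvg_cst.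
  exact: clamp_continuous.
have cc (w : X) : continuous (fun t => w (Num.min (clamp T t) s)).
  move=> t; apply: (@continuous_comp _ _ _ (fun t => Num.min (clamp T t) s) w).
    exact: mc.
  exact: C0_continuous.
by move=> t; apply: cvgD; [exact: C0_continuous|apply: cvgB; exact: cc].
Qed.

Definition stop_path x y s : X :=
  C0Path (stop_frozen x y s) (stop_start x y s) (@stop_continuous x y s).

Lemma stop_pathE x y s t i : 0 <= t <= T ->
  stop_path x y s t 0 i = x t 0 i + (y (Num.min t s) 0 i - x (Num.min t s) 0 i).
Proof. by move=> tT; rewrite /= /stop_fun clamp_id// !mxE. Qed.

Lemma stop_path_id x s : stop_path x x s = x.
Proof. by apply: (C0_path_eq T0) => t i tT; rewrite stop_pathE// subrr addr0. Qed.

Section modulus.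
Variables (x y : X).
Let h t i := y t 0 i - x t 0 i.

Lemma sub_unif_continuous_path e : 0 < e -> exists2 delta : R, 0 < delta &
  forall s t i, `|s - t| < delta -> `|h s i - h t i| < e.
Proof.
move=> e0; have e20 : 0 < e / 2 by rewrite divr_gt0.
have [dx dx0 Hx] := C0_unif_continuous T0 x e20.
have [dy dy0 Hy] := C0_unif_continuous T0 y e20.
exists (Num.min dx dy) => [|s t i]; first by rewrite lt_min dx0.
rewrite lt_min => /andP[sx sy]; have -> : h s i - h t i =
  (y s 0 i - y t 0 i) - (x s 0 i - x t 0 i) by rewrite /h; ring.
rewrite (splitr e); apply: le_lt_trans (ler_normB _ _) _.
by apply: ltrD; [exact: Hy|exact: Hx].
Qed.

Lemma min_dist (a s t : R) : `|Num.min a s - Num.min a t| <= `|s - t|.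
Proof.
wlog st : s t / s <= t => [hw|].
  by case: (leP s t) => [|/ltW] st; [exact: hw|rewrite distrC [leRHS]distrC; exact: hw].
rewrite (ler0_norm (_ : s - t <= 0)) ?subr_le0//.
case: (leP a s) => as_; case: (leP a t) => at_; rewrite ler_norml; apply/andP; split; lra.
Qed.

Lemma stop_path_close e : 0 < e -> exists2 delta : R, 0 < delta &
  forall s t, `|s - t| < delta -> close_paths (stop_path x y s) (stop_path x y t) e.
Proof.
move=> /sub_unif_continuous_path[delta d0 H]; exists delta => // s t st u i uT.
rewrite !stop_pathE// opprD addrACA subrr add0r; apply: H.
exact: le_lt_trans (min_dist _ _ _) st.
Qed.

Variables (F : R -> D -> 'rV[R]_d).
Hypothesis Fll : forall t, 0 <= t <= T -> has_left_limit F t.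

(** The nearby path is compared with the path stopped at its own time s, not at t, since this is the
    comparison that [bump_close] provides along a partition. *)
Definition joint_cont (e t : R) : Prop := exists2 eta : R, 0 < eta &
  forall s (w' : D), 0 <= s <= T -> `|s - t| < eta -> close_paths w' (stop_path x y s) eta ->
    forall i, `|F s w' 0 i - F t (cadlag_of_C0 (stop_path x y t)) 0 i| <= e.

(* The times at which [joint_cont] fails at level 1/n are isolated from the left,
   because F has a left limit at every time. *)
Lemma joint_cont_countable : exists2 B : set R, countable B &
  forall t, 0 <= t <= T -> ~ B t -> forall e, 0 < e -> joint_cont e t.
Proof.
pose B (n : nat) := [set t | 0 <= t <= T /\ ~ joint_cont n.+1%:R^-1 t].
exists (\bigcup_n B n); last first.
  move=> t tT nB e e0.
  have [eta eta0 H] : joint_cont (Num.bound e^-1).+1%:R^-1 t.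
    by apply: contrapT => nj; apply: nB; exists (Num.bound e^-1).
  exists eta => // s w' sT st ww' i; apply: (le_trans (H _ _ sT st ww' i)).
  rewrite invf_ple ?posrE//; apply: le_trans (ltW (archi_boundP _)) _.
    by rewrite invr_ge0 ltW.
  by rewrite ler_nat.
apply: bigcup_countable => // n _; apply: (@left_isolated_countable _ T).
  by move=> t [tT _]; rewrite /= in_itv.
move=> t tT; have e20 : 0 < (n.+1%:R : R)^-1 / 2 by rewrite divr_gt0.
have [l /(_ _ e20)[eta eta0 H]] := has_left_limit_near (Fll tT) (cadlag_of_C0 (stop_path x y t)).
have eta20 : 0 < eta / 2 by rewrite divr_gt0.
have [delta d0 Hd] := stop_path_close eta20.
pose r := Num.min eta delta; have r0 : 0 < r by rewrite lt_min eta0.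
exists r => // u /andP[ru ut] [uT]; apply.
(* Times within r' of u stay in ]t - r, t[, where F is within half of 1/(n+1) of the left limit l at
   t. Comparing both values with l gives level 1/(n+1) at u. *)
pose r' := Num.min (eta / 2) (Num.min (t - u) (u - (t - r))).
exists r' => [|s w' sT su w's i].
  by rewrite !lt_min eta20 !subr_gt0 ut.
have sl : t - r < s < t.
  move: su; rewrite !lt_min !ltr_norml => /andP[_ /andP[/andP[_ s1] /andP[s2 _]]].
  by apply/andP; split; lra.
have gen v (w : D) : 0 <= v <= T -> t - r < v < t -> close_paths w (stop_path x y v) (eta / 2) ->
    `|F v w 0 i - l 0 i| <= n.+1%:R^-1 / 2.
  move=> /andP[v0 vT] /andP[v1 v2] wv; apply: H => //.
    rewrite v2 andbT; apply: le_lt_trans v1; rewrite lerD2l lerN2 /r.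
    by rewrite ge_min lexx.
  move=> a k aT; rewrite (splitr eta).
  have -> : w a 0 k - (cadlag_of_C0 (stop_path x y t)) a 0 k =
    (w a 0 k - stop_path x y v a 0 k) + (stop_path x y v a 0 k - stop_path x y t a 0 k).
    by rewrite /=; ring.
  apply: le_lt_trans (ler_normD _ _) _; apply: ltrD; first exact: wv.
  apply: Hd => //; rewrite ltr0_norm ?subr_lt0// opprB ltrBlDl.
  have rd : r <= delta by rewrite /r ge_min lexx orbT.
  by move: v1 rd; lra.
have -> : F s w' 0 i - F u (cadlag_of_C0 (stop_path x y u)) 0 i =
   (F s w' 0 i - l 0 i) - (F u (cadlag_of_C0 (stop_path x y u)) 0 i - l 0 i) by ring.
rewrite (splitr n.+1%:R^-1); apply: le_trans (ler_normB _ _) _; apply: lerD; apply: gen => //.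
- by move=> a k aT; apply: lt_le_trans (w's a k aT) _; rewrite /r' ge_min lexx.
- by rewrite ru.
- by move=> a k aT; rewrite /= subrr normr0.
Qed.

End modulus.

Section steps.
Variables (x y : X) (n : nat) (tau : nat -> R).
Hypothesis tauP : is_partition T n tau.
Local Notation h := (fun t => y t - x t).

Definition increment (j : nat) : 'rV[R]_d := h (tau j.+1) - h (tau j).

(** The increment over a cell is added at the right end of the cell, at the first time when it is
    known. *)
Fixpoint step_path (j : nat) : D :=
  if j is j'.+1 then Defs.bump (step_path j') (tau j) (increment j') else cadlag_of_C0 x.

Lemma step_path_ge j t : (j <= n)%N -> tau j <= t <= T ->
  step_path j t = x t + h (tau j).
Proof.
have [tau0 _ tauS] := tauP.
elim: j t => [|j ih] t jn /andP[jt tT].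
  by rewrite /= tau0 !C0_start subrr addr0.
have jt' : tau j <= t by apply: le_trans jt; exact: ltW (tauS _ jn).
rewrite /= /bump_fun ih ?(ltnW jn)//; last by rewrite jt'.
have /andP[tj0 _] := partition_itv tauP (ltnW jn).
rewrite clamp_id; last by rewrite (le_trans tj0 jt').
by rewrite jt -addrA /increment [h (tau j) + _]addrC subrK.
Qed.

Lemma step_path_lt j t : (j <= n)%N -> 0 <= t -> t < tau j ->
  exists k, [/\ (k < j)%N, tau k <= t < tau k.+1 & step_path j t = x t + h (tau k)].
Proof.
have [tau0 _ tauS] := tauP.
elim: j => [|j ih] jn t0 tj; first by move: tj; rewrite tau0 ltNge t0.
have /andP[_ tjT] := partition_itv tauP jn.
have clt : clamp T t = t by rewrite clamp_id// t0 (le_trans (ltW tj)).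
rewrite /= /bump_fun clt leNgt tj/= addr0.
have [jt|tj'] := leP (tau j) t.
  exists j; split => //; first by rewrite jt.
  by rewrite step_path_ge ?(ltnW jn)// jt (le_trans (ltW tj)).
have [k [kj kt ->]] := ih (ltnW jn) t0 tj'.
by exists k; split => //; exact: leqW.
Qed.

Variables (delta eta : R).
Hypothesis osc : forall s t i, `|s - t| < delta ->
  `|(y s 0 i - x s 0 i) - (y t 0 i - x t 0 i)| < eta.
Hypothesis mesh : forall j, (j < n)%N -> tau j.+1 - tau j < delta.

(** At time t the intermediate path carries h at the last partition time before t, plus possibly a
    fraction of the current increment, while the stopped path carries h at t /\ tau_{j+1}. The two
    differ by at most an increment of h over less than one mesh. *)
Lemma bump_close j (l : R) : (j < n)%N -> 0 <= l <= 1 -> 0 < eta ->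
  close_paths (Defs.bump (step_path j) (tau j.+1) (l *: increment j)) (stop_path x y (tau j.+1)) eta.
Proof.
move=> jn /andP[l0 l1] eta0 t i tT; have [tau0 _ tauS] := tauP.
rewrite stop_pathE//= /bump_fun clamp_id//.
have /andP[t0 tT'] := tT.
case: (leP (tau j.+1) t) => [jt|tj].
  rewrite step_path_ge ?(ltnW jn)//; last first.
    by rewrite tT' andbT (le_trans _ jt)// ltW// tauS.
  rewrite !mxE.
  have -> (a : R) b c b' c' : a + (b' - c') + l * (b - c - (b' - c')) - (a + (b - c)) =
     (l - 1) * (b - c - (b' - c')) by ring.
  rewrite normrM; apply: (@le_lt_trans _ _ `|y (tau j.+1) 0 i - x (tau j.+1) 0 i - (y (tau j) 0 i - x (tau j) 0 i)|).
    by apply: ler_piMl => //; rewrite ler0_norm ?subr_le0// opprB lerBlDr lerDl.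
  by apply: osc; rewrite ger0_norm ?subr_ge0 ?(ltW (tauS _ jn))// mesh.
rewrite addr0.
have [k [kj /andP[kt tk] ->]] : exists k, [/\ (k < j.+1)%N, tau k <= t < tau k.+1 &
    step_path j t = x t + h (tau k)].
  have [jt|tj'] := leP (tau j) t.
    exists j; split => //; first by rewrite jt.
    by rewrite step_path_ge ?(ltnW jn)// jt.
  have [k [kj kt kE]] := step_path_lt (ltnW jn) t0 tj'.
  by exists k; split => //; exact: ltnW.
rewrite !mxE opprD addrACA subrr add0r; apply: osc.
rewrite ler0_norm ?subr_le0// opprB.
have kn : (k < n)%N by exact: (leq_trans kj).
by apply: lt_trans (mesh kn); rewrite ltrD2r.
Qed.

Lemma step_path_final : 0 < eta -> close_paths (step_path n) y eta.
Proof.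
move=> eta0 t i /andP[t0 tT]; have [_ tauT tauS] := tauP.
have : t <= tau n by rewrite tauT.
rewrite le_eqVlt => /predU1P[->|tn].
  have -> : step_path n (tau n) = x (tau n) + h (tau n).
    by rewrite step_path_ge ?lexx// tauT lexx.
  by rewrite !mxE addrCA subrr addr0 subrr normr0.
have [k [kn /andP[kt tk] ->]] := step_path_lt (leqnn n) t0 tn.
have -> : (x t + (y (tau k) - x (tau k))) 0 i - y t 0 i =
   (y (tau k) 0 i - x (tau k) 0 i) - (y t 0 i - x t 0 i) by rewrite !mxE; ring.
apply: osc; rewrite ler0_norm ?subr_le0// opprB.
by apply: lt_trans (mesh kn); rewrite ltrD2r.
Qed.

End steps.

Lemma C0_cvg_near (v : nat -> X) (w : X) (eta : R) : v @ \oo --> w -> 0 < eta ->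
  exists N, forall n, (N <= n)%N -> forall s i, 0 <= s <= T -> `|v n s 0 i - w s 0 i| < eta.
Proof.
move=> vw eta0.
have : nbhs w [set w' : X | forall s i, 0 <= s <= T -> `|w' s 0 i - w s 0 i| < eta].
  by apply/nbhs_C0P; exists eta.
by move=> /vw [N _ H]; exists N.
Qed.

Section taylor.
Variables (ft : D -> R) (F : R -> D -> 'rV[R]_d).
Hypothesis Fd : pathwise_malliavin ft F.

Lemma bump_add (w : D) t (e e' : 'rV[R]_d) : Defs.bump (Defs.bump w t e) t e' = Defs.bump w t (e + e').
Proof.
apply: (cadlag_path_eq) => s; rewrite /= /bump_fun; case: ifP => _; first by rewrite addrA.
by rewrite !addr0.
Qed.

Lemma bump0 (w : D) t : Defs.bump w t 0 = w.
Proof. by apply: (cadlag_path_eq) => s; rewrite /= /bump_fun if_same addr0. Qed.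

(** Bumps at the same time add up, so the directional derivative at 0, available at every cadlag
    path, is a derivative at every point of the segment, and the one-dimensional mean value theorem
    applies. *)
Lemma bump_mean_value (w : D) t (e : 'rV[R]_d) : 0 <= t <= T ->
  exists2 l : R, 0 <= l <= 1 &
    ft (Defs.bump w t e) - ft w = \sum_i F t (Defs.bump w t (l *: e)) 0 i * e 0 i.
Proof.
move=> tT; pose g (l : R) : R := ft (Defs.bump w t (l *: e)).
have gd (l : R) : is_derive l 1 g (dotv (F t (Defs.bump w t (l *: e))) e).
  have := @Fd t tT (Defs.bump w t (l *: e)) e.
  under eq_cvg do rewrite bump_add -scalerDl.
  move=> cv; have {}cv : (fun eps : R => eps^-1 *: (g (eps *: 1 + l) - g l)) @ 0^' -->
      dotv (F t (Defs.bump w t (l *: e))) e.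
    apply: cvg_trans cv; apply: near_eq_cvg; near=> eps.
    have E : eps *: (1 : R) + l = l + eps by rewrite /GRing.scale/= mulr1 addrC.
    rewrite E; change ((g (l + eps) - g l) / eps = eps^-1 * (g (l + eps) - g l)).
    exact: mulrC.
  apply: DeriveDef; first by apply/cvg_ex; eexists; exact: cv.
  by apply/cvg_lim => //; exact: cv.
have gc : {within `[0, 1], continuous g}.
  apply: derivable_within_continuous => l _; exact: ex_derive.
have [l l01 gE] := MVT ltr01 (fun l _ => gd l) gc.
exists l; first by move: l01; rewrite in_itv/= => /andP[/ltW-> /ltW->].
by move: gE; rewrite /g scale1r scale0r bump0 subr0 mulr1.
Unshelve. all: by end_near. Qed.

Lemma step_path_taylor (x y : X) n tau : is_partition T n tau ->
  exists l : nat -> R, (forall j, 0 <= l j <= 1) /\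
  forall m, (m <= n)%N -> ft (step_path x y tau m) - ft (cadlag_of_C0 x) =
    \sum_(j < m) \sum_i F (tau j.+1)
       (Defs.bump (step_path x y tau j) (tau j.+1) (l j *: increment x y tau j)) 0 i
         * increment x y tau j 0 i.
Proof.
move=> tP; have H j : exists l : R, 0 <= l <= 1 /\ ((j < n)%N ->
    ft (step_path x y tau j.+1) - ft (step_path x y tau j) =
    \sum_i F (tau j.+1) (Defs.bump (step_path x y tau j) (tau j.+1) (l *: increment x y tau j)) 0 i
         * increment x y tau j 0 i).
  have [jn|jn] := ltnP j n; last by exists 0; split => //; rewrite lexx ler01.
  have [l l01 lE] := bump_mean_value (step_path x y tau j) (increment x y tau j)
    (partition_itv tP jn).
  by exists l; split.
have [l lP] := choice H; exists l; split => [j|]; first by have [] := lP j.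
elim=> [_|m ih mn]; first by rewrite big_ord0 subrr.
rewrite big_ord_recr/= -ih ?(ltnW mn)//; have [_ /(_ mn) <-] := lP m.
by rewrite addrC addrA subrK.
Qed.

End taylor.

End pathwise.

Arguments close_paths {R} T {d} v w eta.

(** * Young's inequality and powers *)

Section real_powers.
Context {R : realType}.
Implicit Types (a b p q : R).

Lemma conjugate_exponent p q : 1 < p -> q = p / (p - 1) ->
  [/\ 0 < p, 1 < q, p^-1 + q^-1 = 1, (p - 1) * q = p & p / q = p - 1].
Proof.
move=> p1 ->; have p0 : 0 < p by exact: lt_trans p1.
have pm1 : 0 < p - 1 by rewrite subr_gt0.
split=> //.
- by rewrite ltr_pdivlMr// mul1r ltrBlDr ltrDl.
- by rewrite invf_div -[X in X + _]mul1r -mulrDl addrC subrK divff ?gt_eqF.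
- by rewrite mulrCA divff ?gt_eqF// mulr1.
- by rewrite invf_div mulrCA divff ?gt_eqF// mulr1.
Qed.

(** Young's inequality for kappa len^(1/q) |a| and |b| / (kappa len^(1/q)). The first term has the
    weight of a Riemann sum, the second that of the energy, and kappa stays free for later
    optimization. *)
Lemma young_scaled p q (kappa len a b : R) : 1 < p -> q = p / (p - 1) ->
  0 < kappa -> 0 < len ->
  `|a * b| <= kappa `^ q / q * (len * `|a| `^ q) +
     (kappa `^ p)^-1 / p * (`|b| `^ p / len `^ (p - 1)).
Proof.
move=> p1 qE k0 l0; have [p0 q1 pq pmq pdq] := conjugate_exponent p1 qE.
have q0 : 0 < q by exact: lt_trans q1.
pose u := kappa * len `^ q^-1 * `|a|; pose v := `|b| / (kappa * len `^ q^-1).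
have w0 : 0 < kappa * len `^ q^-1 by rewrite mulr_gt0// powR_gt0.
have u0 : 0 <= u by rewrite mulr_ge0// ltW.
have v0 : 0 <= v by rewrite divr_ge0// ltW.
have : v * u <= v `^ p / p + u `^ q / q by exact: conjugate_powR.
have -> : v * u = `|a * b|.
  rewrite /u /v normrM; move: (kappa * _) w0 => w w0; field; exact: lt0r_neq0.
have lK r : (len `^ q^-1) `^ r = len `^ (r / q) by rewrite -powRrM mulrC.
have -> : u `^ q = kappa `^ q * (len * `|a| `^ q).
  by rewrite /u !powRM ?powR_ge0 ?mulr_ge0 ?powR_ge0 ?(ltW k0)// lK divff ?gt_eqF// powRr1 ?ltW// mulrA.
have -> : v `^ p = (kappa `^ p)^-1 * (`|b| `^ p / len `^ (p - 1)).
  rewrite /v powRM ?invr_ge0 ?(ltW w0)// -[(_ * _)^-1]powR_inv1 ?(ltW w0)//.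
  rewrite -powRrM mulN1r powRN powRM ?powR_ge0 ?(ltW k0)// lK pdq invfM mulrCA mulrA.
  by rewrite mulrC mulrA.
by move=> h; apply: le_trans h _; rewrite addrC mulrAC [X in _ + X]mulrAC.
Qed.

Lemma powRD_le p a b : 0 < p -> 0 <= a -> 0 <= b ->
  (a + b) `^ p <= 2 `^ p * (a `^ p + b `^ p).
Proof.
move=> p0 a0 b0; wlog ab : a b a0 b0 / a <= b => [hw|].
  by case: (leP a b) => [|/ltW] ab; [exact: hw|rewrite addrC [X in _ * X]addrC; exact: hw].
apply: (@le_trans _ _ ((2 * b) `^ p)).
  apply: ge0_ler_powR; rewrite ?nnegrE ?(ltW p0) ?addr_ge0 ?mulr_ge0//.
  by rewrite mulr2n mulrDl mul1r lerD2r.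
by rewrite powRM// ler_wpM2l ?powR_ge0// lerDr powR_ge0.
Qed.

Lemma norm_powR_continuous q a e : 0 < q -> 0 < e -> exists2 eta, 0 < eta &
  forall b, `|b - a| <= eta -> `| `|b| `^ q - `|a| `^ q| <= e.
Proof.
move=> q0 e0; have [->|a0] := eqVneq a 0.
  exists (e `^ q^-1); first exact: powR_gt0.
  move=> b; rewrite subr0 => be; rewrite normr0 (powR0 (lt0r_neq0 q0)) subr0 (ger0_norm (powR_ge0 _ _)).
  have <- : (e `^ q^-1) `^ q = e by rewrite -powRrM mulVf ?gt_eqF// powRr1// ltW.
  by apply: ge0_ler_powR; rewrite ?nnegrE ?powR_ge0// ltW.
have na0 : 0 < `|a| by rewrite normr_gt0.
have : {for `|a|, continuous (fun u : R => u `^ q)}.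
  apply: differentiable_continuous; apply/derivable1_diffP; apply: derivable_powR.
  by rewrite in_itv/= na0.
move=> /cvgrPdist_le /(_ e e0)[eta /= eta0 H]; exists (eta / 2); first by rewrite divr_gt0.
move=> b ba; rewrite distrC; apply: H => /=.
apply: (le_lt_trans (ler_dist_dist _ _)); rewrite distrC; apply: le_lt_trans ba _.
by rewrite ltr_pdivrMr// ltr_pMr// ltrDl.
Qed.

End real_powers.

Lemma forall_ord_large d (P : 'I_d -> nat -> Prop) :
  (forall i, exists N, forall M, (N <= M)%N -> P i M) ->
  exists N, forall M, (N <= M)%N -> forall i, P i M.
Proof.
move=> /choice[N NP]; exists (\max_i N i) => M NM i; apply: NP.
exact: leq_trans (leq_bigmax i) NM.
Qed.

(** * Pathwise first-order expansion *)

Section expansion.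
Context {R : realType} {T : R} {d : nat}.
Hypothesis T0 : 0 < T.
Local Notation X := (C0_path T d).
Local Notation D := (cadlag_path T d).
Local Notation lambda := (@lebesgue_measure R).
Variables (p q : R).
Hypothesis (p1 : 1 < p) (qE : q = p / (p - 1)).
Variables (f : X -> R) (ft : D -> R) (Dft : R -> D -> 'rV[R]_d).
Hypothesis hf : D1b_with p f ft Dft.
Local Notation Df := (fun t (w : X) => Dft t (cadlag_of_C0 w)).
Implicit Types (x y : X) (s t e : R) (i : 'I_d).

Let p0 : 0 < p. Proof. exact: lt_trans p1. Qed.
Let q0 : 0 < q. Proof. by have [_ q1 _ _ _] := conjugate_exponent p1 qE; exact: lt_trans q1. Qed.

Definition dincr x y (tau : nat -> R) (j : nat) i : R :=
  (y (tau j.+1) 0 i - x (tau j.+1) 0 i) - (y (tau j) 0 i - x (tau j) 0 i).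

Definition penergy x y (n : nat) (tau : nat -> R) : R :=
  \sum_(j < n) \sum_i `|dincr x y tau j i| `^ p / (tau j.+1 - tau j) `^ (p - 1).

Definition first_order x y (n : nat) (tau : nat -> R) : R :=
  \sum_(j < n) \sum_i Df (tau j.+1) x 0 i * dincr x y tau j i.

(** The first argument is a cadlag path, so that the same expression covers the stopped paths and
    the intermediate bumped ones. *)
Definition gap (w : D) x t : R := \sum_i `|Dft t w 0 i - Df t x 0 i| `^ q.

Definition gap_int x y : R :=
  \int[lambda]_(t in `]0, T]) gap (cadlag_of_C0 (stop_path T0 x y t)) x t.

Definition gap_sum x y (n : nat) (tau : nat -> R) : R :=
  \sum_(j < n) (tau j.+1 - tau j) *
    gap (cadlag_of_C0 (stop_path T0 x y (tau j.+1))) x (tau j.+1).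

Definition vanishing_mesh (n : nat -> nat) (tau : nat -> nat -> R) : Prop :=
  forall delta : R, 0 < delta -> exists M0, forall M, (M0 <= M)%N -> forall j, (j < n M)%N ->
    tau M j.+1 - tau M j < delta.

Lemma gap_ge0 w x t : 0 <= gap w x t.
Proof. by apply: sumr_ge0 => i _; exact: powR_ge0. Qed.

Lemma stop_path_bound x y (Mx My : R) : (forall t i, `|x t 0 i| <= Mx) ->
  (forall t i, `|y t 0 i| <= My) -> forall s t i, 0 <= t <= T ->
  `|stop_path T0 x y s t 0 i| <= Mx + (My + Mx).
Proof.
move=> xM yM s t i tT; rewrite stop_pathE//; apply: le_trans (ler_normD _ _) _.
by apply: lerD => //; apply: le_trans (ler_normB _ _) _; exact: lerD.
Qed.

Lemma coord_bound (K : R) : exists2 M : R, 0 <= M & forall t (w : D), 0 <= t <= T ->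
  (forall u i, 0 <= u <= T -> `|w u 0 i| <= K) -> forall i, `|Dft t w 0 i| <= M.
Proof.
have [_ _ _ _ bp] := hf; have [M HM] := bp (d%:R `^ p^-1 * `|K| + 1).
exists `|M| => // t w tT wK i.
apply: le_trans (coord_le_lnorm _ i p0) _; apply: le_trans (ler_norm M).
apply: HM => //; apply: le_lt_trans (sup_lnorm_le T0 p0 (normr_ge0 K) _) _.
  by move=> u j uT; apply: le_trans (wK u j uT) (ler_norm _).
by rewrite ltrDl.
Qed.

(** The paths [w] are only required to be close to the stopped paths: this covers both the
    intermediate paths of the Taylor sum and the stopped paths themselves, with one limit. *)
Lemma gap_cvg x y (n : nat -> nat) (tau : nat -> nat -> R) (w : nat -> nat -> D) (K0 : R) :
  (forall M, is_partition T (n M) (tau M)) -> vanishing_mesh n tau ->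
  (forall M j, (j < n M)%N -> close_paths T (w M j) (stop_path T0 x y (tau M j.+1)) K0) ->
  (forall e, 0 < e -> exists M0, forall M, (M0 <= M)%N -> forall j, (j < n M)%N ->
     close_paths T (w M j) (stop_path T0 x y (tau M j.+1)) e) ->
  measurable_fun `]0, T] (fun t => gap (cadlag_of_C0 (stop_path T0 x y t)) x t) /\
  \sum_(j < n M) (tau M j.+1 - tau M j) * gap (w M j) x (tau M j.+1) @[M --> \oo] -->
  gap_int x y.
Proof.
move=> tP mesh wK0 wcl; have [_ _ _ Fll _] := hf.
have [B1 cB1 HB1] := joint_cont_countable T0 x y Fll.
(* Stopping x along itself gives x back, so this instance is the continuity in t of D_t f(x) outside
   a countable set. *)
have [B2 cB2 HB2] := joint_cont_countable T0 x x Fll.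
have [Mx Mx0 xM] := C0_bounded T0 x; have [My My0 yM] := C0_bounded T0 y.
have [K K_ge0 HK] := coord_bound (Mx + (My + Mx) + K0).
have [K' K'_ge0 HK'] := coord_bound Mx.
apply: (@riemann_cvg _ T n tau (fun M j => gap (w M j) x (tau M j.+1)) _ (B1 `|` B2)
  (\sum_(i < d) (K + K') `^ q)) => //.
- rewrite -bigcup2E; apply: bigcup_countable => // -[|[|k]] _ //=.
- move=> M j jn; have tT := partition_itv (tP M) jn.
  rewrite ger0_norm ?gap_ge0//; apply: ler_sum => i _.
  apply: ge0_ler_powR; rewrite ?nnegrE ?addr_ge0 ?(ltW q0)//.
  apply: le_trans (ler_normB _ _) _; apply: lerD; last first.
    by apply: HK' => // u k _; exact: xM.
  apply: HK => // u k uT.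
  have -> : w M j u 0 k = (w M j u 0 k - stop_path T0 x y (tau M j.+1) u 0 k) +
    stop_path T0 x y (tau M j.+1) u 0 k by rewrite subrK.
  apply: le_trans (ler_normD _ _) _; rewrite addrC; apply: lerD.
    exact: (stop_path_bound xM yM).
  exact/ltW/wK0.
- move=> t tT nB e e0; have /andP[t0 tT'] := tT.
  have tTc : 0 <= t <= T by rewrite (ltW t0).
  have ed : 0 < e / d.+1%:R by rewrite divr_gt0.
  suff : exists M0, forall M, (M0 <= M)%N -> forall i j, (j < n M)%N ->
      tau M j < t <= tau M j.+1 ->
      `| `|Df t (stop_path T0 x y t) 0 i - Df t x 0 i| `^ q -
         `|Dft (tau M j.+1) (w M j) 0 i - Df (tau M j.+1) x 0 i| `^ q| <= e / d.+1%:R.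
    move=> [M0 H]; exists M0 => M MM j jn tj; rewrite /gap -sumrB.
    apply: le_trans (ler_norm_sum _ _ _) _.
    apply: (@le_trans _ _ (\sum_(i < d) e / d.+1%:R)).
      by apply: ler_sum => i _; exact: H.
    rewrite sumr_const card_ord -[_ *+ d]mulr_natr mulrAC ler_pdivrMr// ler_wpM2l ?ler_nat//.
    exact: ltW.
  apply: forall_ord_large => i.
  have [eta eta0 Heta] := norm_powR_continuous
    (Df t (stop_path T0 x y t) 0 i - Df t x 0 i) q0 ed.
  have eta20 : 0 < eta / 2 by rewrite divr_gt0.
  have [|e1 e10 H1] := HB1 t tTc _ _ eta20; first by move=> Bt; apply: nB; left.
  have [|e2 e20 H2] := HB2 t tTc _ _ eta20; first by move=> Bt; apply: nB; right.
  have e12 : 0 < Num.min e1 e2 by rewrite lt_min e10.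
  have [M1 HM1] := mesh _ e12; have [M2 HM2] := wcl _ e10.
  exists (maxn M1 M2) => M; rewrite geq_max => /andP[M1M M2M] j jn /andP[jt tj].
  have tT2 := partition_itv (tP M) jn.
  have /andP[d1 d2] : (`|tau M j.+1 - t| < e1) && (`|tau M j.+1 - t| < e2).
    rewrite -lt_min ger0_norm ?subr_ge0//; apply: lt_trans (HM1 M M1M j jn).
    by rewrite ltrD2l ltrN2.
  rewrite distrC; apply: Heta.
  have -> : Dft (tau M j.+1) (w M j) 0 i - Df (tau M j.+1) x 0 i -
     (Df t (stop_path T0 x y t) 0 i - Df t x 0 i) =
     (Dft (tau M j.+1) (w M j) 0 i - Df t (stop_path T0 x y t) 0 i) -
     (Df (tau M j.+1) x 0 i - Df t x 0 i) by ring.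
  rewrite (splitr eta); apply: le_trans (ler_normB _ _) _; apply: lerD.
    by apply: H1 => //; exact: HM2.
  have := H2 _ (cadlag_of_C0 x) tT2 d2; rewrite !stop_path_id; apply.
  by move=> u k _; rewrite subrr normr0.
Qed.

Lemma gap_sum_cvg x y (n : nat -> nat) (tau : nat -> nat -> R) :
  (forall M, is_partition T (n M) (tau M)) -> vanishing_mesh n tau ->
  measurable_fun `]0, T] (fun t => gap (cadlag_of_C0 (stop_path T0 x y t)) x t) /\
  gap_sum x y (n M) (tau M) @[M --> \oo] --> gap_int x y.
Proof.
move=> tP mesh; have z w (e : R) : 0 < e -> close_paths T (cadlag_of_C0 w : D) w e.
  by move=> e0 t i _; rewrite /= subrr normr0.
apply: (@gap_cvg x y n tau (fun M j => cadlag_of_C0 (stop_path T0 x y (tau M j.+1))) 1) => //.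
  by move=> M j _; exact: z.
by move=> e e0; exists 0%N => M _ j _; exact: z.
Qed.

(** The Taylor sum minus the first-order sum pairs differences of D f with increments of h;
    [young_scaled] separates them into a gap sum, which converges, and the energy, kept in discrete
    form until it is compared with the cost. *)
Lemma first_order_expansion x y (n : nat -> nat) (tau : nat -> nat -> R) (kappa e : R) :
  (forall M, is_partition T (n M) (tau M)) -> vanishing_mesh n tau ->
  0 < kappa -> 0 < e -> exists M0, forall M, (M0 <= M)%N ->
  `|f y - f x - first_order x y (n M) (tau M)| <=
    kappa `^ q / q * gap_int x y + (kappa `^ p)^-1 / p * penergy x y (n M) (tau M) + e.
Proof.
move=> tP mesh k0 e0; have [ftf Fd [ftc _] Fll _] := hf.
have [Mx Mx0 xM] := C0_bounded T0 x; have [My My0 yM] := C0_bounded T0 y.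
have [l lP] := choice (fun M => step_path_taylor Fd x y (tP M)).
pose w M j : D := Defs.bump (step_path x y (tau M) j) (tau M j.+1)
  (l M j *: increment x y (tau M) j).
have tauT M j : (j < n M)%N -> tau M j.+1 - tau M j < T + 1.
  move=> jn; have /andP[_ h1] := partition_itv (tP M) jn.
  have /andP[h2 _] := partition_itv (tP M) (ltnW jn).
  by apply: (le_lt_trans (_ : _ <= T)); rewrite ?ltrDl// lerBlDr (le_trans h1)// lerDl.
(* The crude mesh bound T + 1 gives closeness uniform in M, needed for domination; the actual mesh
   gives closeness that tends to 0. *)
have [||_ cvgap] := @gap_cvg x y n tau w ((My + Mx) + (My + Mx) + 1) tP mesh.
- move=> M j jn; apply: (@bump_close _ _ _ T0 x y (n M) (tau M) (tP M) (T + 1)) => //.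
  + move=> s t i _; apply: le_lt_trans (ler_normB _ _) _.
    apply: (@le_lt_trans _ _ ((My + Mx) + (My + Mx))); last by rewrite ltrDl.
    by apply: lerD; apply: le_trans (ler_normB _ _) _; exact: lerD.
  + by move=> k kn; exact: tauT.
  + by have [] := lP M.
  + by rewrite ltr_wpDl// !addr_ge0.
- move=> e' e'0; have [delta d0 osc] := sub_unif_continuous_path T0 x y e'0.
  have [M0 HM0] := mesh _ d0; exists M0 => M MM j jn.
  apply: (@bump_close _ _ _ T0 x y (n M) (tau M) (tP M) delta) => //.
    by move=> k kn; exact: HM0.
  by have [] := lP M.
(* Half of e pays for the final step path, which only approaches y, and half for replacing the gap
   sum by its limit. *)
have e20 : 0 < e / 2 by rewrite divr_gt0.
have c10 : 0 < kappa `^ q / q + 1 by rewrite ltr_wpDl// divr_ge0 ?powR_ge0// ltW.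
have e30 : 0 < e / 2 / (kappa `^ q / q + 1) by rewrite divr_gt0.
have /cvgrPdist_le/(_ _ e30)[M1 _ HM1] := cvgap.
have : nbhs (cadlag_of_C0 y) [set w' : D | `|ft (cadlag_of_C0 y) - ft w'| < e / 2].
  by have /cvgrPdist_lt/(_ _ e20) := ftc (cadlag_of_C0 y).
move=> /nbhs_cadlagP[eta eta0 Heta].
have [delta d0 osc] := sub_unif_continuous_path T0 x y eta0.
have [M2 HM2] := mesh _ d0.
exists (maxn M1 M2) => M; rewrite geq_max => /andP[M1M M2M].
have fy : `|f y - ft (step_path x y (tau M) (n M))| <= e / 2.
  rewrite -ftf; apply/ltW/Heta.
  move=> t i tT; have mM j : (j < n M)%N -> tau M j.+1 - tau M j < delta by exact: HM2.
  exact (step_path_final (tP M) osc mM eta0 i tT).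
have [_ /(_ _ (leqnn _)) fx] := lP M; rewrite ftf in fx.
have -> : f y - f x - first_order x y (n M) (tau M) =
  (f y - ft (step_path x y (tau M) (n M))) +
  \sum_(j < n M) \sum_i (Dft (tau M j.+1) (w M j) 0 i - Df (tau M j.+1) x 0 i) *
     dincr x y (tau M) j i.
  have -> : \sum_(j < n M) \sum_i (Dft (tau M j.+1) (w M j) 0 i - Df (tau M j.+1) x 0 i) *
     dincr x y (tau M) j i = (ft (step_path x y (tau M) (n M)) - f x) -
     first_order x y (n M) (tau M).
    rewrite fx /first_order -sumrB; apply: eq_bigr => j _; rewrite -sumrB.
    by apply: eq_bigr => i _; rewrite mulrBl /w /increment /dincr !mxE.
  by ring.
apply: le_trans (ler_normD _ _) _.
rewrite [in leRHS](splitr e) addrA addrC; apply: lerD => //.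
apply: (@le_trans _ _ (kappa `^ q / q *
    (\sum_(j < n M) (tau M j.+1 - tau M j) * gap (w M j) x (tau M j.+1)) +
    (kappa `^ p)^-1 / p * penergy x y (n M) (tau M))).
  rewrite !mulr_sumr -big_split/=; apply: le_trans (ler_norm_sum _ _ _) _.
  apply: ler_sum => j _; rewrite /gap !mulr_sumr -big_split/=.
  apply: le_trans (ler_norm_sum _ _ _) _; apply: ler_sum => i _.
  apply: young_scaled => //; rewrite subr_gt0; have [_ _] := tP M; exact.
rewrite addrAC lerD2r.
have /ler_distlDr : `|gap_int x y - \sum_(j < n M) (tau M j.+1 - tau M j) * gap (w M j) x (tau M j.+1)|
    <= e / 2 / (kappa `^ q / q + 1) by exact: HM1.
move=> le1.
have c1 : 0 <= kappa `^ q / q by rewrite divr_ge0 ?powR_ge0// ltW.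
have gle : \sum_(j < n M) (tau M j.+1 - tau M j) * gap (w M j) x (tau M j.+1) <=
    gap_int x y + e / 2 / (kappa `^ q / q + 1).
  have /ler_normlP[h1 h2] : `|gap_int x y - \sum_(j < n M) (tau M j.+1 - tau M j) * gap (w M j) x (tau M j.+1)|
    <= e / 2 / (kappa `^ q / q + 1) by exact: HM1.
  by rewrite addrC -lerBlDr -opprB.
apply: le_trans (ler_wpM2l c1 gle) _; rewrite mulrDr lerD2l.
rewrite mulrA ler_pdivrMr// mulrC ler_wpM2l ?(ltW e20)// lerDl//.
Qed.

Section growth.
Variable C : R.
Hypothesis DC : forall t w, 0 <= t <= T ->
  lnorm p (Df t w) <= C * (1 + sup_lnorm T p w `^ (p - 1)).

(** Raising the bound of order p - 1 to the power q gives order p, because (p - 1) q = p. *)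
Lemma coord_growth : exists2 C1 : R, 0 <= C1 & forall t w i, 0 <= t <= T ->
  `|Df t w 0 i| `^ q <= C1 * (1 + psup (T := T) w `^ p).
Proof.
have [_ _ _ pmq _] := conjugate_exponent p1 qE; pose c := d%:R `^ p^-1 : R.
have c0 : 0 <= c by exact: powR_ge0.
pose C0 := `|C| * (1 + c `^ (p - 1)).
have C00 : 0 <= C0 by rewrite mulr_ge0// addr_ge0// powR_ge0.
exists (C0 `^ q * (2 `^ q)) => [|t w i tT]; first by rewrite mulr_ge0// powR_ge0.
have S0 := psup_C0_ge0 T0 w.
have le1 : `|Df t w 0 i| <= C0 * (1 + psup (T := T) w `^ (p - 1)).
  apply: le_trans (coord_le_lnorm _ i p0) _; apply: le_trans (DC w tT) _.
  rewrite /C0 -mulrA; apply: le_trans (ler_norm _) _; rewrite normrM ler_wpM2l//.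
  rewrite ger0_norm ?addr_ge0 ?powR_ge0//.
  have sl : sup_lnorm T p w <= c * psup (T := T) w.
    apply: sup_lnorm_le => // u k _; exact: psup_C0_ge.
  have sl0 : 0 <= sup_lnorm T p w by apply: le_trans S0 _; exact: psup_le_sup_lnorm.
  apply: (@le_trans _ _ (1 + c `^ (p - 1) * psup (T := T) w `^ (p - 1))).
    rewrite lerD2l -powRM//; apply: ge0_ler_powR; rewrite ?nnegrE ?mulr_ge0// subr_ge0 ltW//.
  set u := c `^ _; set v := _ `^ (p - 1); have u0 : 0 <= u by exact: powR_ge0.
  have v0 : 0 <= v by exact: powR_ge0.
  nra.
apply: (@le_trans _ _ ((C0 * (1 + psup (T := T) w `^ (p - 1))) `^ q)).
  by apply: ge0_ler_powR; rewrite ?nnegrE ?mulr_ge0 ?addr_ge0 ?powR_ge0 ?(ltW q0).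
rewrite powRM ?addr_ge0 ?powR_ge0// -mulrA ler_wpM2l ?powR_ge0//.
apply: le_trans (powRD_le q0 ler01 (powR_ge0 _ _)) _.
by rewrite powR1 -powRrM pmq.
Qed.

Lemma gap_growth : exists2 C2 : R, 0 <= C2 & forall t x y, 0 <= t <= T ->
  gap (cadlag_of_C0 (stop_path T0 x y t)) x t <=
    C2 * (1 + psup (T := T) x `^ p + psup (T := T) (fun s => y s - x s) `^ p).
Proof.
have [C1 C10 H] := coord_growth.
exists (d%:R * (2 `^ q * (C1 * (2 + 2 * 2 `^ p)))) => [|t x y tT].
  by rewrite !mulr_ge0 ?powR_ge0// addr_ge0// mulr_ge0// powR_ge0.
have Sx0 := psup_C0_ge0 T0 x; have Sh0 := psup_sub_ge0 T0 x y.
set Sx := psup (T := T) x in Sx0 *; set Sh := psup _ in Sh0 *.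
have Sst : psup (T := T) (stop_path T0 x y t) <= Sx + Sh.
  apply: psup_le; first exact: addr_ge0.
  move=> u i uT; rewrite stop_pathE//; apply: le_trans (ler_normD _ _) _.
  by apply: lerD; [exact: psup_C0_ge|exact: psup_sub_ge].
apply: (@le_trans _ _ (\sum_(i < d) (2 `^ q * (C1 * (2 + 2 * 2 `^ p))) *
    (1 + Sx `^ p + Sh `^ p))); last first.
  by rewrite sumr_const card_ord -[_ *+ d]mulr_natl mulrA.
apply: ler_sum => i _.
apply: (@le_trans _ _ ((`|Df t (stop_path T0 x y t) 0 i| + `|Df t x 0 i|) `^ q)).
  by apply: ge0_ler_powR; rewrite ?nnegrE ?addr_ge0 ?(ltW q0)//; exact: ler_normB.
apply: le_trans (powRD_le q0 (normr_ge0 _) (normr_ge0 _)) _.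
rewrite -!mulrA ler_wpM2l ?powR_ge0//.
apply: le_trans (lerD (H t _ i tT) (H t _ i tT)) _.
rewrite -mulrDr ler_wpM2l//.
have le2 : psup (T := T) (stop_path T0 x y t) `^ p <= 2 `^ p * (Sx `^ p + Sh `^ p).
  apply: le_trans (powRD_le p0 Sx0 Sh0); apply: ge0_ler_powR; rewrite ?nnegrE ?(ltW p0)//.
    exact: psup_C0_ge0.
  exact: addr_ge0.
have a0 : 0 <= Sx `^ p by exact: powR_ge0.
have b0 : 0 <= Sh `^ p by exact: powR_ge0.
have c0 : 0 <= 2 `^ p :> R by exact: powR_ge0.
rewrite -/Sx; move: le2; set u := psup _ `^ p; set a := Sx `^ p in a0 *.
set b := Sh `^ p in b0 *; set c := 2 `^ p in c0 * => le2.
nra.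
Qed.

Hypothesis Dc : forall t, 0 <= t <= T -> continuous (Df t).

Lemma uniform_partition M : is_partition T M.+1 (fun j => j%:R * (T / M.+1%:R)).
Proof.
split=> [||j jM]; first by rewrite mul0r.
  by rewrite mulrC divfK.
by rewrite ltr_pM2r ?divr_gt0// ltr_nat.
Qed.

Lemma uniform_partition_mesh :
  vanishing_mesh S (fun M j => j%:R * (T / M.+1%:R)).
Proof.
move=> delta d0; exists (Num.bound (T / delta)) => M MM j _.
rewrite -mulrBl -natr1 addrAC subrr add0r mul1r ltr_pdivrMr// mulrC -ltr_pdivrMr//.
apply: lt_le_trans (archi_boundP _) _; first by rewrite divr_ge0// ltW.
by rewrite ler_nat (leq_trans MM).
Qed.

Lemma measurable_gap x y :
  measurable_fun `]0, T] (fun t => gap (cadlag_of_C0 (stop_path T0 x y t)) x t).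
Proof. by have [] := gap_sum_cvg x y uniform_partition uniform_partition_mesh. Qed.

Lemma gap_int_ge0 x y : 0 <= gap_int x y.
Proof. by apply: Rintegral_ge0 => t _; exact: gap_ge0. Qed.

Lemma gap_int_growth : exists2 C3 : R, 0 <= C3 & forall x y,
  gap_int x y <= C3 * (1 + psup (T := T) x `^ p + psup (T := T) (fun s => y s - x s) `^ p).
Proof.
have [C2 C20 H] := gap_growth; exists (C2 * T) => [|x y]; first by rewrite mulr_ge0// ltW.
set B := (X in _ <= _ * X); have HB t : `]0, T]%classic t ->
    gap (cadlag_of_C0 (stop_path T0 x y t)) x t <= C2 * B.
  by rewrite /= in_itv/= => /andP[t0 tT]; apply: H; rewrite (ltW t0).
have ci := integrable_cst_itv 0 T (C2 * B).
have gi : lambda.-integrable `]0, T] (EFin \o (fun t => gap (cadlag_of_C0 (stop_path T0 x y t)) x t)).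
  apply: (integrable_real_le _ _ ci); [exact: measurable_itv|exact: measurable_gap|].
  by move=> t tT; rewrite ger0_norm ?gap_ge0//; exact: HB.
apply: (@le_trans _ _ (\int[lambda]_(t in `]0, T]) (C2 * B))).
  by apply: le_Rintegral => //; exact: measurable_itv.
rewrite Rintegral_cst//.
have lamE : lambda `]0, T]%classic = T%:E.
  by rewrite lebesgue_measure_itv/= lte_fin T0 -EFinB subr0.
by rewrite (congr1 fine lamE : fine _ = T) mulrAC.
Qed.

(** Dominated convergence in t, using the continuity of each D_t f in the path. The bounds by 1 keep
    all paths in a bounded set, on which D f is bounded uniformly in t. *)
Lemma gap_int_continuous (xn yn : nat -> X) x y :
  (forall n t i, 0 <= t <= T -> `|xn n t 0 i - x t 0 i| <= 1) ->
  (forall n t i, 0 <= t <= T -> `|yn n t 0 i - y t 0 i| <= 1) ->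
  xn @ \oo --> x -> yn @ \oo --> y ->
  gap_int (xn n) (yn n) @[n --> \oo] --> gap_int x y.
Proof.
move=> xn1 yn1 xnx yny.
have [Mx Mx0 xM] := C0_bounded T0 x; have [My My0 yM] := C0_bounded T0 y.
have bnd (v : nat -> X) (w : X) (M : R) : (forall n t i, 0 <= t <= T -> `|v n t 0 i - w t 0 i| <= 1) ->
    (forall t i, `|w t 0 i| <= M) -> forall n t i, `|v n t 0 i| <= M + 1.
  move=> v1 wM n t i; rewrite (C0_frozen (v n)); set s := clamp T t.
  have -> : v n s 0 i = w s 0 i + (v n s 0 i - w s 0 i) by rewrite addrCA subrr addr0.
  apply: le_trans (ler_normD _ _) _; apply: lerD => //; apply: v1.
  by apply: clamp_itv; exact: ltW.
have bx := bnd xn x Mx xn1 xM; have by_ := bnd yn y My yn1 yM.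
have [K K0 HK] := coord_bound (Mx + 1 + (My + 1 + (Mx + 1))).
have [K' K'0 HK'] := coord_bound (Mx + 1).
have stc t : 0 <= t <= T -> (stop_path T0 (xn n) (yn n) t) @[n --> \oo] --> stop_path T0 x y t.
  move=> tT A /nbhs_C0P[eta eta0 HA].
  have e0 : 0 < eta / 3 by rewrite divr_gt0.
  have [N1 H1] := C0_cvg_near xnx e0; have [N2 H2] := C0_cvg_near yny e0.
  exists (maxn N1 N2) => // n /=; rewrite geq_max => /andP[n1 n2]; apply: HA => s i sT.
  rewrite !stop_pathE//; set m := Num.min s t.
  have mT : 0 <= m <= T.
    by case/andP: sT => s0 sT; case/andP: tT => t0 tT; rewrite /m le_min s0 t0/= ge_min sT.
  have -> : xn n s 0 i + (yn n m 0 i - xn n m 0 i) - (x s 0 i + (y m 0 i - x m 0 i)) =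
    (xn n s 0 i - x s 0 i) + (yn n m 0 i - y m 0 i) - (xn n m 0 i - x m 0 i) by ring.
  have h1 := H1 n n1 s i sT; have h2 := H2 n n2 m i mT; have h3 := H1 n n1 m i mT.
  apply: le_lt_trans (ler_normB _ _) _; apply: le_lt_trans (lerD (ler_normD _ _) (lexx _)) _.
  by move: h1 h2 h3; lra.
have [|||||||_ //] := @real_dominated_cvg _ _ _ lambda `]0, T]%classic set0
  (fun n t => gap (cadlag_of_C0 (stop_path T0 (xn n) (yn n) t)) (xn n) t)
  (fun t => gap (cadlag_of_C0 (stop_path T0 x y t)) x t)
  (fun=> \sum_(i < d) (K + K') `^ q).
- exact: measurable_itv.
- exact: negligible_set0.
- by move=> n; exact: measurable_gap.
- exact: measurable_gap.
- exact: integrable_cst_itv.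
- move=> n t /=; rewrite in_itv/= => /andP[t0 tT].
  have tT' : 0 <= t <= T by rewrite (ltW t0).
  rewrite ger0_norm ?gap_ge0//; apply: ler_sum => i _.
  apply: ge0_ler_powR; rewrite ?nnegrE ?addr_ge0 ?(ltW q0)//.
  apply: le_trans (ler_normB _ _) _; apply: lerD; last first.
    by apply: HK' => // u k _; exact: bx.
  apply: HK => // u k uT; apply: stop_path_bound => //.
- move=> t /=; rewrite in_itv/= => /andP[t0 tT] _.
  have tT' : 0 <= t <= T by rewrite (ltW t0).
  apply: cvg_big => [|i _]; first exact: add_continuous.
  have cv (v : nat -> X) w : v @ \oo --> w -> Df t (v n) 0 i @[n --> \oo] --> Df t w 0 i.
    move=> vw; apply: (@cvg_comp _ _ _ (fun n => Df t (v n)) (fun M : 'rV[R]_d => M 0 i) _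
      (nbhs (Df t w))); last exact: coord_continuous.
    by move=> A /(Dc tT')/vw.
  apply/cvgrPdist_le => e e0; have [eta eta0 Heta] := norm_powR_continuous
    (Df t (stop_path T0 x y t) 0 i - Df t x 0 i) q0 e0.
  have /cvgrPdist_le/(_ _ eta0) : Df t (stop_path T0 (xn n) (yn n) t) 0 i - Df t (xn n) 0 i @[n --> \oo]
     --> Df t (stop_path T0 x y t) 0 i - Df t x 0 i.
    by apply: cvgB; apply: cv => //; exact: stc.
  by apply: filterS => n; rewrite distrC => /Heta; rewrite distrC.
Qed.

End growth.

End expansion.

(** * Integration against image measures *)

Section change_of_variable.
Context d1 d2 (Y1 : measurableType d1) (Y2 : measurableType d2) (R : realType).
Variables (m1 : {measure set Y1 -> \bar R}) (m2 : {measure set Y2 -> \bar R}) (phi : Y1 -> Y2).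
Hypotheses (mphi : measurable_fun setT phi)
  (m12 : forall A, measurable A -> m1 (phi @^-1` A) = m2 A).

Lemma ge0_integral_image (g : Y2 -> \bar R) : measurable_fun setT g ->
  (forall y, (0 <= g y)%E) -> (\int[m1]_x g (phi x) = \int[m2]_y g y)%E.
Proof.
move=> mg g0; rewrite -(@eq_measure_integral _ _ _ setT m2 (pushforward m1 phi)).
  by rewrite (ge0_integral_pushforward mphi m1 measurableT)// preimage_setT.
by move=> A mA _; exact: m12.
Qed.

Lemma integrable_image (g : Y2 -> R) : m2.-integrable setT (EFin \o g) ->
  m1.-integrable setT (EFin \o (g \o phi)).
Proof.
move=> gi; have mg := integrable_real_measurable gi; apply/integrableP; split.
  exact/measurable_EFinP/measurableT_comp.
have /integrableP[_] := gi.
rewrite -ge0_integral_image//; apply: measurableT_comp => //; exact/measurable_EFinP.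
Qed.

Lemma Rintegral_image (g : Y2 -> R) : m2.-integrable setT (EFin \o g) ->
  \int[m1]_x g (phi x) = \int[m2]_y g y.
Proof.
move=> gi; have mg := integrable_real_measurable gi; rewrite /Rintegral; congr fine.
rewrite -(@eq_measure_integral _ _ _ setT m2 (pushforward m1 phi)).
  have mg' : measurable_fun setT (EFin \o g) by exact/measurable_EFinP.
  by rewrite (@integral_pushforward _ _ _ _ _ _ mphi m1 setT _ mg')// preimage_setT; exact: integrable_image.
by move=> A mA _; exact: m12.
Qed.

End change_of_variable.

Lemma integrable_ge0_bound d (Y : measurableType d) (R : realType)
    (m : {measure set Y -> \bar R}) (g : Y -> R) (b : R) :
  measurable_fun setT g -> (forall y, 0 <= g y) -> (\int[m]_y (g y)%:E <= b%:E)%E ->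
  m.-integrable setT (EFin \o g) /\ \int[m]_y g y <= b.
Proof.
move=> mg g0 gb; have gi : m.-integrable setT (EFin \o g).
  apply/integrableP; split; first exact/measurable_EFinP.
  apply: (@le_lt_trans _ _ b%:E); last exact: ltry.
  by under eq_integral => y _ do rewrite /= ger0_norm//.
by split=> //; rewrite -lee_fin /Rintegral fineK//; exact: integrable_fin_num.
Qed.

Lemma Rintegral_le_mono d (Y : measurableType d) (R : realType)
    (m : {measure set Y -> \bar R}) (f g : Y -> R) :
  m.-integrable setT (EFin \o f) -> m.-integrable setT (EFin \o g) ->
  (forall y, f y <= g y) -> \int[m]_y f y <= \int[m]_y g y.
Proof. by move=> fi gi fg; exact: le_Rintegral. Qed.

Lemma integrable_cstT d (Y : measurableType d) (R : realType) (m : probability Y R) (c : R) :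
  m.-integrable setT (EFin \o (fun=> c)).
Proof.
apply/integrableP; split; first exact: measurable_cst.
by rewrite /= integral_cst//= probability_setT mule1 ltry.
Qed.

Lemma Rintegral_cstT d (Y : measurableType d) (R : realType) (m : probability Y R) (c : R) :
  \int[m]_y c = c.
Proof. by rewrite /Rintegral/= integral_cst//= probability_setT mule1. Qed.

(** * Expected first-order expansion under a coupling *)

Section coupling_estimates.
Context {R : realType} {T : R} {d : nat}.
Hypothesis T0 : 0 < T.
Local Notation X := (C0_path T d).
Local Notation D := (cadlag_path T d).
Variables (p q : R).
Hypothesis (p1 : 1 < p) (qE : q = p / (p - 1)).
Variables (f : X -> R) (ft : D -> R) (Dft : R -> D -> 'rV[R]_d).
Hypothesis hf : D1b_with p f ft Dft.
Local Notation Df := (fun t (w : X) => Dft t (cadlag_of_C0 w)).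
Variable C : R.
Hypothesis fC : forall w, `|f w| <= C * (1 + sup_lnorm T p w `^ p).
Hypothesis Dc : forall t, 0 <= t <= T -> continuous (Df t).
Hypothesis DC : forall t w, 0 <= t <= T ->
  lnorm p (Df t w) <= C * (1 + sup_lnorm T p w `^ (p - 1)).
Variable mu : probability X R.
Hypothesis hmu : (\int[mu]_w (sup_lnorm T p w `^ p)%:E < +oo)%E.
Implicit Types (x y w : X) (s t e : R) (i : 'I_d).
Local Notation S v := (psup (T := T) v).
Local Notation h_ x y := (fun s => (y : R -> 'rV[R]_d) s - (x : R -> 'rV[R]_d) s).

Let p0 : 0 < p. Proof. exact: lt_trans p1. Qed.
Let q1 : 1 < q. Proof. by have [_ q1 _ _ _] := conjugate_exponent p1 qE. Qed.
Let q0 : 0 < q. Proof. exact: lt_trans q1. Qed.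

Lemma cost_ge0 x y : (0 <= cost T p x y)%E.
Proof. by rewrite /cost; case: ifP => _ //; exact: poweR_ge0. Qed.

(** The embedding of W_0^{1,p} into continuous paths: [cost_energy] for the single cell [0, t] gives
    |h(t)|^p <= t^(p-1) times the cost. *)
Lemma psup_cost x y : ((S (h_ x y) `^ p)%:E <= (T `^ (p - 1))%:E * cost T p x y)%E.
Proof.
have T1 : 0 < T `^ (p - 1) by exact: powR_gt0.
case cE : (cost T p x y) (cost_ge0 x y) => [c| |] // c0; last by rewrite gt0_muley ?leey.
rewrite lee_fin in c0; rewrite -EFinM lee_fin.
have b0 : 0 <= T `^ (p - 1) * c by rewrite mulr_ge0// ltW.
have : S (h_ x y) <= (T `^ (p - 1) * c) `^ p^-1.
  apply: psup_le; first exact: powR_ge0.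
  move=> t i /andP[t0 tT]; rewrite !mxE.
  move: t0; rewrite le_eqVlt => /predU1P[<-|t0].
    by rewrite !C0_start !mxE subrr normr0 powR_ge0.
  have := @cost_energy R d p T x y p1 T0 1 (fun j => j%:R * t).
  rewrite mul0r mul1r => /(_ (lexx _) tT) H.
  have {H} : ((\sum_(j < 1) \sum_(i < d) `|x (j.+1%:R * t) 0 i - y (j.+1%:R * t) 0 i -
      (x (j%:R * t) 0 i - y (j%:R * t) 0 i)| `^ p / (j.+1%:R * t - j%:R * t) `^ (p - 1))%:E <= c%:E)%E.
    by rewrite -cE; apply: H => -[|//] _; rewrite mul0r mul1r.
  rewrite big_ord1 /= mul0r mul1r !C0_start subr0 lee_fin => H.
  have {}H : `|x t 0 i - y t 0 i| `^ p / t `^ (p - 1) <= c.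
    apply: le_trans H; rewrite (bigD1 i)//= !mxE !subr0 lerDl.
    by apply: sumr_ge0 => j _; rewrite mulr_ge0 ?invr_ge0 ?powR_ge0.
  rewrite distrC -[leLHS](@powRr1 _)// -[X in _ `^ X <= _](mulfV (lt0r_neq0 p0)) powRrM.
  apply: ge0_ler_powR; rewrite ?nnegrE ?powR_ge0 ?invr_ge0 ?(ltW p0)//.
  rewrite ler_pdivrMr ?powR_gt0// in H; apply: le_trans H _; rewrite mulrC ler_wpM2r//.
  by apply: ge0_ler_powR; rewrite ?nnegrE ?subr_ge0 ?(ltW p1) ?(ltW t0) ?(ltW T0).
move=> H; have <- : ((T `^ (p - 1) * c) `^ p^-1) `^ p = T `^ (p - 1) * c.
  by rewrite -powRrM mulVf ?gt_eqF// powRr1.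
by apply: ge0_ler_powR; rewrite ?nnegrE ?powR_ge0 ?(ltW p0)// psup_sub_ge0.
Qed.

Lemma measurable_psup_path : measurable_fun setT (fun w : X => S w).
Proof.
apply: measurable_psup => // [u i|t i]; first exact: C0_coord_continuous.
exact: measurable_coord.
Qed.

Lemma integrable_psup : mu.-integrable setT (EFin \o (fun w => S w `^ p)).
Proof.
have m : measurable_fun setT (fun w : X => S w `^ p).
  exact: measurableT_comp (measurable_powR _) measurable_psup_path.
apply/integrableP; split; first exact/measurable_EFinP.
apply: le_lt_trans hmu; apply: ge0_le_lower_integral => w _ //=.
rewrite lee_fin ger0_norm ?powR_ge0//; apply: ge0_ler_powR; rewrite ?nnegrE ?(ltW p0)//.
- exact: psup_C0_ge0.
- by apply: le_trans (psup_le_sup_lnorm T0 w p0); exact: psup_C0_ge0.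
- exact: psup_le_sup_lnorm.
Qed.

Lemma f_growth : exists2 C1 : R, 0 <= C1 & forall w, `|f w| <= C1 * (1 + S w `^ p).
Proof.
pose c := (d%:R `^ p^-1) `^ p : R; have c0 : 0 <= c by exact: powR_ge0.
exists (`|C| * (1 + c)) => [|w]; first by rewrite mulr_ge0// addr_ge0.
apply: le_trans (fC w) _; rewrite -mulrA; apply: le_trans (ler_norm _) _.
have sl0 : 0 <= sup_lnorm T p w.
  by apply: le_trans (psup_le_sup_lnorm T0 w p0); exact: psup_C0_ge0.
rewrite normrM ler_wpM2l// ger0_norm ?addr_ge0 ?powR_ge0//.
have le1 : sup_lnorm T p w `^ p <= c * S w `^ p.
  rewrite -powRM ?powR_ge0 ?psup_C0_ge0//; apply: ge0_ler_powR; rewrite ?nnegrE ?(ltW p0)//.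
    by rewrite mulr_ge0 ?powR_ge0 ?psup_C0_ge0.
  by apply: sup_lnorm_le => // [|t i _]; [exact: psup_C0_ge0|exact: psup_C0_ge].
have v0 : 0 <= S w `^ p by exact: powR_ge0.
nra.
Qed.

Lemma f_continuous : continuous f.
Proof.
have [ftf _ [ftc _] _ _] := hf; move=> w A.
rewrite -ftf => /(ftc (cadlag_of_C0 w)) /nbhs_cadlagP[eta eta0 H].
apply/nbhs_C0P; exists eta => // w' ww'; rewrite /= -ftf; exact: H.
Qed.

Lemma measurable_f : measurable_fun setT f.
Proof. by apply: continuous_C0_measurable; exact: f_continuous. Qed.

Lemma integrable_f : mu.-integrable setT (EFin \o f).
Proof.
have [C1 C10 H] := f_growth.
apply: (@integrable_real_le _ _ _ _ _ _ _ (fun w => C1 * (1 + S w `^ p))) => //.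
- exact: measurable_f.
- apply: integrable_realZl => //; apply: integrable_realD => //.
    exact: integrable_cstT.
  exact: integrable_psup.
Qed.

Lemma measurable_Df t i : 0 <= t <= T -> measurable_fun setT (fun w : X => Df t w 0 i).
Proof.
move=> tT; apply: continuous_C0_measurable => w.
apply: (@cvg_comp _ _ _ (fun w' => Df t w') (fun M : 'rV[R]_d => M 0 i) _ (nbhs (Df t w))).
  exact: Dc.
exact: coord_continuous.
Qed.

Lemma measurable_penergy n tau : measurable_fun setT (fun z : X * X => penergy p z.1 z.2 n tau).
Proof.
apply: measurable_sum => j; apply: measurable_sum => i; apply: measurable_funM => //.
apply: measurable_norm_powR; apply: measurable_funB; apply: measurable_funB;
  (by apply: (measurableT_comp (measurable_coord T0 _ _))).
Qed.

Lemma penergy_ge0 x y n tau : 0 <= penergy p x y n tau.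
Proof.
by apply: sumr_ge0 => j _; apply: sumr_ge0 => i _; rewrite mulr_ge0 ?invr_ge0 ?powR_ge0.
Qed.

Lemma penergy_cost x y n tau : is_partition T n tau ->
  ((penergy p x y n tau)%:E <= cost T p x y)%E.
Proof.
move=> [tau0 tauT tauS]; apply: le_trans (cost_energy x y p1 T0 _ _ tauS); last 2 first.
- by rewrite tau0.
- by rewrite tauT.
rewrite lee_fin; apply: ler_sum => j _; apply: ler_sum => i _; rewrite /dincr.
rewrite -normrN opprB opprB [X in `|X|](_ : _ = x (tau j.+1) 0 i - y (tau j.+1) 0 i -
  (x (tau j) 0 i - y (tau j) 0 i))//; ring.
Qed.

Lemma measurable_first_order n tau : (forall j, (j < n)%N -> 0 <= tau j.+1 <= T) ->
  measurable_fun setT (fun z : X * X => first_order Dft z.1 z.2 n tau).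
Proof.
move=> tauT; rewrite /first_order.
have H (j : 'I_n) : measurable_fun setT (fun z : X * X =>
   \sum_i Df (tau j.+1) z.1 0 i * dincr z.1 z.2 tau j i).
  apply: measurable_sum => i; apply: measurable_funM.
    by apply: (measurableT_comp (measurable_Df i (tauT j (ltn_ord j)))).
  by apply: measurable_funB; apply: measurable_funB;
    apply: (measurableT_comp (measurable_coord T0 _ _)).
exact: measurable_sum.
Qed.

(** Joint measurability of the integrand in time and paths is avoided: the integral is a pointwise
    limit of Riemann sums, each of which is a finite expression in measurable functions of the
    pair. *)
Lemma measurable_gap_int : measurable_fun setT (fun z : X * X => gap_int T0 q Dft z.1 z.2).
Proof.
apply: (@measurable_fun_cvg _ _ _ _ (fun M (z : X * X) =>
   gap_sum T0 q Dft z.1 z.2 M.+1 (fun j => j%:R * (T / M.+1%:R)))); last first.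
  move=> z _; have [_ cv] := gap_sum_cvg T0 p1 qE hf z.1 z.2
    (uniform_partition T0) (uniform_partition_mesh T0); exact: cv.
move=> M; apply: measurable_sum => j; apply: measurable_funM => //.
have tT := partition_itv (uniform_partition T0 M) (ltn_ord j).
apply: measurable_sum => i; apply: measurable_norm_powR; apply: measurable_funB.
  apply: (measurableT_comp (measurable_Df i tT)).
  apply: measurable_fun_C0 => // t k tT'.
  under eq_fun do rewrite stop_pathE//.
  apply: measurable_funD; last apply: measurable_funB;
    by apply: (measurableT_comp (measurable_coord T0 _ _)).
by apply: (measurableT_comp (measurable_Df i tT)).
Qed.

Section one_coupling.
Variables (pi : probability (X * X)%type R) (a : R).
Hypothesis pi1 : forall A, measurable A -> pi (fst @^-1` A) = mu A.
Hypothesis pia : (\int[pi]_z cost T p z.1 z.2 <= a%:E)%E.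

Lemma integrable_fst (g : X -> R) : mu.-integrable setT (EFin \o g) ->
  pi.-integrable setT (EFin \o (fun z => g z.1)).
Proof. exact: (integrable_image measurable_fst pi1). Qed.

Lemma Rintegral_fst (g : X -> R) : mu.-integrable setT (EFin \o g) ->
  \int[pi]_z g z.1 = \int[mu]_x g x.
Proof. exact: (Rintegral_image measurable_fst pi1). Qed.

Lemma measurable_psup_sub : measurable_fun setT (fun z : X * X => S (h_ z.1 z.2) `^ p).
Proof.
apply: (measurableT_comp (measurable_powR p)); apply: measurable_psup => // [u i|t i].
  rewrite (_ : (fun t => _) = (fun t => u.2 t 0 i - u.1 t 0 i)).
    by move=> t; apply: cvgB; exact: C0_coord_continuous.
  by apply/funext => t; rewrite !mxE.
rewrite (_ : (fun u => _) = (fun u : X * X => u.2 t 0 i - u.1 t 0 i)).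
  by apply: measurable_funB; apply: (measurableT_comp (measurable_coord T0 _ _)).
by apply/funext => u; rewrite !mxE.
Qed.

Lemma psup_sub_expectation :
  pi.-integrable setT (EFin \o (fun z : X * X => S (h_ z.1 z.2) `^ p)) /\
  \int[pi]_(z in setT) S (h_ (z : X * X).1 z.2) `^ p <= T `^ (p - 1) * a.
Proof.
pose c := T `^ (p - 1); have c0 : 0 < c by exact: powR_gt0.
have [|||gi gb] := @integrable_ge0_bound _ _ R pi (fun z : X * X => c^-1 * S (h_ z.1 z.2) `^ p) a.
- by apply: measurable_funM => //; exact: measurable_psup_sub.
- by move=> z; rewrite mulr_ge0 ?powR_ge0// invr_ge0 ltW.
- apply: le_trans pia; apply: ge0_le_lower_integral => z _.
    by rewrite lee_fin mulr_ge0 ?powR_ge0// invr_ge0 ltW.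
  have := psup_cost z.1 z.2; rewrite -/c; case: (cost T p z.1 z.2) => [r| |].
  + by rewrite -EFinM !lee_fin => H; rewrite mulrC ler_pdivrMr// mulrC.
  + by rewrite leey.
  + by rewrite gt0_muleNy// leeNy_eq.
have E : (fun z : X * X => S (h_ z.1 z.2) `^ p) = (fun z : X * X => c * (c^-1 * S (h_ z.1 z.2) `^ p)).
  by apply/funext => z; rewrite mulrA mulfV ?gt_eqF// mul1r.
rewrite E; split; first exact: integrable_realZl.
by rewrite RintegralZl// ler_wpM2l// ltW.
Qed.

Lemma penergy_expectation n tau : is_partition T n tau ->
  pi.-integrable setT (EFin \o (fun z => penergy p z.1 z.2 n tau)) /\
  \int[pi]_z penergy p z.1 z.2 n tau <= a.
Proof.
move=> tP; apply: integrable_ge0_bound; first exact: measurable_penergy.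
  by move=> z; exact: penergy_ge0.
apply: le_trans pia; apply: ge0_le_lower_integral => z _.
  by rewrite lee_fin penergy_ge0.
exact: penergy_cost.
Qed.

Lemma integrable_growth (c : R) : pi.-integrable setT
  (EFin \o (fun z : X * X => c * (1 + S z.1 `^ p + S (h_ z.1 z.2) `^ p))).
Proof.
have [hi _] := psup_sub_expectation; apply: integrable_realZl => //.
apply: integrable_realD => //; apply: integrable_realD => //; first exact: integrable_cstT.
exact: (integrable_fst integrable_psup).
Qed.

Lemma integrable_gap_int : pi.-integrable setT (EFin \o (fun z => gap_int T0 q Dft z.1 z.2)).
Proof.
have [C3 _ H] := gap_int_growth T0 p1 qE hf DC.
apply: (integrable_real_le _ measurable_gap_int (integrable_growth C3)) => // z _.
by rewrite ger0_norm ?gap_int_ge0.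
Qed.

Lemma integrable_f_snd : pi.-integrable setT (EFin \o (fun z => f z.2)).
Proof.
have [C1 C10 H] := f_growth.
apply: (integrable_real_le _ _ (integrable_growth (C1 * 2 `^ p))) => //.
  exact: (measurableT_comp measurable_f).
move=> z _; apply: le_trans (H _) _; rewrite -mulrA ler_wpM2l//.
have Sx0 := psup_C0_ge0 T0 z.1; have Sh0 := psup_sub_ge0 T0 z.1 z.2.
have : S z.2 `^ p <= 2 `^ p * (S z.1 `^ p + S (h_ z.1 z.2) `^ p).
  apply: le_trans (powRD_le p0 Sx0 Sh0); apply: ge0_ler_powR; rewrite ?nnegrE ?(ltW p0)//.
  - exact: psup_C0_ge0.
  - exact: addr_ge0.
  apply: psup_le => [|t i tT]; first exact: addr_ge0.
  rewrite -[z.2 t 0 i](subrK (z.1 t 0 i)) addrC; apply: le_trans (ler_normD _ _) _.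
  by apply: lerD; [exact: psup_C0_ge|exact: psup_sub_ge].
have : 1 <= 2 `^ p :> R by have := ler_powR (ler1n R 2 : 1 <= 2) (ltW p0); rewrite powRr0.
move: (_ `^ p) (_ `^ p) => c u; lra.
Qed.

Lemma first_order_young kappa x y n tau : is_partition T n tau -> 0 < kappa ->
  `|first_order Dft x y n tau| <=
    kappa `^ q / q * (\sum_(j < n) (tau j.+1 - tau j) * \sum_i `|Df (tau j.+1) x 0 i| `^ q) +
    (kappa `^ p)^-1 / p * penergy p x y n tau.
Proof.
move=> [_ _ tS] k0; rewrite !mulr_sumr -big_split/=; apply: le_trans (ler_norm_sum _ _ _) _.
apply: ler_sum => j _; rewrite !mulr_sumr -big_split/=.
apply: le_trans (ler_norm_sum _ _ _) _; apply: ler_sum => i _.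
by apply: young_scaled => //; rewrite subr_gt0; exact: tS.
Qed.

Lemma riemann_coord_growth : exists2 C1 : R, 0 <= C1 & forall x n tau, is_partition T n tau ->
  \sum_(j < n) (tau j.+1 - tau j) * \sum_i `|Df (tau j.+1) x 0 i| `^ q <=
  C1 * (1 + S x `^ p).
Proof.
have [C1 C10 H] := coord_growth T0 p1 qE DC.
exists (T * d%:R * C1) => [|x n tau tP]; first by rewrite !mulr_ge0// ltW.
have [tau0 tauT tS] := tP.
apply: (@le_trans _ _ (\sum_(j < n) (tau j.+1 - tau j) * (d%:R * (C1 * (1 + S x `^ p))))).
  apply: ler_sum => j _; rewrite ler_wpM2l//.
    by rewrite subr_ge0 ltW//; exact: tS.
  apply: (@le_trans _ _ (\sum_(i < d) C1 * (1 + S x `^ p))).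
    by apply: ler_sum => i _; apply: H; exact: partition_itv tP (ltn_ord j).
  by rewrite sumr_const card_ord mulr_natl.
rewrite -mulr_suml (_ : \sum_(j < n) _ = T) ?mulrA//.
by rewrite -(big_mkord predT (fun j => tau j.+1 - tau j)) telescope_sumr// tauT tau0 subr0.
Qed.

Lemma integrable_first_order n tau : is_partition T n tau ->
  pi.-integrable setT (EFin \o (fun z => first_order Dft z.1 z.2 n tau)).
Proof.
move=> tP; have [C1 _ H] := riemann_coord_growth.
have [pI _] := penergy_expectation tP.
apply: (@integrable_real_le _ _ _ _ _ _ _ (fun z : X * X => 1 `^ q / q * (C1 * (1 + S z.1 `^ p)) +
  (1 `^ p)^-1 / p * penergy p z.1 z.2 n tau)) => //.
- by apply: measurable_first_order => j jn; exact: partition_itv tP jn.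
- apply: integrable_realD => //; last exact: integrable_realZl.
  do 2![apply: integrable_realZl => //]; apply: integrable_realD => //.
    exact: integrable_cstT.
  exact: (integrable_fst integrable_psup).
- move=> z _; apply: le_trans (first_order_young _ _ tP ltr01) _; rewrite lerD2r.
  by rewrite ler_wpM2l ?H// divr_ge0 ?powR_ge0// ltW.
Qed.

(** The rank from which the pathwise expansion holds depends on (x, y). What is integrated is
    therefore the excess of the remainder [r] over its bound [b]: its positive part tends to 0
    pointwise, and dominated convergence applies. *)
Lemma expected_expansion (n : nat -> nat) (tau : nat -> nat -> R) (kappa e : R) :
  (forall M, is_partition T (n M) (tau M)) -> vanishing_mesh n tau ->
  0 < kappa -> 0 < e -> exists M0, forall M, (M0 <= M)%N ->
  `|\int[pi]_z f z.2 - \int[mu]_x f x - \int[pi]_z first_order Dft z.1 z.2 (n M) (tau M)| <=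
    kappa `^ q / q * \int[pi]_z gap_int T0 q Dft z.1 z.2 + (kappa `^ p)^-1 / p * a + e.
Proof.
move=> tP mesh k0 e0.
pose r M (z : X * X) := `|f z.2 - f z.1 - first_order Dft z.1 z.2 (n M) (tau M)|.
pose b M (z : X * X) := kappa `^ q / q * gap_int T0 q Dft z.1 z.2 +
  (kappa `^ p)^-1 / p * penergy p z.1 z.2 (n M) (tau M).
have f1i := integrable_fst integrable_f.
have FOi M := integrable_first_order (tP M).
have di M : pi.-integrable setT (EFin \o (fun z => f z.2 - f z.1 -
    first_order Dft z.1 z.2 (n M) (tau M))).
  by apply: integrable_realB => //; apply: integrable_realB => //; exact: integrable_f_snd.
have ri M : pi.-integrable setT (EFin \o r M) by exact: integrable_norm.
have bi M : pi.-integrable setT (EFin \o b M).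
  have [pI _] := penergy_expectation (tP M).
  apply: integrable_realD => //; apply: integrable_realZl => //; exact: integrable_gap_int.
have b0 M z : 0 <= b M z.
  have k1 : 0 <= kappa `^ q / q by rewrite divr_ge0 ?powR_ge0// ltW.
  have k2 : 0 <= (kappa `^ p)^-1 / p by rewrite divr_ge0 ?invr_ge0 ?powR_ge0// ltW.
  by rewrite /b addr_ge0// mulr_ge0// ?gap_int_ge0// penergy_ge0.
have [C1 C10 HC1] := riemann_coord_growth.
pose G (z : X * X) := `|f z.2| + `|f z.1| + kappa `^ q / q * (C1 * (1 + S z.1 `^ p)).
have k1 : 0 <= kappa `^ q / q by rewrite divr_ge0 ?powR_ge0// ltW.
have Gi : pi.-integrable setT (EFin \o G).
  apply: integrable_realD => //.
    by apply: integrable_realD => //; apply: integrable_norm => //; exact: integrable_f_snd.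
  do 2![apply: integrable_realZl => //]; apply: integrable_realD => //.
    exact: integrable_cstT.
  exact: (integrable_fst integrable_psup).
(* The energy, for which no integrable bound uniform in M is at hand, occurs with the same
   coefficient in [b] and in Young's bound on the first-order sum, and cancels. *)
have rbG M z : `|Num.max (r M z - b M z) 0| <= G z.
  have G0 : 0 <= G z.
    by rewrite /G !addr_ge0// mulr_ge0// mulr_ge0// addr_ge0// powR_ge0.
  rewrite ger0_norm ?le_max ?lexx ?orbT// ge_max G0 andbT lerBlDr.
  apply: le_trans (ler_normB _ _) _; apply: le_trans (lerD (ler_normB _ _) (first_order_young _ _ (tP M) k0)) _.
  have := ler_wpM2l k1 (HC1 z.1 _ _ (tP M)); have := mulr_ge0 k1 (gap_int_ge0 T0 q Dft z.1 z.2).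
  rewrite /G /b; move: (kappa `^ q / q * _) => u1; move: (kappa `^ q / q * _) => u2.
  move: (kappa `^ q / q * _) => u3; move: (_ / p * _) => u4; lra.
have mm M : measurable_fun setT (fun z => Num.max (r M z - b M z) 0).
  apply: measurable_maxr => //; apply: measurable_funB; exact: integrable_real_measurable.
have [|||||||_ cv] := @real_dominated_cvg _ _ _ pi setT set0
   (fun M z => Num.max (r M z - b M z) 0) (fun=> 0) G.
- exact: measurableT.
- exact: negligible_set0.
- exact: mm.
- exact: measurable_cst.
- exact: Gi.
- by move=> M z _; exact: rbG.
- move=> z _ _; apply/cvgrPdist_le => e' e'0.
  have [M0 H] := first_order_expansion T0 p1 qE hf z.1 z.2 tP mesh k0 e'0.
  exists M0 => // M /H le1; rewrite sub0r normrN ger0_norm ?le_max ?lexx ?orbT//.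
  by rewrite ge_max (ltW e'0) andbT lerBlDl.
rewrite Rintegral_cstT in cv; have /cvgrPdist_le/(_ _ e0)[M0 _ HM0] := cv.
exists M0 => M /HM0 /=; rewrite sub0r normrN => le1.
have [pI pB] := penergy_expectation (tP M).
rewrite -(Rintegral_fst integrable_f) -!RintegralB//; last 2 first.
- by apply: integrable_realB => //; exact: integrable_f_snd.
- exact: integrable_f_snd.
apply: le_trans (le_normr_Rintegral _ (di M)) _ => //.
have mi : pi.-integrable setT (EFin \o (fun z => Num.max (r M z - b M z) 0)).
  by apply: (integrable_real_le _ (mm M) Gi) => // z _; exact: rbG.
apply: (@le_trans _ _ (\int[pi]_z (b M z + Num.max (r M z - b M z) 0))).
  apply: Rintegral_le_mono; [exact: ri|exact: integrable_realD|].
  by move=> z; rewrite -lerBlDl le_max lexx.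
rewrite RintegralD//; apply: lerD; last exact: le_trans (ler_norm _) le1.
rewrite /b RintegralD//; last 2 first.
- by apply: integrable_realZl => //; exact: integrable_gap_int.
- exact: integrable_realZl.
rewrite !RintegralZl//; last exact: integrable_gap_int.
by rewrite lerD2l ler_wpM2l// divr_ge0 ?invr_ge0 ?powR_ge0// ltW.
Qed.

End one_coupling.

(* A condition on x alone, so that the mass of its complement is governed by mu,
   whatever the coupling. *)
Definition small_gap_set (e K : R) : set X :=
  [set x | forall y, gap_int T0 q Dft x y <= e + K * S (h_ x y) `^ p].

Lemma C0_cvg_harmonic (v : nat -> X) x :
  (forall n t i, 0 <= t <= T -> `|v n t 0 i - x t 0 i| < n.+1%:R^-1) -> v @ \oo --> x.
Proof.
move=> vx A /nbhs_C0P[eta eta0 HA]; exists (Num.bound eta^-1) => // n /= Nn; apply: HA => t i tT.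
apply: lt_le_trans (vx n t i tT) _; rewrite invf_ple ?posrE//.
apply: le_trans (ltW (archi_boundP _)) _; first by rewrite invr_ge0 ltW.
by rewrite ler_nat; apply: leq_trans Nn _.
Qed.

(** The condition ranges over uncountably many y, but the set is closed: for each fixed y both sides
    pass to the limit along a sequence converging to x. *)
Lemma measurable_small_gap_set e K : 0 <= K -> measurable (small_gap_set e K).
Proof.
move=> K0; rewrite -[X in measurable X]setCK; apply: measurableC; apply: sub_sigma_algebra.
rewrite openE => x /= /existsNP[y /negP]; rewrite -ltNge => gy.
apply: contrapT => nx.
have /choice[v vP] : forall n : nat, exists v : X,
   (forall t i, 0 <= t <= T -> `|v t 0 i - x t 0 i| < n.+1%:R^-1) /\ small_gap_set e K v.
  move=> n; apply: contrapT => nv; apply: nx; apply/nbhs_C0P; exists n.+1%:R^-1 => // v vx.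
  by move=> Bv; apply: nv; exists v.
have vx : v @ \oo --> x by apply: C0_cvg_harmonic => n; have [] := vP n.
have v1 n t i : 0 <= t <= T -> `|v n t 0 i - x t 0 i| <= 1.
  move=> tT; have [H _] := vP n; apply/ltW/(lt_le_trans (H t i tT)).
  by rewrite invf_le1// ler1n.
have cvg1 : gap_int T0 q Dft (v n) y @[n --> \oo] --> gap_int T0 q Dft x y.
  apply: (gap_int_continuous p1 qE hf Dc v1 _ vx (cvg_cst y)) => n t i _.
  by rewrite subrr normr0.
have Sxy := psup_sub_ge0 T0 x y.
have cvg2 : e + K * `|S (h_ x y) + n.+1%:R^-1| `^ p @[n --> \oo] --> e + K * S (h_ x y) `^ p.
  apply: cvgD; first exact: cvg_cst; apply: cvgM; first exact: cvg_cst.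
  rewrite -[X in _ --> X `^ p](ger0_norm Sxy); apply/cvgrPdist_le => e' e'0.
  have [eta eta0 H] := norm_powR_continuous (S (h_ x y)) p0 e'0.
  have /cvgrPdist_le/(_ _ eta0) := @cvg_harmonic R; apply: filterS => n /=.
  rewrite sub0r normrN distrC => le1; apply: H.
  by rewrite addrAC subrr add0r.
suff le1 : gap_int T0 q Dft x y <= e + K * S (h_ x y) `^ p by rewrite leNgt gy in le1.
apply: (ler_cvg_to cvg1 cvg2); apply: nearW => n.
have [Hn /(_ y) Bn] := vP n; apply: le_trans Bn _; rewrite lerD2l ler_wpM2l//.
have b0 : 0 <= S (h_ x y) + n.+1%:R^-1 by rewrite addr_ge0// invr_ge0.
rewrite ger0_norm//; apply: ge0_ler_powR; rewrite ?nnegrE ?(ltW p0) ?psup_sub_ge0//.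
apply: psup_le => // t i tT; rewrite !mxE.
have -> : y t 0 i - v n t 0 i = (y t 0 i - x t 0 i) - (v n t 0 i - x t 0 i) by ring.
apply: le_trans (ler_normB _ _) _; apply: lerD; first exact: psup_sub_ge.
exact/ltW/Hn.
Qed.

(** The gap tends to 0 as y tends to x, so it is at most e when sup|h| < eta. Otherwise the constant
    part of the p-growth bound is at most a multiple of (sup|h| / eta)^p, which explains [K0]. *)
Lemma small_gap_set_exhausts e x : 0 < e ->
  exists N, forall K : nat, (N <= K)%N -> small_gap_set e K%:R x.
Proof.
move=> e0.
have [eta eta0 Heta] : exists2 eta : R, 0 < eta & forall y, S (h_ x y) < eta ->
    gap_int T0 q Dft x y <= e.
  apply: contrapT => neta.
  have /choice[v vP] : forall n : nat, exists v : X,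
     S (h_ x v) < n.+1%:R^-1 /\ e < gap_int T0 q Dft x v.
    move=> n; apply: contrapT => nv; apply: neta; exists n.+1%:R^-1 => // y Sy.
    by rewrite leNgt; apply/negP => gy; apply: nv; exists y.
  have vlt n t i : 0 <= t <= T -> `|v n t 0 i - x t 0 i| < n.+1%:R^-1.
    by move=> tT; have [H _] := vP n; apply: le_lt_trans H; exact: psup_sub_ge.
  have v1 n t i : 0 <= t <= T -> `|v n t 0 i - x t 0 i| <= 1.
    by move=> tT; apply/ltW/(lt_le_trans (vlt n t i tT)); rewrite invf_le1// ler1n.
  have vx := C0_cvg_harmonic vlt.
  have cvg1 : gap_int T0 q Dft x (v n) @[n --> \oo] --> gap_int T0 q Dft x x.
    apply: (gap_int_continuous p1 qE hf Dc _ v1 (cvg_cst x) vx) => n t i _.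
    by rewrite subrr normr0.
  have g0 : gap_int T0 q Dft x x = 0.
    rewrite /gap_int; under eq_Rintegral do rewrite stop_path_id.
    have -> : (fun t => gap q Dft (cadlag_of_C0 x) x t) = (fun=> 0).
      apply/funext => t; rewrite /gap big1// => i _.
      by rewrite subrr normr0 powR0// gt_eqF.
    by rewrite Rintegral_cst ?mul0r//; exact: measurable_itv.
  rewrite g0 in cvg1; suff le1 : e <= 0 by rewrite leNgt e0 in le1.
  apply: (ler_cvg_to (cvg_cst e) cvg1).
  by apply: nearW => n; have [_ /ltW] := vP n.
have [C3 C30 HC3] := gap_int_growth T0 p1 qE hf DC.
pose K0 := C3 * (1 + S x `^ p) / eta `^ p + C3.
have Sp0 : 0 <= S x `^ p by exact: powR_ge0.
have ep0 : 0 < eta `^ p by exact: powR_gt0.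
have K00 : 0 <= K0 by rewrite /K0 addr_ge0// divr_ge0 ?powR_ge0// mulr_ge0// addr_ge0.
exists (Num.bound K0) => K NK y.
have KK : K0 <= K%:R.
  by apply: le_trans (ltW (archi_boundP K00)) _; rewrite ler_nat.
have Sh0 : 0 <= S (h_ x y) `^ p by exact: powR_ge0.
case: (ltP (S (h_ x y)) eta) => [/Heta H|etaS].
  by apply: le_trans H _; rewrite lerDl mulr_ge0// ler0n.
apply: le_trans (HC3 x y) _; apply: (@le_trans _ _ (K0 * S (h_ x y) `^ p)); last first.
  by rewrite ler_wpDl ?(ltW e0)// ler_wpM2r.
rewrite /K0 mulrDl mulrDr lerD2r -mulrA ler_peMr//; first by rewrite mulr_ge0// addr_ge0.
rewrite mulrC ler_pdivlMr// mul1r; apply: ge0_ler_powR; rewrite ?nnegrE ?(ltW p0) ?(ltW eta0)//.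
exact: psup_sub_ge0.
Qed.

(** On the small gap set its defining bound is used, elsewhere the p-growth. The growth in x is
    integrated over sets that eventually leave out every x, hence is small under mu for a level K
    chosen before the coupling; the growth in h is controlled by [psup_cost]. *)
Lemma gap_estimate e : 0 < e -> exists2 K : R, 0 <= K &
  forall (pi : probability (X * X)%type R) (a : R),
  (forall A, measurable A -> pi (fst @^-1` A) = mu A) ->
  (\int[pi]_z cost T p z.1 z.2 <= a%:E)%E ->
  \int[pi]_z gap_int T0 q Dft z.1 z.2 <= e + K * a.
Proof.
move=> e0; have e20 : 0 < e / 2 by rewrite divr_gt0.
have [C3 C30 HC3] := gap_int_growth T0 p1 qE hf DC.
pose b (K : nat) x := \1_(~` small_gap_set (e / 2) K%:R) x * (1 + S x `^ p).
have ti : mu.-integrable setT (EFin \o (fun x => 1 + S x `^ p)).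
  by apply: integrable_realD; [exact: measurableT|exact: integrable_cstT|exact: integrable_psup].
have t0 x : 0 <= 1 + S x `^ p by rewrite addr_ge0// powR_ge0.
have mb K : measurable_fun setT (b K).
  apply: measurable_funM; last exact: integrable_real_measurable ti.
  by apply: measurable_indic; apply: measurableC; exact: measurable_small_gap_set.
have bb K x : `|b K x| <= 1 + S x `^ p.
  rewrite /b indicE; case: (_ \in _); first by rewrite mul1r ger0_norm.
  by rewrite mul0r normr0.
have bi K : mu.-integrable setT (EFin \o b K).
  by apply: (integrable_real_le _ (mb K) ti) => // x _; exact: bb.
have [|||||||_ cv] := @real_dominated_cvg _ _ _ mu setT set0 b (fun=> 0) (fun x => 1 + S x `^ p).
- exact: measurableT.
- exact: negligible_set0.
- exact: mb.
- exact: measurable_cst.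
- exact: ti.
- by move=> K x _; exact: bb.
- move=> x _ _; apply: cvg_near_cst; have [N HN] := small_gap_set_exhausts x e20.
  exists N => // K /= NK; rewrite /b indicE memNset ?mul0r//= => /(_ (HN K NK)); exact.
rewrite Rintegral_cstT in cv.
have e30 : 0 < e / 2 / (C3 + 1) by rewrite !divr_gt0// ltr_wpDl.
have /cvgrPdist_le/(_ _ e30)[N _ /(_ N (leqnn N))/=] := cv.
rewrite sub0r normrN => /(le_trans (ler_norm _)) bN.
exists ((N%:R + C3) * T `^ (p - 1)) => [|pi a pi1 pia].
  by rewrite mulr_ge0 ?powR_ge0// addr_ge0.
have [hi hB] := psup_sub_expectation pia.
have b1i := integrable_fst pi1 (bi N).
apply: (@le_trans _ _ (\int[pi]_z (e / 2 + ((N%:R + C3) * S (h_ z.1 z.2) `^ p + C3 * b N z.1)))).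
  have i1 : pi.-integrable setT (EFin \o (fun z : X * X => (N%:R + C3) * S (h_ z.1 z.2) `^ p + C3 * b N z.1)).
    by apply: integrable_realD => //; exact: integrable_realZl.
  apply: Rintegral_le_mono.
  - exact: (integrable_gap_int pi1 pia).
  - by apply: integrable_realD => //; exact: integrable_cstT.
  move=> z; have Sh0 : 0 <= S (h_ z.1 z.2) `^ p by exact: powR_ge0.
  have N0 : 0 <= N%:R :> R by rewrite ler0n.
  have := HC3 z.1 z.2; rewrite /b indicE; have := t0 z.1.
  have [Bz|nBz] := pselect (small_gap_set (e / 2) N%:R z.1).
    have := Bz z.2; rewrite memNset ?mul0r; last by move=> /(_ Bz).
    move: (gap_int _ _ _ _ _) (psup (T := T) (h_ _ _) `^ p) Sh0 => g s; nra.
  rewrite mem_set// mul1r; move: (gap_int _ _ _ _ _) (psup (T := T) (h_ _ _) `^ p) Sh0 => g s.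
  by move=> s0 _ le1; have := mulr_ge0 N0 s0; move: le1; rewrite !mulrDr mulrDl; move: e20; lra.
have c1i : pi.-integrable setT (EFin \o (fun z : X * X => (N%:R + C3) * S (h_ z.1 z.2) `^ p)).
  exact: integrable_realZl.
have c2i : pi.-integrable setT (EFin \o (fun z : X * X => C3 * b N z.1)) by exact: integrable_realZl.
rewrite RintegralD//; [|exact: integrable_cstT|exact: integrable_realD].
rewrite Rintegral_cstT RintegralD// !RintegralZl//.
rewrite (Rintegral_fst pi1 (bi N)) [in leRHS](splitr e) -[leRHS]addrA lerD2l [leRHS]addrC.
apply: lerD; first by rewrite -mulrA ler_wpM2l// addr_ge0.
apply: le_trans (ler_wpM2l C30 bN) _; rewrite mulrCA ler_piMr ?(ltW e20)//.
by rewrite ler_pdivrMr ?ltr_wpDl// mul1r lerDl.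
Qed.

End coupling_estimates.

(** * Conditional expectations and causality *)

Section levels.
Context {R : realType}.
Implicit Types (m k : nat) (u : R).

Definition level m k : set R :=
  `[k%:R / m.+1%:R - m%:R, k.+1%:R / m.+1%:R - m%:R[%classic.

(** The value u rounded down to the left end of its level if u lies in [-m, m[, and 0 otherwise; the
    2m(m+1) levels tile [-m, m[. *)
Definition grid m u : R :=
  \sum_(k < m.*2 * m.+1) (k%:R / m.+1%:R - m%:R) * \1_(level m k) u.

Lemma level_truncn m k u : level m k u -> - m%:R <= u /\
  k = Num.trunc ((u + m%:R) * m.+1%:R).
Proof.
rewrite /level/= in_itv/= lerBlDr ltrBrDr => /andP[h1 h2].
split; first by rewrite lerNl -subr_ge0 opprK addrC; apply: le_trans h1; rewrite divr_ge0.
by apply/esym/truncn_def; rewrite -ler_pdivrMr// h1/= -ltr_pdivlMr.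
Qed.

Lemma grid_close m u : - m%:R <= u < m%:R -> `|grid m u - u| <= m.+1%:R^-1.
Proof.
move=> /andP[u1 u2]; set k := Num.trunc ((u + m%:R) * m.+1%:R).
have um : 0 <= u + m%:R by rewrite -lerBlDr sub0r.
have /truncn_itv/andP[k1 k2] : 0 <= (u + m%:R) * m.+1%:R by rewrite mulr_ge0.
rewrite -/k in k1 k2.
have kN : (k < m.*2 * m.+1)%N.
  rewrite -(ltr_nat R) natrM; apply: le_lt_trans k1 _; rewrite ltr_pM2r//.
  by rewrite -addnn natrD ltrD2r.
have ku : level m k u.
  by rewrite /level/= in_itv/= lerBlDr ltrBrDr ler_pdivrMr// k1/= ltr_pdivlMr.
rewrite /grid (bigD1 (Ordinal kN))//= indicE mem_set// mulr1 big1 ?addr0 => [|j jk].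
  rewrite ler_norml; apply/andP; split.
    rewrite lerNl opprB lerBlDr -lerBlDl addrC ltW//.
    have := ku; rewrite /level/= in_itv/= => /andP[_]; rewrite -[k.+1%:R]natr1 mulrDl mul1r => h.
    by rewrite addrC ltrBlDr addrAC.
  rewrite (@le_trans _ _ 0) ?invr_ge0// subr_le0.
  by have := ku; rewrite /level/= in_itv/= => /andP[].
rewrite indicE memNset ?mulr0// => /level_truncn[_ jE].
by move/eqP: jk; apply; apply: val_inj; rewrite /= jE.
Qed.

Lemma grid_out m u : ~~ (- m%:R <= u < m%:R) -> grid m u = 0.
Proof.
move=> um; rewrite /grid big1// => k _; rewrite indicE memNset ?mulr0// => ku.
have [u1 _] := level_truncn ku; move/negP: um; apply; rewrite u1/=.
move: ku; rewrite /level/= in_itv/= => /andP[_]; move/lt_le_trans; apply.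
rewrite lerBlDr ler_pdivrMr// -!natrD -natrM ler_nat addnn.
exact: ltn_ord.
Qed.

Lemma grid_le m u : `|grid m u| <= `|u| + 1.
Proof.
have [um|/grid_out->] := boolP (- m%:R <= u < m%:R); last by rewrite normr0 addr_ge0.
rewrite -[grid m u](subrK u) addrC; apply: le_trans (ler_normD _ _) _; rewrite lerD2l.
by apply: le_trans (grid_close um) _; rewrite invf_le1// ler1n.
Qed.

Lemma grid_cvg u : grid m u @[m --> \oo] --> u.
Proof.
apply/cvgrPdist_le => e e0; exists (maxn (Num.bound `|u|) (Num.bound e^-1)) => // m /=.
rewrite geq_max => /andP[um em].
have {}um : `|u| < m%:R by apply: lt_le_trans (archi_boundP _) _; rewrite ?ler_nat.
rewrite distrC; apply: le_trans (grid_close _) _.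
  by move: um; rewrite ltr_norml => /andP[/ltW-> ->].
rewrite invf_ple ?posrE//; apply: le_trans (ltW (archi_boundP _)) _; first by rewrite invr_ge0 ltW.
by rewrite ler_nat; exact: leqW.
Qed.

Lemma measurable_grid m : measurable_fun setT (grid m).
Proof.
apply: measurable_sum => k; apply: measurable_funM => //; apply: measurable_indic.
exact: measurable_itv.
Qed.

(** Reduces identities between integrals of phi G to the case where G is replaced by the indicator
    of an event determined by G. *)
Lemma grid_integral_cvg d (Y : measurableType d) (m : {measure set Y -> \bar R}) (phi G : Y -> R) :
  m.-integrable setT (EFin \o phi) -> measurable_fun setT G ->
  m.-integrable setT (EFin \o (fun y => phi y * G y)) ->
  \sum_(k < n.*2 * n.+1) (k%:R / n.+1%:R - n%:R) *
    \int[m]_y (phi y * \1_(G @^-1` level n k) y) @[n --> \oo] --> \int[m]_y (phi y * G y).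
Proof.
move=> phii mG pGi; have mphi := integrable_real_measurable phii.
have Bi B : measurable B -> m.-integrable setT (EFin \o (fun y => phi y * \1_(G @^-1` B) y)).
  move=> mB; apply: (integrable_real_le _ _ (integrable_norm phii)) => //.
    apply: measurable_funM => //; apply: measurable_indic; rewrite -[X in measurable X]setTI; exact: mG.
  move=> y _; rewrite normrM indicE; case: (_ \in _); first by rewrite normr1 mulr1.
  by rewrite normr0 mulr0 /=.
have [|||||||_ cv] := @real_dominated_cvg _ _ _ m setT set0 (fun n y => phi y * grid n (G y))
  (fun y => phi y * G y) (fun y => `|phi y * G y| + `|phi y|).
- exact: measurableT.
- exact: negligible_set0.
- by move=> n; apply: measurable_funM => //; exact: (measurableT_comp (measurable_grid n)).
- exact: measurable_funM.
- by apply: integrable_realD; [exact: measurableT| |]; exact: integrable_norm.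
- move=> n y _; rewrite !normrM -[X in _ + X]mulr1 -mulrDr ler_wpM2l//; exact: grid_le.
- by move=> y _ _; apply: cvgM; [exact: cvg_cst|exact: grid_cvg].
move: cv; rewrite (_ : (fun n => _) = (fun n => \sum_(k < n.*2 * n.+1) (k%:R / n.+1%:R - n%:R) *
    \int[m]_y (phi y * \1_(G @^-1` level n k) y)))//; apply/funext => n.
have mL k : measurable (level n k) by exact: measurable_itv.
transitivity (\int[m]_y \sum_(k < n.*2 * n.+1) (k%:R / n.+1%:R - n%:R) * (phi y * \1_(G @^-1` level n k) y)).
  apply: eq_Rintegral => y _; rewrite /grid mulr_sumr; apply: eq_bigr => k _.
  by rewrite mulrCA.
rewrite Rintegral_sum//; first by apply: eq_bigr => k _; rewrite RintegralZl//; exact: Bi.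
by move=> k; apply: integrable_realZl => //; exact: Bi.
Qed.

Section eq_levels.
Context d1 d2 (Y1 : measurableType d1) (Y2 : measurableType d2).
Variables (m1 : {measure set Y1 -> \bar R}) (m2 : {measure set Y2 -> \bar R}).

Lemma eq_integral_levels (phi1 G1 : Y1 -> R) (phi2 G2 : Y2 -> R) :
  m1.-integrable setT (EFin \o phi1) -> m2.-integrable setT (EFin \o phi2) ->
  measurable_fun setT G1 -> measurable_fun setT G2 ->
  m1.-integrable setT (EFin \o (fun y => phi1 y * G1 y)) ->
  m2.-integrable setT (EFin \o (fun y => phi2 y * G2 y)) ->
  (forall B, measurable B -> \int[m1]_y (phi1 y * \1_(G1 @^-1` B) y) =
     \int[m2]_y (phi2 y * \1_(G2 @^-1` B) y)) ->
  \int[m1]_y (phi1 y * G1 y) = \int[m2]_y (phi2 y * G2 y).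
Proof.
move=> i1 i2 mG1 mG2 g1 g2 H.
have c1 := grid_integral_cvg i1 mG1 g1; have c2 := grid_integral_cvg i2 mG2 g2.
apply: (cvg_unique _ c1); first exact: Rhausdorff; move: c2.
rewrite (_ : (fun n => \sum_(k < _) _ * \int[m2]_y _) = (fun n => \sum_(k < n.*2 * n.+1) (k%:R / n.+1%:R - n%:R) *
    \int[m1]_y (phi1 y * \1_(G1 @^-1` level n k) y)))//; apply/funext => n.
by apply: eq_bigr => k _; rewrite H//; exact: measurable_itv.
Qed.

End eq_levels.

Lemma zero_integral_levels d (Y : measurableType d) (m : {measure set Y -> \bar R}) (phi G : Y -> R) :
  m.-integrable setT (EFin \o phi) -> measurable_fun setT G ->
  m.-integrable setT (EFin \o (fun y => phi y * G y)) ->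
  (forall B, measurable B -> \int[m]_y (phi y * \1_(G @^-1` B) y) = 0) ->
  \int[m]_y (phi y * G y) = 0.
Proof.
move=> i1 mG1 g1 H; have := grid_integral_cvg i1 mG1 g1.
rewrite (_ : (fun n => _) = (fun=> 0)); last first.
  apply/funext => n; rewrite big1// => k _; rewrite H ?mulr0//; exact: measurable_itv.
move=> c1; apply: (cvg_unique _ c1); first exact: Rhausdorff; exact: cvg_cst.
Qed.

(** The function sgn(u) |u|^(r-1), written with positive and negative parts. For r = q it is the
    direction for which the pairing with u is optimal in Young's inequality. *)
Definition dual_power (r u : R) : R := Num.max u 0 `^ (r - 1) - Num.max (- u) 0 `^ (r - 1).

Lemma measurable_dual_power r : measurable_fun setT (dual_power r).
Proof.
apply: measurable_funB; apply: (measurableT_comp (measurable_powR _)); apply: measurable_maxr => //.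
Qed.

Lemma dual_powerM r u : 1 < r -> u * dual_power r u = `|u| `^ r.
Proof.
move=> r1; have r0 : r - 1 != 0 by rewrite gt_eqF// subr_gt0.
have E a : 0 < a -> a * a `^ (r - 1) = a `^ r.
  by move=> a0; apply: mulr_powRB1; [exact: ltW|exact: lt_trans r1].
rewrite /dual_power; case: (ltgtP u 0) => u0.
- by rewrite (ltr0_norm u0) powR0// sub0r (max_idPl _) ?oppr_ge0 ?(ltW u0)// mulrN -mulNr E// oppr_gt0.
- by rewrite (gtr0_norm u0) (max_idPr _) ?oppr_le0 ?(ltW u0)// [X in _ - X]powR0// subr0 E.
- by rewrite u0 mul0r normr0 powR0// gt_eqF// (lt_trans _ r1).
Qed.

Lemma norm_dual_power r u : 1 < r -> `|dual_power r u| = `|u| `^ (r - 1).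
Proof.
move=> r1; have r0 : r - 1 != 0 by rewrite gt_eqF// subr_gt0.
rewrite /dual_power; case: (ltgtP u 0) => u0.
- by rewrite (ltr0_norm u0) [X in X - _]powR0// sub0r (max_idPl _) ?oppr_ge0 ?(ltW u0)// normrN ger0_norm ?powR_ge0.
- by rewrite (gtr0_norm u0) (max_idPr _) ?oppr_le0 ?(ltW u0)// [X in _ - X]powR0// subr0 ger0_norm ?powR_ge0.
- by rewrite u0 oppr0 maxxx subrr !normr0 powR0.
Qed.

Lemma dual_power_norm p q u : 1 < p -> q = p / (p - 1) -> `|dual_power q u| `^ p = `|u| `^ q.
Proof.
move=> p1 qE; have [p0 q1 pq pmq pdq] := conjugate_exponent p1 qE.
rewrite norm_dual_power// -powRrM; congr powR.
have pm1 : p - 1 != 0 by rewrite gt_eqF// subr_gt0.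
rewrite qE; field.
done.
Qed.

End levels.

Section conditional_expectation.
Context d (Y : measurableType d) (R : realType) (m : probability Y R).
Variables (G : set (set Y)) (Z oZ : Y -> R).
Hypotheses (Gsub : forall A, G A -> measurable A)
  (Zi : m.-integrable setT (EFin \o Z)) (oZi : m.-integrable setT (EFin \o oZ))
  (oZG : forall B, measurable B -> G (oZ @^-1` B))
  (orth : forall A, G A -> \int[m]_w ((Z w - oZ w) * \1_A w) = 0).

Lemma condexp_orthogonal (H : Y -> R) : (forall B, measurable B -> G (H @^-1` B)) ->
  m.-integrable setT (EFin \o (fun w => (Z w - oZ w) * H w)) ->
  \int[m]_w ((Z w - oZ w) * H w) = 0.
Proof.
move=> HG WHi; apply: zero_integral_levels => //.
- exact: integrable_realB.
- by move=> _ B mB; rewrite setTI; apply: Gsub; exact: HG.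
- by move=> B mB; exact/orth/HG.
Qed.

(* Tested against its dual power (truncated to be bounded), oZ has at most the
   L^q norm of Z. *)
Lemma condexp_power (p q : R) : 1 < p -> q = p / (p - 1) ->
  m.-integrable setT (EFin \o (fun w => `|Z w| `^ q)) ->
  m.-integrable setT (EFin \o (fun w => `|oZ w| `^ q)) /\
  \int[m]_w `|oZ w| `^ q <= \int[m]_w `|Z w| `^ q.
Proof.
move=> p1 qE Zqi; have [p0 q1 pq pmq pdq] := conjugate_exponent p1 qE.
have q0 : 0 < q by exact: lt_trans q1.
have moZ := integrable_real_measurable oZi; have mZ := integrable_real_measurable Zi.
pose E (n : nat) : set R := [set u | `|u| <= n%:R].
have mE n : measurable (E n).
  rewrite (_ : E n = `[- n%:R, n%:R]%classic); first exact: measurable_itv.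
  by apply/seteqP; split => u; rewrite /E/= in_itv/= ler_norml.
pose psi n u := dual_power q u * \1_(E n) u.
have mpsi n : measurable_fun setT (psi n).
  apply: measurable_funM; first exact: measurable_dual_power.
  exact: measurable_indic.
have psib n u : `|psi n u| <= n%:R `^ (q - 1).
  rewrite /psi indicE; have [uE|uE] := pselect (E n u).
    rewrite mem_set// mulr1 norm_dual_power//; apply: ge0_ler_powR; rewrite ?nnegrE//.
    by rewrite subr_ge0 ltW.
  by rewrite memNset// mulr0 normr0 powR_ge0.
have bi (g : Y -> R) n : m.-integrable setT (EFin \o g) ->
    m.-integrable setT (EFin \o (fun w => g w * psi n (oZ w))).
  move=> gi; apply: (@integrable_real_le _ _ _ _ _ _ _ (fun w => n%:R `^ (q - 1) * `|g w|)) => //.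
  - apply: measurable_funM; first exact: integrable_real_measurable gi.
    exact: (measurableT_comp (mpsi n)).
  - by apply: integrable_realZl => //; exact: integrable_norm.
  - by move=> w _; rewrite normrM mulrC ler_wpM2r.
have In n : m.-integrable setT (EFin \o (fun w => `|oZ w| `^ q * \1_(E n) (oZ w))) /\
    \int[m]_w (`|oZ w| `^ q * \1_(E n) (oZ w)) <= \int[m]_w `|Z w| `^ q.
  have eqI : (fun w => `|oZ w| `^ q * \1_(E n) (oZ w)) = (fun w => oZ w * psi n (oZ w)).
    by apply/funext => w; rewrite /psi mulrA dual_powerM.
  have Ii : m.-integrable setT (EFin \o (fun w => `|oZ w| `^ q * \1_(E n) (oZ w))).
    by rewrite eqI; exact: bi.
  split=> //; set I := Rintegral _ _ _; set J := Rintegral _ _ _.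
  have IE : I = \int[m]_w (Z w * psi n (oZ w)).
    rewrite /I eqI; apply/esym/eqP; rewrite -subr_eq0 -RintegralB//; [|exact: bi|exact: bi].
    under eq_Rintegral do rewrite -mulrBl.
    apply/eqP/(condexp_orthogonal (H := fun w => psi n (oZ w))).
      move=> B mB; rewrite (_ : _ @^-1` B = oZ @^-1` (psi n @^-1` B))//; apply: oZG.
      by rewrite -[X in measurable X]setTI; exact: mpsi.
    by apply: bi; exact: integrable_realB.
  (* Young's inequality for Z and the truncated dual power of oZ, whose p-th power is |oZ|^q on the
     truncation set. The truncation makes I finite, so I / p can be moved to the left. *)
  have : I <= J / q + I / p.
    rewrite [leLHS]IE ![_ / _]mulrC -!RintegralZl// -RintegralD//; last 2 first.
    - exact: integrable_realZl.
    - exact: integrable_realZl.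
    apply: Rintegral_le_mono.
    - exact: bi.
    - by apply: integrable_realD => //; exact: integrable_realZl.
    move=> w; apply: le_trans (ler_norm _) _.
    apply: le_trans (young_scaled _ _ p1 qE ltr01 ltr01) _.
    rewrite !powR1 !invr1 !mulr1 !mul1r lerD2l ler_wpM2l ?invr_ge0 ?(ltW p0)//.
    rewrite /psi indicE; case: (_ \in _); last by rewrite !mulr0 normr0 powR0 ?gt_eqF.
    by rewrite !mulr1 (dual_power_norm _ p1 qE).
  have -> : I / p = I - I / q.
    by rewrite -[X in _ = X - _]mulr1 -pq mulrDr addrK.
  have qi0 : 0 < q^-1 by rewrite invr_gt0.
  by move=> le1; rewrite -(ler_pM2r qi0); move: le1; rewrite -/(I / q) -/(J / q); lra.
have mq : measurable_fun setT (fun w => `|oZ w| `^ q) by exact: measurable_norm_powR.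
apply: integrable_ge0_bound => //.
pose F n := oZ @^-1` E n.
have cv : (\int[m]_(w in F n) (`|oZ w| `^ q)%:E @[n --> \oo] -->
    \int[m]_(w in \bigcup_n F n) (`|oZ w| `^ q)%:E)%E.
  apply: ge0_nondecreasing_set_cvg_integral.
  - move=> n k nk; apply/subsetPset => w /= /le_trans; apply.
    by rewrite ler_nat.
  - by move=> n; rewrite /F -[X in measurable X]setTI; exact: moZ.
  - move=> n; apply: measurable_funTS; exact/measurable_EFinP.
  - by move=> n w _; rewrite lee_fin powR_ge0.
have FT : \bigcup_n F n = setT.
  apply/seteqP; split => // w _; exists (Num.bound `|oZ w|) => //=.
  by apply/ltW/archi_boundP.
rewrite FT in cv; apply: (cvge_le _ cv) => //; apply: nearW => n /=.
have [Ii IJ] := In n; apply: le_trans (_ : _ <= (\int[m]_w (`|oZ w| `^ q * \1_(E n) (oZ w)))%:E)%E _; last by rewrite lee_fin.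
rewrite /Rintegral fineK; last exact: integrable_fin_num.
rewrite [X in (X <= _)%E](_ : _ = \int[m]_w (`|oZ w| `^ q * \1_(E n) (oZ w))%:E)%E//.
by rewrite integral_mkcond; apply: eq_integral => w _; rewrite epatch_indic.
Qed.

End conditional_expectation.

(** * The filtration, causal couplings and optional processes *)

Section filtrations.
Context {R : realType} {T : R} {d : nat}.
Hypothesis T0 : 0 < T.
Local Notation X := (C0_path T d).
Local Notation F t := (@filtration R T d t).
Implicit Types (x y w : X) (s t : R) (i : 'I_d) (A U : set X).

Lemma filtration_sigma t : sigma_algebra setT (F t).
Proof. by apply: sigma_algebra_bigcap => s _; exact: smallest_sigma_algebra. Qed.

Lemma filtration_le s t A : s <= t -> F s A -> F t A.
Proof. by move=> st FA r /= tr; apply: FA; exact: le_lt_trans tr. Qed.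

Lemma filtration_setT t : F t setT.
Proof. by have [F0 FD _] := filtration_sigma t; have := FD _ F0; rewrite setD0. Qed.

Lemma filtration_set0 t : F t set0.
Proof. by have [] := filtration_sigma t. Qed.

Lemma filtration_measurable t A : F t A -> measurable A.
Proof.
move=> /(_ (t + 1)); rewrite /= ltrDl => /(_ ltr01).
apply: smallest_sub; first exact: sigma_algebra_measurable.
move=> _ [r [i [B [_ mB ->]]]].
by rewrite -[X in measurable X]setTI; exact: (measurable_coord T0 r i).
Qed.

Lemma filtration_coord s t i (B : set R) : 0 <= s <= t -> measurable B ->
  F t [set w : X | B (w s 0 i)].
Proof.
move=> /andP[s0 st] mB r /= tr; apply: sub_sigma_algebra; exists s, i, B; split => //.
by rewrite s0 (le_trans st)// ltW.
Qed.

Lemma stopping_time_cst t : 0 <= t <= T -> stopping_time (fun _ : X => t%:E).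
Proof.
move=> tT; split=> [w|s sT]; first by right; exists t.
rewrite (_ : [set w | _] = if t <= s then setT else set0).
  by case: ifP => _; [exact: filtration_setT|exact: filtration_set0].
by apply/seteqP; split => w /=; rewrite lee_fin; case: ifP.
Qed.

Lemma stopped_sigma_cst t A : 0 <= t <= T ->
  stopped_sigma (fun _ : X => t%:E) A <-> F t A.
Proof.
move=> tT; split=> [[_ /(_ t tT)]|FA].
  by rewrite (_ : [set w | _] = setT) ?setIT//; apply/seteqP; split => w //= _; exact: lexx.
split=> [|s sT]; first exact: filtration_measurable FA.
have [ts|st] := leP t s.
  rewrite (_ : [set w | _] = setT) ?setIT; first exact: filtration_le FA.
  by apply/seteqP; split => w //= _; rewrite lee_fin.
rewrite (_ : [set w | _] = set0) ?setI0; first exact: filtration_set0.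
by apply/seteqP; split => w //=; rewrite lee_fin leNgt st.
Qed.

(** The constant t is a stopping time whose stopped sigma-algebra is F_t. Only such stopping times
    are needed. *)
Lemma optional_projection_at (mu : probability X R) (H oH : R -> X -> 'rV[R]_d) t i :
  optional_projection mu H oH -> 0 <= t <= T ->
  [/\ mu.-integrable setT (EFin \o (fun w => H t w 0 i)),
      mu.-integrable setT (EFin \o (fun w => oH t w 0 i)),
      forall B, measurable B -> F t ((fun w => oH t w 0 i) @^-1` B) &
      forall A, F t A -> \int[mu]_w ((H t w 0 i - oH t w 0 i) * \1_A w) = 0].
Proof.
move=> /(_ i)[_ op] tT; have [Hi oHi oHF HA] := op _ (stopping_time_cst tT); split => //.
  by move=> B /oHF /(stopped_sigma_cst _ tT).
move=> A FA; have mA := filtration_measurable FA.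
have E := HA A (proj2 (stopped_sigma_cst A tT) FA); rewrite /at_time /= in E.
under eq_Rintegral do rewrite mulrBl.
have r1 (g : X -> R) : \int[mu]_w (g w * \1_A w) = \int[mu]_(w in A) g w.
  rewrite [RHS]Rintegral_mkcond; apply: eq_Rintegral => w _.
  by rewrite patchE indicE; case: (_ \in _); rewrite ?mulr1 ?mulr0.
have i1 (g : X -> R) : mu.-integrable setT (EFin \o g) ->
   mu.-integrable setT (EFin \o (fun w => g w * \1_A w)).
  move=> gi; have mg := integrable_real_measurable gi.
  apply: (integrable_real_le _ _ (integrable_norm gi)) => //.
    by apply: measurable_funM => //; exact: measurable_indic.
  move=> w _ /=; rewrite normrM indicE; case: (_ \in _); rewrite ?normr1 ?mulr1//.
  by rewrite normr0 mulr0.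
rewrite RintegralB//; [|exact: i1|exact: i1].
by rewrite !r1 /Rintegral E subrr.
Qed.

Section causality.
Variables (mu nu : probability X R) (pi : probability (X * X)%type R).
Hypothesis pic : causal_coupling mu nu pi.

Lemma Rintegral_indic d1 (Y : measurableType d1) (m : probability Y R) (A : set Y) :
  measurable A -> \int[m]_y \1_A y = fine (m A).
Proof. by move=> mA; rewrite /Rintegral integral_indic// setIT. Qed.

(** Integrating out y turns the integral into that of W times h(x) = k x U, which causality makes
    F_t-measurable up to mu-null sets, whereas W is orthogonal to F_t. *)
Lemma causal_orthogonal_set t (W : X -> R) U : 0 <= t <= T ->
  mu.-integrable setT (EFin \o W) ->
  (forall A, F t A -> \int[mu]_w (W w * \1_A w) = 0) -> F t U ->
  \int[pi]_z (W z.1 * \1_U z.2) = 0.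
Proof.
move=> tT Wi W0 FU; have [[pi1 _] [k kP kc]] := pic.
have mU := filtration_measurable FU; have mW := integrable_real_measurable Wi.
pose h x := fine (k x U).
have kU x : k x U \is a fin_num.
  rewrite ge0_fin_numE ?measure_ge0//; apply: (@le_lt_trans _ _ 1%E); last exact: ltry.
  by rewrite -(prob_kernel (s := k) x); apply: le_measure; rewrite ?inE.
have mh : measurable_fun setT h.
  by apply: (measurableT_comp (fine_measurable _)) => //; exact: measurable_kernel.
have h1 x : `|h x| <= 1.
  rewrite ger0_norm ?fine_ge0// -lee_fin /h fineK//.
  by rewrite -(prob_kernel (s := k) x); apply: le_measure; rewrite ?inE.
have hi : mu.-integrable setT (EFin \o h).
  by apply: (integrable_real_le _ mh (integrable_cstT _ 1)).
have Whi : mu.-integrable setT (EFin \o (fun x => W x * h x)).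
  apply: (integrable_real_le _ _ (integrable_norm Wi)) => //; first exact: measurable_funM.
  by move=> x _; rewrite normrM ler_piMr.
have mU2 : measurable_fun setT (fun z : X * X => \1_U z.2 : R).
  apply: (measurableT_comp (measurable_indic _)) => //.
have U1 (z : X * X) : `|\1_U z.2 : R| <= 1.
  by rewrite indicE; case: (_ \in _); rewrite ?normr1 ?normr0.
have W1i := integrable_fst pi1 Wi.
transitivity (\int[mu]_x (W x * h x)); last first.
  apply: zero_integral_levels => // B mB.
  (* The event {h in B} differs from some A in F_t by a null set; the set A is the one tested
     against W. *)
  have [A FA /negligibleP] := kc t tT U FU (EFin @` B) (measurable_image_EFin mB).
  have mA := filtration_measurable FA.
  have hB : h @^-1` B = (fun x => k x U) @^-1` (EFin @` B).
    apply/seteqP; split => x /=; first by move=> Bh; exists (h x) => //; rewrite /h fineK.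
    by move=> [b Bb bE]; rewrite /h -bE.
  have mhB : measurable (h @^-1` B) by rewrite -[X in measurable X]setTI; exact: mh.
  rewrite -hB => N0; rewrite -(W0 A FA) /Rintegral; congr fine.
  apply: ae_eq_integral => //.
  - apply/measurable_EFinP; apply: measurable_funM => //; exact: measurable_indic.
  - apply/measurable_EFinP; apply: measurable_funM => //; exact: measurable_indic.
  exists ((h @^-1` B `\` A) `|` (A `\` h @^-1` B)); split.
  - by apply: measurableU; exact: measurableD.
  - by apply: N0; apply: measurableU; exact: measurableD.
  move=> x /= nx; apply: contrapT => nN; apply: nx => _.
  rewrite !indicE; congr (_ * _)%:E; congr (_ %:R); congr nat_of_bool.
  by apply/idP/idP; rewrite !inE => H; apply: contrapT => nH; apply: nN; [left|right].
under eq_Rintegral do rewrite mulrC; under [RHS]eq_Rintegral do rewrite mulrC.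
(* The disintegration is stated on rectangles only. Discretizing W, with the indicator of U and h as
   the fixed factors, leaves exactly the rectangles {W in B} x U. *)
apply: (@eq_integral_levels _ _ _ _ _ pi mu (fun z => \1_U z.2) (fun z => W z.1) h W) => //.
- by apply: (integrable_real_le _ mU2 (integrable_cstT _ 1)).
- exact: (measurableT_comp mW).
- apply: (integrable_real_le _ _ (integrable_norm W1i)) => //.
    by apply: measurable_funM => //; exact: (measurableT_comp mW).
  by move=> z _; rewrite normrM ler_piMl.
- by under [X in integrable _ _ X]funext => x do rewrite /= mulrC.
move=> B mB; set A := W @^-1` B.
have mA : measurable A by rewrite -[X in measurable X]setTI; exact: mW.
transitivity (\int[pi]_z \1_(A `*` U) z).
  apply: eq_Rintegral => z _; rewrite !indicE -natrM mulnb; congr (_ %:R); congr nat_of_bool.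
  apply/andP/idP => [[]|]; rewrite !inE; first by move=> ? ?.
  by move=> [].
rewrite Rintegral_indic; last exact: measurableX.
rewrite kP// /Rintegral; congr fine; rewrite [LHS]integral_mkcond; apply: eq_integral => x _.
by rewrite epatch_indic /= -/A EFinM /h fineK.
Qed.

Lemma causal_orthogonal t (W G : X -> R) : 0 <= t <= T ->
  mu.-integrable setT (EFin \o W) ->
  (forall A, F t A -> \int[mu]_w (W w * \1_A w) = 0) ->
  (forall B, measurable B -> F t (G @^-1` B)) ->
  pi.-integrable setT (EFin \o (fun z => W z.1 * G z.2)) ->
  \int[pi]_z (W z.1 * G z.2) = 0.
Proof.
move=> tT Wi W0 GF WGi; have [[pi1 _] _] := pic.
apply: (@zero_integral_levels R _ _ pi (fun z => W z.1) (fun z => G z.2)) => //.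
- exact: (integrable_fst pi1 Wi).
- move=> _ B mB; rewrite setTI (_ : _ @^-1` B = snd @^-1` (G @^-1` B))//.
  rewrite -[X in measurable X]setTI; apply: measurable_snd => //.
  exact: filtration_measurable (GF B mB).
- move=> B mB; have := causal_orthogonal_set tT Wi W0 (GF B mB); exact.
Qed.

End causality.

(* A cadlag process is the limit of its right discretizations. *)
Lemma optional_measurable (Y : R -> X -> R) : optional Y ->
  measurable_fun (`[0, T]%classic `*` setT) (fun u : R * X => Y u.1 u.2).
Proof.
move=> Yo _ B mB.
have mD : measurable (`[0, T]%classic `*` [set: X]).
  by apply: measurableX => //; exact: measurable_itv.
rewrite (_ : _ `&` _ = [set u : R * X | 0 <= u.1 <= T /\ B (Y u.1 u.2)]); last first.
  by apply/seteqP; split => u /=; rewrite in_itv/=; [move=> [[]]|move=> []].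
have := Yo B mB; apply: smallest_sub.
  split=> [|A mA|A mA]; [exact: measurable0|exact: measurableD|exact: bigcupT_measurable].
move=> _ [Z [{mB}B [Za Zc mB ->]]].
pose zgrid (n k : nat) : R := k%:R / n.+1%:R.
pose K n := (Num.trunc (T * n.+1%:R)).+1.
(* Z is read strictly to the right of t when t < T, as right continuity requires; the cap at T makes
   the value exact at t = T. *)
pose Zn n (u : R * X) := \sum_(k < K n) \1_(`[zgrid n k, zgrid n k.+1[%classic) u.1 *
   Z (Num.min T (zgrid n k.+1)) u.2.
have zT n k : 0 <= Num.min T (zgrid n k) <= T.
  by rewrite le_min (ltW T0) divr_ge0//= ge_min lexx.
have mZ s : 0 <= s <= T -> measurable_fun setT (Z s).
  by move=> sT _ C mC; rewrite setTI; apply: (@filtration_measurable s); exact: Za.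
have mZn n : measurable_fun (`[0, T]%classic `*` setT) (Zn n).
  apply: measurable_funTS; apply: measurable_sum => k; apply: measurable_funM.
    apply: (measurableT_comp (measurable_indic _)) => //; exact: measurable_itv.
  exact: (measurableT_comp (mZ _ (zT n k.+1))).
have ZnE n t w : 0 <= t <= T -> exists2 s, 0 <= s <= T /\
    (t < T -> t < s) /\ (s <= t + n.+1%:R^-1 /\ t <= s) & Zn n (t, w) = Z s w.
  move=> /andP[t0 tT]; set k := Num.trunc (t * n.+1%:R).
  have /truncn_itv/andP[k1 k2] : 0 <= t * n.+1%:R by rewrite mulr_ge0.
  rewrite -/k in k1 k2.
  have kK : (k < K n)%N.
    rewrite -(ltr_nat R); apply: le_lt_trans k1 _; apply: (@le_lt_trans _ _ (T * n.+1%:R)).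
      by rewrite ler_wpM2r.
    have /truncn_itv/andP[//] : 0 <= T * n.+1%:R by rewrite mulr_ge0// ltW.
  exists (Num.min T (zgrid n k.+1)); [split=> //; split|].
  - by move=> tT'; rewrite lt_min tT' /zgrid ltr_pdivlMr.
  - split; last by rewrite le_min tT /zgrid ler_pdivlMr// ltW.
    rewrite ge_min; apply/orP; right; rewrite /zgrid -natr1 mulrDl mul1r lerD2r.
    by rewrite ler_pdivrMr.
  rewrite /Zn (bigD1 (Ordinal kK))//= indicE mem_set ?mul1r; last first.
    by rewrite /= in_itv/= /zgrid ler_pdivrMr// k1 ltr_pdivlMr.
  rewrite big1 ?addr0// => j jk; rewrite indicE memNset ?mul0r//= in_itv/= => /andP[h1 h2].
  move/eqP: jk; apply; apply: val_inj => /=; apply/esym/truncn_def.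
  by rewrite -ler_pdivrMr// h1 -ltr_pdivlMr.
have mZ2 : measurable_fun (`[0, T]%classic `*` setT) (fun u : R * X => Z u.1 u.2).
  apply: (measurable_fun_cvg mZn) => -[t w] [/= + _]; rewrite in_itv/= => tT.
  have /andP[t0 tleT] := tT.
  have /choice[s sPE] : forall n, exists s, [/\ 0 <= s <= T, t < T -> t < s, s <= t + n.+1%:R^-1,
      t <= s & Zn n (t, w) = Z s w].
    by move=> n; have [s [? [? [? ?]]] ?] := ZnE n t w tT; exists s.
  rewrite (_ : (fun n => _) = (fun n => Z (s n) w)); last by apply/funext => n; have [] := sPE n.
  move: tleT; rewrite le_eqVlt => /predU1P[tE|tlT].
    apply: cvg_near_cst; apply: nearW => n; have [/andP[_ s1] _ _ s2 _] := sPE n.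
    by congr (Z _ w); apply/eqP; rewrite eq_le s2 tE s1.
  have [Zr _] := Zc w; have {}Zr := Zr t; rewrite t0 tlT in Zr.
  move=> A /(Zr isT)[e /= e0 HA].
  exists (Num.bound e^-1) => // n /= en; have [_ s1 s2 s3 _] := sPE n.
  apply: HA; last exact: s1 tlT.
  rewrite /= ler0_norm ?subr_le0// opprB ltrBlDl; apply: le_lt_trans s2 _; rewrite ltrD2l.
  rewrite invf_plt ?posrE//; apply: lt_le_trans (archi_boundP _) _; first by rewrite invr_ge0 ltW.
  by rewrite ler_nat; exact: leqW.
have -> : [set u : R * X | 0 <= u.1 <= T /\ B (Z u.1 u.2)] =
  (`[0, T]%classic `*` setT) `&` (fun u : R * X => Z u.1 u.2) @^-1` B.
  by apply/seteqP; split => u /=; rewrite in_itv/=; [move=> []|move=> [[]]].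
exact: mZ2.
Qed.

End filtrations.

(** * Riemann sums along shifted partitions *)

Section shifted_partitions.
Context {R : realType}.
Local Notation lambda := (@lebesgue_measure R).
Implicit Types (s t c : R).

Lemma lebesgue_translation c (A : set R) : measurable A ->
  lambda ((fun s => s + c) @^-1` A) = lambda A.
Proof.
move=> mA; pose phi (s : measurableTypeR R) : measurableTypeR R := s + c.
have mphi : measurable_fun setT phi by exact: measurable_funD.
rewrite -[LHS]/(pushforward lambda phi A); apply/esym.
unshelve refine (@lebesgue_measure_unique R (pushforward lambda phi) _ A mA); first exact: mphi.
move=> _ [[a b] _ <-] /=; rewrite /pushforward.
rewrite (_ : _ @^-1` _ = `]a - c, b - c]%classic); last first.
  by apply/seteqP; split => u /=; rewrite !in_itv/= ltrBlDr lerBrDr.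
by rewrite !lebesgue_measure_itv/= !lte_fin ltrD2r; case: ifP => // _; rewrite -!EFinB opprB addrA subrK.
Qed.

Lemma Rintegral_translation c (g : R -> R) : lambda.-integrable setT (EFin \o g) ->
  lambda.-integrable setT (EFin \o (fun s => g (s + c))) /\
  \int[lambda]_s g (s + c) = \int[lambda]_s g s.
Proof.
move=> gi; have mc : measurable_fun setT (fun s : measurableTypeR R => s + c).
  exact: measurable_funD.
split; first exact: (@integrable_image _ _ _ _ R lambda lambda _ mc (@lebesgue_translation c) g gi).
exact: (@Rintegral_image _ _ _ _ R lambda lambda _ mc (@lebesgue_translation c) g gi).
Qed.

Lemma integrable_mul_indic (h : R -> R) (A : set R) : measurable A ->
  lambda.-integrable setT (EFin \o h) ->
  lambda.-integrable setT (EFin \o (fun t => h t * \1_A t)).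
Proof.
move=> mA hi; have mh := integrable_real_measurable hi.
apply: (integrable_real_le _ _ (integrable_norm hi)) => //.
  by apply: measurable_funM => //; exact: measurable_indic.
move=> t _ /=; rewrite normrM indicE; case: (_ \in _); rewrite ?normr1 ?mulr1//.
by rewrite normr0 mulr0.
Qed.

(* The average of the sum over the shift s is the integral. *)
Lemma shifted_riemann_le (T G e : R) (g : R -> R) M : 0 < T ->
  measurable_fun `[0, T] g -> (forall t, 0 <= t <= T -> 0 <= g t <= G) -> 0 < e ->
  exists2 s, 0 < s < T / M.+1%:R &
    T / M.+1%:R * \sum_(k < M.+1) g (s + k%:R * (T / M.+1%:R)) <=
    \int[lambda]_(t in `[0, T]) g t + e.
Proof.
move=> T0 mg gG e0; set Delta := T / M.+1%:R; have D0 : 0 < Delta by rewrite divr_gt0.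
have mI : measurable (`[0, T]%classic : set R) by exact: measurable_itv.
pose h := g \_ `[0, T]%classic.
have hE t : 0 <= t <= T -> h t = g t.
  by move=> tT; rewrite /h patchE mem_set//= in_itv.
have h0 t : 0 <= h t.
  rewrite /h patchE; case: ifPn => //; rewrite inE/= in_itv/= => tT.
  by have /andP[] := gG t tT.
have mh : measurable_fun setT h by exact: (proj1 (measurable_restrictT g mI) mg).
have oi : lambda.-integrable setT (EFin \o (\1_(`[0, T]%classic : set R) : R -> R)).
  exact: integrable_indic_itv.
have hi : lambda.-integrable setT (EFin \o h).
  apply: (integrable_real_le _ _ (integrable_realZl _ G oi)) => // t _.
  rewrite ger0_norm// /h patchE indicE; case: ifPn => [|_]; last by rewrite mulr0.
  by rewrite inE/= in_itv/= mulr1 => tT; have /andP[] := gG t tT.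
rewrite Rintegral_mkcond -/h; set J := Rintegral _ _ _.
(* Otherwise every shift gives at least J + e. Integrating over the shifts in ]0, Delta[ turns the
   sum into integrals over disjoint cells, whose total is at most J. *)
apply: contrapT => ns.
have gt s : 0 < s < Delta -> J + e <= Delta * \sum_(k < M.+1) h (s + k%:R * Delta).
  move=> sD; rewrite leNgt; apply/negP => lt1; apply: ns; exists s => //.
  rewrite (_ : \sum_(k < M.+1) _ = \sum_(k < M.+1) h (s + k%:R * Delta)) ?ltW//.
  have /andP[s0 sD'] := sD; apply: eq_bigr => k _; rewrite hE//.
  rewrite addr_ge0 ?(ltW s0) ?mulr_ge0 ?(ltW D0)//=.
  apply: (@le_trans _ _ (Delta + k%:R * Delta)); first by rewrite lerD2r ltW.
  rewrite -[X in X + _]mul1r -mulrDl addrC natr1 /Delta mulrC -mulrA ler_piMr ?(ltW T0)//.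
    by rewrite mulrC ler_pdivrMr// mul1r ler_nat.
  exact: ltW.
pose I0 : set R := `]0, Delta[%classic.
pose I k : set R := `]k%:R * Delta, k.+1%:R * Delta[%classic.
have mI0 : measurable I0 by exact: measurable_itv.
have mIk k : measurable (I k) by exact: measurable_itv.
have Ui k := integrable_mul_indic (mIk k) hi.
have UE k s : h (s + k%:R * Delta) * \1_(I k) (s + k%:R * Delta) = h (s + k%:R * Delta) * \1_I0 s.
  have E : (k%:R * Delta < s + k%:R * Delta < k.+1%:R * Delta) = (0 < s < Delta).
    by rewrite ltrDr -[k.+1%:R]natr1 mulrDl mul1r [X in _ && (_ < X)]addrC ltrD2r.
  rewrite !indicE; congr (_ * (nat_of_bool _)%:R); apply/idP/idP;
  by rewrite !inE /I /I0/= !in_itv/= E.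
have sumU : \sum_(k < M.+1) \int[lambda]_t (h t * \1_(I k) t) <= J.
  rewrite -Rintegral_sum//; apply: Rintegral_le_mono => //.
    by apply: integrable_real_sum.
  move=> t; rewrite -mulr_sumr ler_piMr//.
  have [[k tk]|nk] := pselect (exists k : 'I_M.+1, I k t); last first.
    rewrite big1// => k _; rewrite indicE memNset// => tk; apply: nk; by exists k.
  rewrite (bigD1 k)//= indicE mem_set//= big1 ?addr0// => j jk; rewrite indicE memNset// => tj.
  move/eqP: jk; apply; apply: val_inj => /=.
  apply: (@partition_cell_unique R T M.+1 (fun j => j%:R * Delta) t); rewrite ?ltn_ord//.
    exact: uniform_partition.
    by move: tj; rewrite /I/= in_itv/= => /andP[-> /ltW].
  by move: tk; rewrite /I/= in_itv/= => /andP[-> /ltW].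
have Di : lambda.-integrable setT (EFin \o (fun s => (J + e) * \1_I0 s)).
  by apply: integrable_realZl => //; exact: integrable_indic_itv.
have hsi k : lambda.-integrable setT (EFin \o (fun s => h (s + k%:R * Delta) * \1_I0 s)).
  by under [X in integrable _ _ X]funext => s do rewrite /= -UE;
    have [] := Rintegral_translation (k%:R * Delta) (Ui k).
have : \int[lambda]_s ((J + e) * \1_I0 s) <=
    \int[lambda]_s (Delta * \sum_(k < M.+1) h (s + k%:R * Delta) * \1_I0 s).
  apply: Rintegral_le_mono => //.
    by apply: integrable_realZl => //; exact: integrable_real_sum.
  move=> s; rewrite -mulr_suml mulrA indicE; have [sI|sI] := pselect (I0 s).
    by rewrite mem_set// !mulr1; apply: gt; move: sI; rewrite /I0/= in_itv.
  by rewrite memNset// !mulr0.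
have i0 : lambda.-integrable setT (EFin \o (\1_I0 : R -> R)) by exact: integrable_indic_itv.
have si : lambda.-integrable setT
    (EFin \o (fun s => \sum_(k < M.+1) h (s + k%:R * Delta) * \1_I0 s)).
  exact: integrable_real_sum.
rewrite (RintegralZl _ _ i0)// (RintegralZl _ _ si)// Rintegral_sum// (eq_bigr (fun k : 'I_M.+1 => \int[lambda]_t (h t * \1_(I k) t))); last first.
  move=> k _; have [_ <-] := Rintegral_translation (k%:R * Delta) (Ui k).
  by apply: eq_Rintegral => s _; rewrite UE.
have -> : \int[lambda]_s \1_I0 s = Delta.
  have lamE : lambda I0 = Delta%:E by rewrite /I0 lebesgue_measure_itv/= lte_fin D0 -EFinB subr0.
  by rewrite /Rintegral integral_indic// setIT (congr1 fine lamE).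
rewrite leNgt => /negP; apply; apply: le_lt_trans (ler_wpM2l (ltW D0) sumU) _.
by rewrite mulrC ltr_pM2r// ltrDl.
Qed.

(** The previous bound applied to G - g. *)
Lemma shifted_riemann_ge (T G e : R) (g : R -> R) M : 0 < T ->
  measurable_fun `[0, T] g -> (forall t, 0 <= t <= T -> 0 <= g t <= G) -> 0 < e ->
  exists2 s, 0 < s < T / M.+1%:R &
    \int[lambda]_(t in `[0, T]) g t - e <=
    T / M.+1%:R * \sum_(k < M.+1) g (s + k%:R * (T / M.+1%:R)).
Proof.
move=> T0 mg gG e0.
have mI : measurable (`[0, T]%classic : set R) by exact: measurable_itv.
have lamE : lambda (`[0, T]%classic : set R) = T%:E.
  by rewrite lebesgue_measure_itv/= lte_fin T0 -EFinB subr0.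
have ci : lambda.-integrable `[0, T] (EFin \o (fun=> G)).
  apply/integrableP; split; first exact: measurable_cst.
  by rewrite /= integral_cst//= [X in (_ * X)%E](_ : _ = T%:E) ?ltry.
have gi : lambda.-integrable `[0, T] (EFin \o g).
  apply: (@integrable_real_le _ _ _ lambda _ _ g _ mg ci) => // t; rewrite /= in_itv/= => /gG /andP[g0 g1].
  by rewrite ger0_norm.
have [||s sD le1] := @shifted_riemann_le T G e (fun t => G - g t) M T0 _ _ e0.
- by apply: measurable_funB.
- by move=> t /gG /andP[g0 g1]; rewrite subr_ge0 g1 lerBlDr lerDl.
exists s => //; move: le1; rewrite RintegralB// sumrB mulrBr.
have -> : \int[lambda]_(t in `[0, T]) G = T * G.
  by rewrite Rintegral_cst// (congr1 fine lamE : fine _ = T) mulrC.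
rewrite sumr_const card_ord -[G *+ _]mulr_natl mulrA divfK//.
move: (_ / _ * _) (Rintegral _ _ _) => u v; lra.
Qed.

(** The points are 0, then s + k T/(M+1) for k <= M, then T. Of the M + 2 cells the first and the
    last have lengths that add up to T/(M+1). *)
Definition shifted_partition (T s : R) M (j : nat) : R :=
  if j is k.+1 then (if (k < M.+1)%N then s + k%:R * (T / M.+1%:R) else T) else 0.

Lemma shifted_partitionP (T s : R) M : 0 < s < T / M.+1%:R ->
  is_partition T M.+2 (shifted_partition T s M).
Proof.
move=> /andP[s0 sD]; split => //=; first by rewrite ltnn.
move=> [|j] jn /=; first by rewrite mul0r addr0.
rewrite -ltnS jn; case: ifP => jM; first by rewrite ltrD2l ltr_pM2r ?(lt_trans s0)// ltr_nat.
have -> : j = M by apply/eqP; rewrite eqn_leq -ltnS -(ltnS M) -ltnS jn/= ltnNge -ltnS jM.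
rewrite -ltrBrDr; apply: lt_le_trans sD _; rewrite -[X in X <= _]mul1r lerBrDr -mulrDl nat1r.
by rewrite mulrC divfK.
Qed.

Lemma shifted_partition_mesh (T s : R) M : 0 < s < T / M.+1%:R -> forall j, (j < M.+2)%N ->
  shifted_partition T s M j.+1 - shifted_partition T s M j <= T / M.+1%:R.
Proof.
move=> /andP[s0 sD] [|j] jn /=; first by rewrite mul0r addr0 subr0 ltW.
have -> : (j < M.+1)%N by [].
case: ifP => jM.
  by rewrite opprD addrACA subrr add0r -mulrBl -natr1 addrAC subrr add0r mul1r.
have -> : j = M by apply/eqP; move: jn jM; rewrite !ltnS leq_eqVlt => /predU1P[->//|->].
rewrite opprD addrCA addrC lerBlDr -[X in X - _](@divfK _ M.+1%:R)// mulrC.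
by rewrite -mulrBl -natr1 addrAC subrr add0r mul1r lerDl ltW.
Qed.

End shifted_partitions.

Lemma integrable_mul_power d (Y : measurableType d) (R : realType) (m : {measure set Y -> \bar R})
    (p q : R) (a b : Y -> R) : 1 < p -> q = p / (p - 1) ->
  measurable_fun setT a -> measurable_fun setT b ->
  m.-integrable setT (EFin \o (fun y => `|a y| `^ q)) ->
  m.-integrable setT (EFin \o (fun y => `|b y| `^ p)) ->
  m.-integrable setT (EFin \o (fun y => a y * b y)).
Proof.
move=> p1 qE ma mb ai bi.
apply: (@integrable_real_le _ _ _ m _ measurableT _
  (fun y => q^-1 * `|a y| `^ q + p^-1 * `|b y| `^ p)).
- exact: measurable_funM.
- by apply: integrable_realD => //; exact: integrable_realZl.
- move=> y _; apply: le_trans (young_scaled _ _ p1 qE ltr01 ltr01) _.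
  by rewrite !powR1 !invr1 !mulr1 !mul1r.
Qed.

(** With kappa^(p q) = a / A, both kappa^q A and kappa^-p a equal A^(1/q) a^(1/p), and the weights
    1/q and 1/p add up to 1. *)
Lemma young_optimal (R : realType) (p q A a : R) : 1 < p -> q = p / (p - 1) ->
  0 < A -> 0 < a -> exists2 kappa : R, 0 < kappa &
  kappa `^ q / q * A + (kappa `^ p)^-1 / p * a = A `^ q^-1 * a `^ p^-1.
Proof.
move=> p1 qE A0 a0; have [p0 q1 pq _ _] := conjugate_exponent p1 qE.
have q0 : 0 < q by exact: lt_trans q1.
have aA : 0 < a / A by rewrite divr_gt0.
exists ((a / A) `^ (p^-1 * q^-1)); first exact: powR_gt0.
have -> : ((a / A) `^ (p^-1 * q^-1)) `^ q = (a / A) `^ p^-1.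
  by rewrite -powRrM -mulrA mulVf ?gt_eqF// mulr1.
have -> : ((a / A) `^ (p^-1 * q^-1)) `^ p = (a / A) `^ q^-1.
  by rewrite -powRrM mulrAC mulVf ?gt_eqF// mul1r.
have split_ (r s c : R) : 0 < c -> r + s = 1 -> c = c `^ r * c `^ s.
  move=> c0 rs; rewrite -powRD ?rs ?powRr1 ?ltW//.
  by apply/implyP => _; rewrite gt_eqF.
have inv (r c : R) : 0 <= c -> (c `^ r)^-1 = c^-1 `^ r.
  by move=> c0; rewrite -powR_inv1 ?powR_ge0// -powRrM mulrN1 -mulN1r powRrM powR_inv1.
rewrite powRM ?invr_ge0 ?(ltW a0) ?(ltW A0)// -inv ?(ltW A0)//.
rewrite powRM ?invr_ge0 ?(ltW a0) ?(ltW A0)// -[A^-1 `^ q^-1]inv ?(ltW A0)//.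
rewrite {2}(split_ p^-1 q^-1 A)// {3}(split_ p^-1 q^-1 a)//.
have : A `^ p^-1 != 0 by rewrite gt_eqF ?powR_gt0.
have : A `^ q^-1 != 0 by rewrite gt_eqF ?powR_gt0.
have : a `^ q^-1 != 0 by rewrite gt_eqF ?powR_gt0.
move: (A `^ p^-1) (A `^ q^-1) (a `^ p^-1) (a `^ q^-1) => u1 u2 w1 w2 w20 u20 u10.
have pn : p != 0 by rewrite gt_eqF.
have qn : q != 0 by rewrite gt_eqF.
transitivity (u2 * w1 * (q^-1 + p^-1)); last by rewrite addrC pq mulr1.
by field; rewrite w20 u20 u10 pn qn.
Qed.

Lemma integrable_image_inv d1 d2 (Y1 : measurableType d1) (Y2 : measurableType d2) (R : realType)
    (m1 : {measure set Y1 -> \bar R}) (m2 : {measure set Y2 -> \bar R}) (phi : Y1 -> Y2) (g : Y2 -> R) :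
  measurable_fun setT phi -> (forall A, measurable A -> m1 (phi @^-1` A) = m2 A) ->
  measurable_fun setT g -> m1.-integrable setT (EFin \o (g \o phi)) ->
  m2.-integrable setT (EFin \o g).
Proof.
move=> mphi m12 mg /integrableP[_ gi]; apply/integrableP; split; first exact/measurable_EFinP.
rewrite -(ge0_integral_image mphi m12)//; apply: measurableT_comp => //; exact/measurable_EFinP.
Qed.

Section shifted_sums.
Context {R : realType} {T : R}.
Hypothesis T0 : 0 < T.

Lemma shifted_sumE (s : R) M (c : R -> R) :
  \sum_(j < M.+2) (shifted_partition T s M j.+1 - shifted_partition T s M j) * c (shifted_partition T s M j.+1) =
  s * c s + T / M.+1%:R * (\sum_(k < M) c (s + k.+1%:R * (T / M.+1%:R))) +
  (T - (s + M%:R * (T / M.+1%:R))) * c T.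
Proof.
rewrite big_ord_recl /= mul0r addr0 subr0 big_ord_recr/= ltnn ltnSn addrA; congr (_ + _ + _).
rewrite mulr_sumr; apply: eq_bigr => k _; rewrite /bump leq0n !add1n add0n ltnS ltn_ord ltnS (ltnW (ltn_ord k)).
by congr (_ * _); rewrite -[k.+1%:R]natr1; ring.
Qed.

(** With right tags, s gets the weight s instead of T/(M+1), and the tag T is added with a weight
    below T/(M+1), which is the error term. *)
Lemma shifted_sum_upper (s : R) M (c : R -> R) (G : R) : 0 < s < T / M.+1%:R ->
  (forall t, 0 <= t <= T -> 0 <= c t <= G) ->
  \sum_(j < M.+2) (shifted_partition T s M j.+1 - shifted_partition T s M j) * c (shifted_partition T s M j.+1)
  <= T / M.+1%:R * \sum_(k < M.+1) c (s + k%:R * (T / M.+1%:R)) + T / M.+1%:R * G.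
Proof.
move=> sD cG; have /andP[s0 sD'] := sD; rewrite shifted_sumE; set Delta := T / M.+1%:R.
have TE : T = Delta + M%:R * Delta.
  by rewrite -[X in X + _]mul1r -mulrDl nat1r /Delta mulrC divfK.
have sT : 0 <= s <= T.
  by rewrite (ltW s0) TE (le_trans (ltW sD'))// lerDl mulr_ge0// ltW// divr_gt0.
rewrite big_ord_recl /= mul0r addr0 mulrDr -!addrA; apply: lerD.
  by rewrite ler_wpM2r ?(ltW sD')//; have /andP[] := cG s sT.
rewrite lerD2l; have /andP[c0 c1] : 0 <= c T <= G by apply: cG; rewrite lexx ltW.
apply: ler_pM => //.
  by rewrite subr_ge0 [leRHS]TE lerD2r ltW.
by rewrite lerBlDr [leLHS]TE lerD2l lerDr ltW.
Qed.

End shifted_sums.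

(** * The upper bound *)

Section projection.
Context {R : realType} {T : R} {d : nat}.
Hypothesis T0 : 0 < T.
Local Notation X := (C0_path T d).
Local Notation D := (cadlag_path T d).
Local Notation F t := (@filtration R T d t).
Local Notation lambda := (@lebesgue_measure R).
Variables (p q : R).
Hypothesis (p1 : 1 < p) (qE : q = p / (p - 1)).
Variables (f : X -> R) (ft : D -> R) (Dft : R -> D -> 'rV[R]_d).
Hypothesis hf : D1b_with p f ft Dft.
Local Notation Df := (fun t (w : X) => Dft t (cadlag_of_C0 w)).
Variable C : R.
Hypothesis fC : forall w, `|f w| <= C * (1 + sup_lnorm T p w `^ p).
Hypothesis Dc : forall t, 0 <= t <= T -> continuous (Df t).
Hypothesis DC : forall t w, 0 <= t <= T ->
  lnorm p (Df t w) <= C * (1 + sup_lnorm T p w `^ (p - 1)).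
Variable mu : probability X R.
Hypothesis hmu : (\int[mu]_w (sup_lnorm T p w `^ p)%:E < +oo)%E.
Variable oDf : R -> X -> 'rV[R]_d.
Hypothesis hoDf : optional_projection mu Df oDf.
Implicit Types (x y w : X) (s t e : R) (i : 'I_d).
Local Notation S v := (psup (T := T) v).
Local Notation h_ x y := (fun s => (y : R -> 'rV[R]_d) s - (x : R -> 'rV[R]_d) s).

Let p0 : 0 < p. Proof. exact: lt_trans p1. Qed.
Let q1 : 1 < q. Proof. by have [_ q1 _ _ _] := conjugate_exponent p1 qE. Qed.
Let q0 : 0 < q. Proof. exact: lt_trans q1. Qed.

Lemma integrable_Df_power t i : 0 <= t <= T ->
  mu.-integrable setT (EFin \o (fun w => `|Df t w 0 i| `^ q)).
Proof.
move=> tT; have [C1 C10 H] := coord_growth T0 p1 qE DC.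
apply: (@integrable_real_le _ _ _ mu _ measurableT _ (fun w => C1 * (1 + S w `^ p))).
- by apply: measurable_norm_powR; exact: (measurable_Df Dc).
- apply: integrable_realZl => //; apply: integrable_realD => //; first exact: integrable_cstT.
  exact: (integrable_psup T0 p1 hmu).
- by move=> w _; rewrite ger0_norm ?powR_ge0//; exact: H.
Qed.

Lemma projection_power t i : 0 <= t <= T ->
  mu.-integrable setT (EFin \o (fun w => `|oDf t w 0 i| `^ q)) /\
  \int[mu]_w `|oDf t w 0 i| `^ q <= \int[mu]_w `|Df t w 0 i| `^ q.
Proof.
move=> tT; have [Zi oZi oZF orth] := optional_projection_at T0 i hoDf tT.
apply: (condexp_power (G := F t) _ Zi oZi oZF orth p1 qE); last exact: integrable_Df_power.
exact: filtration_measurable.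
Qed.

Definition projection_moment t : R := \int[mu]_w \sum_i `|oDf t w 0 i| `^ q.
Local Notation g := projection_moment.

Lemma integrable_projection_sum t : 0 <= t <= T ->
  mu.-integrable setT (EFin \o (fun w => \sum_i `|oDf t w 0 i| `^ q)).
Proof.
move=> tT; apply: integrable_real_sum => // i.
by have [] := projection_power i tT.
Qed.

Lemma projection_moment_bound : exists G : R, forall t, 0 <= t <= T -> 0 <= g t <= G.
Proof.
have [C1 C10 H] := coord_growth T0 p1 qE DC.
have Gi : mu.-integrable setT (EFin \o (fun w => C1 * (1 + S w `^ p))).
  apply: integrable_realZl => //; apply: integrable_realD => //; first exact: integrable_cstT.
  exact: (integrable_psup T0 p1 hmu).
exists (\sum_(i < d) \int[mu]_w (C1 * (1 + S w `^ p))) => t tT; apply/andP; split.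
  by apply: Rintegral_ge0 => w _; apply: sumr_ge0 => i _; exact: powR_ge0.
rewrite /g Rintegral_sum//; last by move=> i; have [] := projection_power i tT.
apply: ler_sum => i _; have [_ le1] := projection_power i tT; apply: le_trans le1 _.
apply: Rintegral_le_mono => //; first exact: integrable_Df_power.
by move=> w; exact: H.
Qed.

(** Optional processes are jointly measurable on [0, T] x X, and Tonelli's theorem applies. *)
Lemma measurable_projection_moment : measurable_fun `[0, T] g.
Proof.
have mI : measurable (`[0, T]%classic : set R) by exact: measurable_itv.
pose A : set (R * X) := `[0, T]%classic `*` setT.
have mA : measurable A by exact: measurableX.
pose H (u : R * X) := \sum_i `|oDf u.1 u.2 0 i| `^ q.
have mH : measurable_fun A H.
  apply: measurable_sum => i; apply: measurable_norm_powR.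
  by have [/(optional_measurable T0)] := hoDf i.
pose K (u : R * X) : \bar R := ((H \_ A) u)%:E.
have mK : measurable_fun setT K.
  apply/measurable_EFinP; exact: (proj1 (measurable_restrictT H mA) mH).
have K0 u : (0 <= K u)%E.
  rewrite lee_fin patchE; case: ifP => // _.
  by apply: sumr_ge0 => i _; exact: powR_ge0.
have mF := measurable_fun_fubini_tonelli_F (m2 := mu) _ mK K0.
apply: (@eq_measurable_fun _ _ _ _ _ (fun t => fine (fubini_F mu K t))).
  move=> t; rewrite inE/= in_itv/= => tT; rewrite /fubini_F /g /Rintegral; congr fine.
  by apply: eq_integral => w _; rewrite /K patchE mem_set//; split => //=; rewrite in_itv.
by apply: measurable_funTS; apply: (measurableT_comp (fine_measurable _)).
Qed.

Lemma projection_moment_integrable : lambda.-integrable `[0, T] (EFin \o g).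
Proof.
have [G HG] := projection_moment_bound.
have mI : measurable (`[0, T]%classic : set R) by exact: measurable_itv.
have lamE : lambda (`[0, T]%classic : set R) = T%:E.
  by rewrite lebesgue_measure_itv/= lte_fin T0 -EFinB subr0.
have ci : lambda.-integrable `[0, T] (EFin \o (fun=> G)).
  apply/integrableP; split; first exact: measurable_cst.
  by rewrite /= integral_cst//= [X in (_ * X)%E](_ : _ = T%:E) ?ltry.
apply: (@integrable_real_le _ _ _ lambda _ _ g _ measurable_projection_moment ci) => // t.
by rewrite /= in_itv/= => /HG /andP[g0 g1]; rewrite ger0_norm.
Qed.

Definition projection_energy : R := \int[lambda]_(t in `[0, T]) g t.

Lemma projection_energy_ge0 : 0 <= projection_energy.
Proof.
have [G HG] := projection_moment_bound.
by apply: Rintegral_ge0 => t /=; rewrite in_itv/= => /HG /andP[].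
Qed.

Lemma process_normE : process_norm q mu oDf = (projection_energy `^ q^-1)%:E.
Proof.
rewrite /process_norm.
have -> : (\int[lambda]_(t in `[0%R, T]) \int[mu]_w (lnorm q (oDf t w) `^ q)%:E)%E =
    projection_energy%:E.
  rewrite /projection_energy /Rintegral fineK; last first.
    by apply: integrable_fin_num; [exact: measurable_itv|exact: projection_moment_integrable].
  apply: eq_integral => t; rewrite inE/= in_itv/= => tT.
  rewrite /g /Rintegral fineK; last first.
    by apply: integrable_fin_num => //; exact: integrable_projection_sum.
  by apply: eq_integral => w _; rewrite lnorm_powR.
by rewrite poweR_EFin.
Qed.

Section causal_upper_bound.
Variables (nu : probability X R) (pi : probability (X * X)%type R) (a : R).
Hypothesis pic : causal_coupling mu nu pi.
Hypothesis pia : (\int[pi]_z cost T p z.1 z.2 <= a%:E)%E.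

Let pi1 A : measurable A -> pi (fst @^-1` A) = mu A.
Proof. by have [[H _] _] := pic; exact: H. Qed.

Let W t i w := Df t w 0 i - oDf t w 0 i.

Lemma measurable_oDf t i : 0 <= t <= T -> measurable_fun setT (fun w => oDf t w 0 i).
Proof.
by move=> tT; have [_ oZi _ _] := optional_projection_at T0 i hoDf tT;
  exact: integrable_real_measurable oZi.
Qed.

Lemma integrable_W_power t i : 0 <= t <= T ->
  mu.-integrable setT (EFin \o (fun w => `|W t i w| `^ q)).
Proof.
move=> tT; have [oi _] := projection_power i tT.
apply: (@integrable_real_le _ _ _ mu _ measurableT _
  (fun w => 2 `^ q * (`|Df t w 0 i| `^ q + `|oDf t w 0 i| `^ q))).
- apply: measurable_norm_powR; apply: measurable_funB; first exact: (measurable_Df Dc).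
  exact: measurable_oDf.
- by apply: integrable_realZl => //; apply: integrable_realD => //; exact: integrable_Df_power.
- move=> w _; rewrite ger0_norm ?powR_ge0//; apply: le_trans (powRD_le q0 (normr_ge0 _) (normr_ge0 _)).
  by apply: ge0_ler_powR; rewrite ?nnegrE ?addr_ge0 ?(ltW q0)//; exact: ler_normB.
Qed.

Lemma integrable_increment_power s i :
  pi.-integrable setT (EFin \o (fun z : X * X => `|z.2 s 0 i - z.1 s 0 i| `^ p)).
Proof.
have [hi _] := psup_sub_expectation T0 p1 pia.
apply: (@integrable_real_le _ _ _ pi _ measurableT _ (fun z : X * X => S (h_ z.1 z.2) `^ p)) => //.
- apply: measurable_norm_powR; apply: measurable_funB;
    by apply: (measurableT_comp (measurable_coord T0 _ _)).
- move=> z _; rewrite ger0_norm ?powR_ge0//; apply: ge0_ler_powR; rewrite ?nnegrE ?(ltW p0)//.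
    exact: psup_sub_ge0.
  exact: psup_sub_ge.
Qed.

Lemma integrable_mul_increment (V : X -> R) s i : measurable_fun setT V ->
  mu.-integrable setT (EFin \o (fun w => `|V w| `^ q)) ->
  pi.-integrable setT (EFin \o (fun z : X * X => V z.1 * (z.2 s 0 i - z.1 s 0 i))).
Proof.
move=> mV Vi; apply: (integrable_mul_power p1 qE).
- exact: (measurableT_comp mV).
- by apply: measurable_funB; apply: (measurableT_comp (measurable_coord T0 _ _)).
- exact: (integrable_fst pi1 Vi).
- exact: integrable_increment_power.
Qed.

(** D_t f - oD_t f is orthogonal to x(s) by the projection property and to y(s) by causality, since
    both are known at time t >= s. *)
Lemma causal_increment s t i : 0 <= s <= t -> t <= T ->
  \int[pi]_z (W t i z.1 * (z.2 s 0 i - z.1 s 0 i)) = 0.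
Proof.
move=> st tT; have tT' : 0 <= t <= T by case/andP: st => s0 /(le_trans s0) ->.
have [Zi oZi oZF orth] := optional_projection_at T0 i hoDf tT'.
have Wi : mu.-integrable setT (EFin \o W t i) by exact: integrable_realB.
have mW := integrable_real_measurable Wi.
have Wqi := integrable_W_power i tT'.
have xi : mu.-integrable setT (EFin \o (fun w => W t i w * w s 0 i)).
  apply: (integrable_mul_power p1 qE) => //; first exact: measurable_coord.
  apply: (@integrable_real_le _ _ _ mu _ measurableT _ (fun w => S w `^ p)).
  - by apply: measurable_norm_powR; exact: measurable_coord.
  - exact: (integrable_psup T0 p1 hmu).
  - move=> w _; rewrite ger0_norm ?powR_ge0//; apply: ge0_ler_powR; rewrite ?nnegrE ?(ltW p0)//.
      exact: psup_C0_ge0.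
    exact: psup_C0_ge.
have x1i := integrable_fst pi1 xi.
have hi := integrable_mul_increment s i mW Wqi.
have yi : pi.-integrable setT (EFin \o (fun z : X * X => W t i z.1 * z.2 s 0 i)).
  under [X in integrable _ _ X]funext => z do
    rewrite /= -[z.2 s 0 i](subrK (z.1 s 0 i)) mulrDr.
  exact: integrable_realD.
under eq_Rintegral do rewrite mulrBr.
rewrite RintegralB// (causal_orthogonal T0 pic tT' Wi orth (G := fun w => w s 0 i))//; last first.
  by move=> B mB; exact: filtration_coord.
rewrite (Rintegral_fst pi1 xi) sub0r; apply/eqP; rewrite oppr_eq0; apply/eqP.
apply: (condexp_orthogonal (G := F t) (Z := fun w => Df t w 0 i)) => //.
- exact: filtration_measurable.
- by move=> B mB; exact: filtration_coord.
Qed.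

(** D f is tagged at the right end of each cell, a time at which both values of h in the increment
    are known; it may thus be replaced by its projection before Young's inequality is applied. *)
Lemma first_order_upper n tau (kappa : R) : is_partition T n tau -> 0 < kappa ->
  \int[pi]_z first_order Dft z.1 z.2 n tau <=
  kappa `^ q / q * (\sum_(j < n) (tau j.+1 - tau j) * g (tau j.+1)) + (kappa `^ p)^-1 / p * a.
Proof.
move=> tP k0; have [tau0 tauT tS] := tP.
have tT j : (j < n)%N -> 0 <= tau j.+1 <= T by exact: partition_itv.
pose o (z : X * X) := \sum_(j < n) \sum_i oDf (tau j.+1) z.1 0 i * dincr z.1 z.2 tau j i.
have dE (V : X -> R) j i z : V z.1 * dincr z.1 z.2 tau j i =
    V z.1 * (z.2 (tau j.+1) 0 i - z.1 (tau j.+1) 0 i) - V z.1 * (z.2 (tau j) 0 i - z.1 (tau j) 0 i).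
  by rewrite /dincr mulrBr.
have di (V : X -> R) j i : measurable_fun setT V ->
    mu.-integrable setT (EFin \o (fun w => `|V w| `^ q)) ->
    pi.-integrable setT (EFin \o (fun z => V z.1 * dincr z.1 z.2 tau j i)).
  move=> mV Vi; under [X in integrable _ _ X]funext => z do rewrite /= dE.
  by apply: integrable_realB => //; exact: integrable_mul_increment.
have oi (j : 'I_n) i : pi.-integrable setT (EFin \o (fun z => oDf (tau j.+1) z.1 0 i * dincr z.1 z.2 tau j i)).
  apply: (di (fun w => oDf (tau j.+1) w 0 i)); first exact: (measurable_oDf i (tT j (ltn_ord j))).
  by have [] := projection_power i (tT j (ltn_ord j)).
have Zi (j : 'I_n) i : pi.-integrable setT (EFin \o (fun z => Df (tau j.+1) z.1 0 i * dincr z.1 z.2 tau j i)).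
  apply: (di (fun w => Df (tau j.+1) w 0 i)); first exact: (measurable_Df Dc i (tT j (ltn_ord j))).
  exact: integrable_Df_power (tT j (ltn_ord j)).
have osi : pi.-integrable setT (EFin \o o).
  by apply: integrable_real_sum => // j; exact: integrable_real_sum.
have -> : \int[pi]_z first_order Dft z.1 z.2 n tau = \int[pi]_z o z.
  rewrite /first_order /o !Rintegral_sum//; last 2 first.
  - by move=> j; exact: integrable_real_sum.
  - by move=> j; exact: integrable_real_sum.
  apply: eq_bigr => j _; rewrite !Rintegral_sum//; apply: eq_bigr => i _.
  apply/eqP; rewrite -subr_eq0 -RintegralB//.
  under eq_Rintegral do rewrite -mulrBl.
  have /andP[t1 t2] := tT j (ltn_ord j).
  have tj : 0 <= tau j <= tau j.+1.
    have /andP[-> _] := partition_itv tP (ltnW (ltn_ord j)).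
    by rewrite ltW// tS.
  under eq_Rintegral do rewrite (dE (W (tau j.+1) i)).
  have tT' := tT j (ltn_ord j).
  have mW : measurable_fun setT (W (tau j.+1) i).
    by apply: measurable_funB; [exact: (measurable_Df Dc)|exact: measurable_oDf].
  rewrite RintegralB//; [|exact: integrable_mul_increment (integrable_W_power _ _)..].
  by rewrite !causal_increment ?subrr ?lexx ?t1.
have [pI pB] := penergy_expectation T0 p1 pia tP.
pose b (z : X * X) := \sum_(j < n) (tau j.+1 - tau j) * \sum_i `|oDf (tau j.+1) z.1 0 i| `^ q.
have bji (j : 'I_n) : mu.-integrable setT (EFin \o
    (fun w => (tau j.+1 - tau j) * \sum_i `|oDf (tau j.+1) w 0 i| `^ q)).
  by apply: integrable_realZl => //; exact: integrable_projection_sum (tT j (ltn_ord j)).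
have bi : pi.-integrable setT (EFin \o b).
  apply: integrable_real_sum => // j.
  exact: (integrable_fst pi1 (bji j)).
apply: (@le_trans _ _ (\int[pi]_z (kappa `^ q / q * b z + (kappa `^ p)^-1 / p * penergy p z.1 z.2 n tau))).
  apply: Rintegral_le_mono => //; first by apply: integrable_realD => //; exact: integrable_realZl.
  move=> z; rewrite /o /b /penergy !mulr_sumr -big_split/=; apply: ler_sum => j _.
  rewrite !mulr_sumr -big_split/=; apply: ler_sum => i _.
  apply: le_trans (ler_norm _) _; apply: young_scaled => //; rewrite subr_gt0; exact: tS.
rewrite RintegralD//; [|exact: integrable_realZl..].
rewrite !RintegralZl//; apply: lerD; last first.
  by rewrite ler_wpM2l// divr_ge0 ?invr_ge0 ?powR_ge0// ltW.
rewrite /b Rintegral_sum//; last by move=> j; exact: (integrable_fst pi1 (bji j)).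
rewrite ler_wpM2l ?divr_ge0 ?powR_ge0 ?(ltW q0)//; apply: ler_sum => j _.
rewrite (Rintegral_fst pi1 (bji j)) RintegralZl//.
exact: integrable_projection_sum (tT j (ltn_ord j)).
Qed.

(** The two Young parameters are independent: [lam] balances the projected energy against the cost,
    [kappa] balances the gap against it. *)
Lemma value_upper (lam kappa e : R) : 0 < lam -> 0 < kappa -> 0 < e ->
  \int[pi]_z f z.2 - \int[mu]_x f x <=
  (lam `^ q / q * projection_energy + (lam `^ p)^-1 / p * a) +
  (kappa `^ q / q * \int[pi]_z gap_int T0 q Dft z.1 z.2 + (kappa `^ p)^-1 / p * a) + e.
Proof.
move=> l0 k0 e0; pose c := lam `^ q / q; have c0 : 0 <= c by rewrite divr_ge0 ?powR_ge0// ltW.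
have [G HG] := projection_moment_bound.
have G0 : 0 <= G by have /andP[] := HG 0 (introT andP (conj (lexx 0) (ltW T0))); exact: le_trans.
(* One third of e each for the choice of the shift, for the last cell of the shifted partition, and
   for the first-order expansion; the first two get multiplied by [c]. *)
pose e1 := e / 3 / (c + 1).
have e10 : 0 < e1 by rewrite !divr_gt0// ltr_wpDl.
have ce1 : c * e1 <= e / 3.
  by rewrite /e1 mulrCA ler_piMr ?divr_ge0 ?(ltW e0)// ler_pdivrMr ?ltr_wpDl// mul1r lerDl.
have /choice[s sP] : forall M, exists s, 0 < s < T / M.+1%:R /\
    T / M.+1%:R * \sum_(k < M.+1) g (s + k%:R * (T / M.+1%:R)) <= projection_energy + e1.
  move=> M; have [s s1 s2] := shifted_riemann_le M T0 measurable_projection_moment HG e10.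
  by exists s.
have tP M : is_partition T M.+2 (shifted_partition T (s M) M).
  by apply: shifted_partitionP; have [] := sP M.
have mesh : vanishing_mesh (fun M => M.+2) (fun M => shifted_partition T (s M) M).
  move=> delta d0; exists (Num.bound (T / delta)) => M MM j jM; have [sM _] := sP M.
  apply: le_lt_trans (shifted_partition_mesh sM jM) _.
  rewrite ltr_pdivrMr// mulrC -ltr_pdivrMr//.
  apply: lt_le_trans (archi_boundP _) _; first by rewrite divr_ge0// ltW.
  by rewrite ler_nat (leq_trans MM).
have e30 : 0 < e / 3 by rewrite divr_gt0.
have [M0 HM0] := expected_expansion T0 p1 qE hf fC Dc DC hmu pi1 pia tP mesh k0 e30.
pose M := maxn M0 (Num.bound (T * G / e1)).
have [sM riem] := sP M.
have TG : T / M.+1%:R * G <= e1.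
  rewrite mulrAC ler_pdivrMr// [leRHS]mulrC -ler_pdivrMr//; apply: le_trans (ltW (archi_boundP _)) _.
    by apply: divr_ge0; [apply: mulr_ge0 => //|]; exact: ltW.
  by rewrite ler_nat; apply: leqW; exact: leq_maxr.
have := HM0 M (leq_maxl _ _); rewrite ler_norml => /andP[_].
have := first_order_upper (tP M) l0.
have := ler_wpM2l c0 (le_trans (shifted_sum_upper T0 sM HG) (lerD riem TG)).
rewrite -/c !mulrDr.
move: (c * e1) ce1 (c * \sum_(j < _) _) => ce1 ce1e u.
move: (c * projection_energy) ((lam `^ p)^-1 / p * a) (kappa `^ q / q * _) ((kappa `^ p)^-1 / p * a).
move: (\int[pi]_z f z.2) (\int[mu]_x f x) (\int[pi]_z first_order _ _ _ _ _).
by move=> *; lra.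
Qed.

(** The optimal parameters exist for positive quantities only; the energy may vanish, so it is
    increased by e. *)
Lemma value_upper_optimal (e0 K e : R) : 0 < a -> 0 < e0 -> 0 <= K -> 0 < e ->
  \int[pi]_z gap_int T0 q Dft z.1 z.2 <= e0 + K * a ->
  \int[pi]_z f z.2 - \int[mu]_x f x <=
  (projection_energy + e) `^ q^-1 * a `^ p^-1 + (e0 + K * a) `^ q^-1 * a `^ p^-1 + e.
Proof.
move=> a0 e00 K0 ep gapE; have I0 := projection_energy_ge0.
have [lam l0 <-] := young_optimal p1 qE (ltr_wpDl I0 ep) a0.
have A2 : 0 < e0 + K * a by rewrite ltr_wpDr// mulr_ge0// ltW.
have [kappa k0 <-] := young_optimal p1 qE A2 a0.
apply: le_trans (value_upper l0 k0 ep) _; rewrite lerD2r; apply: lerD; rewrite lerD2r ler_wpM2l ?divr_ge0 ?powR_ge0 ?(ltW q0)//.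
by rewrite lerDl ltW.
Qed.

End causal_upper_bound.

Lemma causal_cost_ge0 nu : (0 <= causal_cost p mu nu)%E.
Proof.
apply: le_ereal_inf_tmp => _ [pi _ <-]; apply: integral_ge0 => z _; exact: cost_ge0.
Qed.

Lemma powR_cvg (r b : R) : 0 < r -> 0 <= b -> (b + e) `^ r @[e --> 0^'+] --> b `^ r.
Proof.
move=> r0 b0; apply/cvgrPdist_le => e' e'0.
have [eta eta0 H] := norm_powR_continuous b r0 e'0.
near=> e; have e0 : 0 <= e by near: e; exact: nbhs_right_ge.
rewrite distrC -[b + e in X in X <= _]ger0_norm ?addr_ge0// -[b in _ - b `^ r]ger0_norm//.
apply: H; rewrite addrAC subrr add0r ger0_norm//.
by near: e; exact: nbhs_right_le.
Unshelve. all: by end_near. Qed.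

(** The infimum in the causal cost is approached by couplings of cost at most a + e, with e tending
    to 0; the margin also makes the cost bound positive when a = 0. The constant K is fixed before
    nu. *)
Lemma robust_upper (e0 : R) : 0 < e0 -> exists2 K : R, 0 <= K &
  forall (nu : probability X R) (a : R), causal_cost p mu nu = a%:E ->
  nu.-integrable setT (EFin \o f) /\ \int[nu]_w f w - \int[mu]_w f w <=
    (projection_energy `^ q^-1 + (e0 + K * a) `^ q^-1) * a `^ p^-1.
Proof.
move=> e00; have [K K0 HK] := gap_estimate T0 p1 qE hf Dc DC hmu e00.
exists K => // nu a aE; have a0 : 0 <= a by rewrite -lee_fin -aE causal_cost_ge0.
have ex (e : R) : 0 < e -> exists2 pi, causal_coupling mu nu pi &
    (\int[pi]_z cost T p z.1 z.2 <= (a + e)%:E)%E.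
  move=> ep; have fn : ereal_inf [set (\int[pi]_z cost T p z.1 z.2)%E | pi in causal_coupling mu nu] \is a fin_num.
    by rewrite -[ereal_inf _]/(causal_cost p mu nu) aE.
  have [_ [pi pic <-] lt1] := lb_ereal_inf_adherent ep fn.
  exists pi => //; rewrite EFinD -aE; exact: ltW.
have mf := measurable_f hf.
have fint (e : R) : 0 < e -> nu.-integrable setT (EFin \o f) /\
   \int[nu]_w f w - \int[mu]_w f w <= (projection_energy + e) `^ q^-1 * (a + e) `^ p^-1 +
     (e0 + K * (a + e)) `^ q^-1 * (a + e) `^ p^-1 + e.
  move=> ep; have [pi pic pia] := ex e ep; have [[pi1 pi2] _] := pic.
  have f2i := integrable_f_snd T0 p1 hf fC hmu pi1 pia.
  have ni : nu.-integrable setT (EFin \o f).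
    exact: (integrable_image_inv measurable_snd pi2 mf f2i).
  split=> //; rewrite -(Rintegral_image measurable_snd pi2 ni).
  by apply: (value_upper_optimal pic pia _ e00 K0 ep); [rewrite ltr_wpDl|exact: HK].
split; first by have [] := fint 1 ltr01.
have cv : (projection_energy + e) `^ q^-1 * (a + e) `^ p^-1 +
     (e0 + K * (a + e)) `^ q^-1 * (a + e) `^ p^-1 + e @[e --> 0^'+] -->
   projection_energy `^ q^-1 * a `^ p^-1 + (e0 + K * a) `^ q^-1 * a `^ p^-1 + 0.
  have qi : 0 < q^-1 by rewrite invr_gt0.
  have pI : 0 < p^-1 by rewrite invr_gt0.
  have id0 : e @[e --> (0:R)^'+] --> (0 : R) by apply: cvg_at_right_filter; exact: cvg_id.
  apply: cvgD => //; apply: cvgD; apply: cvgM; try exact: powR_cvg.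
    by apply: powR_cvg => //; exact: projection_energy_ge0.
  have [->|Kn] := eqVneq K 0.
    by under eq_fun do rewrite mul0r; rewrite mul0r; exact: cvg_cst.
  apply/cvgrPdist_le => e' e'0.
  have [eta eta0 H] := norm_powR_continuous (e0 + K * a) qi e'0.
  near=> e; have ep : 0 <= e by near: e; exact: nbhs_right_ge.
  have b0 : 0 <= e0 + K * a by rewrite addr_ge0 ?(ltW e00)// mulr_ge0.
  have b1 : 0 <= e0 + K * (a + e) by rewrite addr_ge0 ?(ltW e00)// mulr_ge0// addr_ge0.
  rewrite distrC -(ger0_norm b1) -(ger0_norm b0); apply: H.
  rewrite (_ : _ - _ = K * e); last by ring.
  rewrite ger0_norm ?mulr_ge0// mulrC -ler_pdivlMr ?lt_def ?Kn//.
  by near: e; apply: nbhs_right_le; rewrite divr_gt0// lt_def Kn.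
rewrite mulrDl -[leRHS]addr0; apply: (cvgr_to_ge cv).
by near=> e; have [|_ ->//] := fint e; near: e; exact: nbhs_right_gt.
Unshelve. all: by end_near. Qed.

End projection.

Import HBNNSimple.

(* f and g need not be measurable: integrals of nonnegative functions are lower
   integrals. *)
Lemma lower_integral_le_ae d (Y : measurableType d) (R : realType)
    (m : {measure set Y -> \bar R}) (D N : set Y) (f g : Y -> \bar R) :
  measurable D -> m.-negligible N ->
  (forall y, D y -> (0 <= f y)%E) -> (forall y, D y -> (0 <= g y)%E) ->
  (forall y, D y -> ~ N y -> (f y <= g y)%E) ->
  (\int[m]_(y in D) f y <= \int[m]_(y in D) g y)%E.
Proof.
move=> mD N0 f0 g0 fg; rewrite (ge0_integralE m f0).
apply: ge_ereal_sup => _ [h hf <-]; rewrite -integralT_nnsfun [leRHS]integral_mkcond.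
apply: (ge0_ae_le_lower_integral _ N0) => //.
- by apply/measurable_EFinP; exact: measurable_funPT.
- by move=> y _; rewrite lee_fin.
- by move=> y _; rewrite patchE; case: ifPn => // /[!inE]; exact: g0.
move=> y _ nN; apply: le_trans (hf y) _.
by rewrite !patchE; case: ifPn => // /[!inE] Dy; exact: fg.
Qed.

(** * Drifted paths and the lower bound *)

Section ramps.
Context {R : realType} {T : R} {d : nat}.
Hypothesis T0 : 0 < T.
Local Notation X := (C0_path T d).
Local Notation lambda := (@lebesgue_measure R).
Implicit Types (x : X) (s t : R) (i : 'I_d) (b : nat -> 'rV[R]_d) (tau : nat -> R).

(** The time spent in the j-th cell up to time t. *)
Definition cell_time tau (t : R) (j : nat) : R := Num.min t (tau j.+1) - Num.min t (tau j).

Definition ramp_fun n tau b (t : R) : 'rV[R]_d :=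
  \sum_(j < n) cell_time tau (clamp T t) j *: b j.

Lemma ramp_funE n tau b t i :
  ramp_fun n tau b t 0 i = \sum_(j < n) cell_time tau (clamp T t) j * b j 0 i.
Proof. by rewrite /ramp_fun summxE; apply: eq_bigr => j _; rewrite mxE. Qed.

Lemma cell_time_dist tau s t j : `|cell_time tau s j - cell_time tau t j| <= 2 * `|s - t|.
Proof.
rewrite /cell_time opprB addrACA [X in _ + X]addrC -opprB.
rewrite (_ : _ - _ = (Num.min s (tau j.+1) - Num.min t (tau j.+1)) -
  (Num.min s (tau j) - Num.min t (tau j))); last by ring.
apply: le_trans (ler_normB _ _) _; rewrite mulr2n mulrDl mul1r.
by apply: lerD; rewrite ![Num.min _ (tau _)]minC; exact: min_dist.
Qed.

Lemma ramp_lipschitz n tau b s t i :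
  `|ramp_fun n tau b s 0 i - ramp_fun n tau b t 0 i| <=
  2 * (\sum_(j < n) \sum_k `|b j 0 k|) * `|s - t|.
Proof.
rewrite !ramp_funE -sumrB; apply: le_trans (ler_norm_sum _ _ _) _.
rewrite mulr_sumr mulr_suml; apply: ler_sum => j _; rewrite -mulrBl normrM.
rewrite mulrAC; apply: ler_pM => //.
  by apply: le_trans (cell_time_dist _ _ _ _) _; rewrite ler_wpM2l// clamp_dist// ltW.
by rewrite (bigD1 i)//= lerDl; apply: sumr_ge0.
Qed.

Section ramp_path.
Variables (n : nat) (tau : nat -> R) (b : nat -> 'rV[R]_d).
Hypothesis tP : is_partition T n tau.

Lemma ramp_start : ramp_fun n tau b 0 = 0.
Proof.
apply/rowP => i; rewrite ramp_funE mxE big1// => j _.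
rewrite /cell_time clamp0//.
have /andP[t1 _] := partition_itv tP (ltn_ord j).
have /andP[t2 _] := partition_itv tP (ltnW (ltn_ord j)).
by rewrite !(min_idPl _)// subrr mul0r.
Qed.

Lemma ramp_continuous : continuous (ramp_fun n tau b).
Proof.
move=> t; apply/cvgrPdist_lt => e e0.
pose B := 2 * (\sum_(j < n) \sum_k `|b j 0 k|).
have B0 : 0 <= B by rewrite mulr_ge0//; do 2![apply: sumr_ge0 => ? _].
near=> s; rewrite /Num.norm/= mx_normrE; apply: (@bigmax_lt _ _ _ _ _ _ _ _ e0) => -[u i] _ /=.
rewrite !mxE ord1; apply: le_lt_trans (ramp_lipschitz _ _ _ _ _ _) _; rewrite -/B.
apply: (@le_lt_trans _ _ ((B + 1) * `|t - s|)); first by rewrite ler_wpM2r// lerDl.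
rewrite mulrC -ltr_pdivlMr ?ltr_wpDl//; near: s.
by apply: cvgr_dist_lt; [exact: cvg_id|rewrite divr_gt0// ltr_wpDl].
Unshelve. all: by end_near. Qed.

Definition ramp_shift_fun x t := x t + ramp_fun n tau b t.

Lemma ramp_shift_frozen x : frozen T (ramp_shift_fun x).
Proof. by move=> t; rewrite /ramp_shift_fun -(C0_frozen x) /ramp_fun clampK. Qed.

Lemma ramp_shift_start x : ramp_shift_fun x 0 = 0.
Proof. by rewrite /ramp_shift_fun C0_start ramp_start addr0. Qed.

Lemma ramp_shift_continuous x : continuous (ramp_shift_fun x).
Proof. by move=> t; apply: cvgD; [exact: C0_continuous|exact: ramp_continuous]. Qed.

Definition ramp_path x : X :=
  C0Path (ramp_shift_frozen x) (ramp_shift_start x) (@ramp_shift_continuous x).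

Lemma ramp_derive x t k i : (k < n)%N -> tau k < t < tau k.+1 ->
  path_derive (fun s => x s - ramp_path x s) t 0 i = - b k 0 i.
Proof.
move=> kn /andP[kt tk]; rewrite mxE derive1E.
have /andP[k0 _] := partition_itv tP (ltnW kn); have /andP[_ kT] := partition_itv tP kn.
pose c := \sum_(j < k) (tau j.+1 - tau j) * b j 0 i.
rewrite (@near_eq_derive _ _ _ _ (fun s => - (c + (s - tau k) * b k 0 i))).
  rewrite derive_val.
  by rewrite /GRing.scale/=; ring.
near=> s.
have ks : tau k < s by near: s; exact: lt_nbhsr.
have sk : s < tau k.+1 by near: s; exact: lt_nbhsl.
rewrite !mxE opprD addrA subrr sub0r; congr (- _).
rewrite ramp_funE clamp_id; last by rewrite (ltW (le_lt_trans k0 ks)) (ltW (lt_le_trans sk kT)).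
rewrite -(big_mkord predT (fun j => cell_time tau s j * b j 0 i)).
rewrite (@big_cat_nat _ _ _ k)//=; last exact: ltnW.
rewrite (big_ltn kn) addrA [X in _ + X]big_nat_cond [X in _ + X]big1 ?addr0; last first.
  move=> j /andP[/andP[kj jn] _]; rewrite /cell_time !(min_idPl _) ?subrr ?mul0r//.
    by apply: le_trans (ltW sk) _; exact: partition_le tP _ (ltnW jn).
  by apply: le_trans (ltW sk) _; apply: partition_le tP _ jn; exact: leqW.
congr (_ + _); last by rewrite /cell_time (min_idPl (ltW sk)) (min_idPr (ltW ks)).
rewrite big_mkord; apply: eq_bigr => j _; rewrite /cell_time !(min_idPr _)//.
  apply: le_trans (ltW ks); apply: partition_le tP _ (ltnW kn); exact: ltnW (ltn_ord j).
by apply: le_trans (ltW ks); exact: partition_le tP (ltn_ord j) (ltnW kn).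
Unshelve. all: by end_near. Qed.

(** Away from the countably many times [tau j] the derivative of the difference is [- b k] on the
    k-th cell, and lower integrals ignore the exceptional null set. The difference is Lipschitz,
    hence absolutely continuous. *)
Lemma ramp_cost (p : R) x : 1 < p ->
  (cost T p x (ramp_path x) <= (\sum_(j < n) (tau j.+1 - tau j) * \sum_i `|b j 0 i| `^ p)%:E)%E.
Proof.
move=> p1; have p0 : 0 < p by exact: lt_trans p1.
pose h s := x s - ramp_path x s.
have [tau0 tauT tS] := tP.
pose sb j := \sum_i `|b j 0 i| `^ p.
have sb0 j : 0 <= sb j by apply: sumr_ge0 => i _; exact: powR_ge0.
have stepE t : 0 <= t <= T -> ~ (exists j : nat, t = tau j) ->
    lnorm p (path_derive h t) `^ p = step_fun n tau sb t.
  move=> /andP[t0 tT] nt.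
  have t0' : 0 < t.
    by rewrite lt_neqAle t0 andbT eq_sym; apply/eqP => tE; apply: nt; exists 0%N; rewrite tau0.
  have [k kn /andP[kt]] := partition_cell tP (introT andP (conj t0' tT)).
  rewrite le_eqVlt => /predU1P[tE|tk]; first by case: nt; exists k.+1.
  rewrite (step_funE _ tP kn) ?kt ?(ltW tk)// lnorm_powR//; apply: eq_bigr => i _.
  by rewrite (ramp_derive x i kn) ?kt// normrN.
have mI : measurable (`[0, T]%classic : set R) by exact: measurable_itv.
have N0 : lambda.-negligible [set t | exists j : nat, t = tau j].
  have cN : countable [set t | exists j : nat, t = tau j].
    rewrite (_ : [set t | _] = range tau); first exact: card_image_le.
    by apply/seteqP; split => t [j]; [move=> ->; exists j|move=> _ <-; exists j].
  apply/negligibleP; last exact: countable_lebesgue_measure0.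
  by apply: countable_measurable => //; exact: measurable_set1.
have ss0 t : 0 <= step_fun n tau sb t.
  by apply: sumr_ge0 => j _; rewrite mulr_ge0// indicE.
have le1 : (\int[lambda]_(t in `[0%R, T]) (lnorm p (path_derive h t) `^ p)%:E <=
    (\sum_(j < n) (tau j.+1 - tau j) * sb j)%:E)%E.
  apply: (@le_trans _ _ (\int[lambda]_(t in `[0%R, T]) (step_fun n tau sb t)%:E)%E).
    apply: (@lower_integral_le_ae _ _ R lambda _ _ _ _ _ N0); first exact: mI.
    - by move=> t _; rewrite lee_fin powR_ge0.
    - by move=> t _; rewrite lee_fin.
    - by move=> t /=; rewrite in_itv/= => tT nt; rewrite lee_fin stepE.
  have mstep : measurable_fun (`]0, T]%classic : set R) (fun t => (step_fun n tau sb t)%:E).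
    by apply/measurable_EFinP; apply: measurable_funTS; exact: measurable_step_fun.
  rewrite -integral_itv_obnd_cbnd//.
  rewrite -(Rintegral_step_fun sb tP) /Rintegral fineK//.
  apply: integrable_fin_num; first exact: measurable_itv.
  apply: (integrable_real_le _ _ (integrable_cst_itv 0 T (\sum_(j < n) sb j))).
  - exact: measurable_itv.
  - by apply: measurable_funTS; exact: measurable_step_fun.
  move=> t _; rewrite ger0_norm// /step_fun; apply: ler_sum => j _.
  by rewrite indicE ler_piMr// lern1 leq_b1.
have int0 : (0 <= \int[lambda]_(t in `[0%R, T]) (lnorm p (path_derive h t) `^ p)%:E)%E.
  by apply: integral_ge0 => t _; rewrite lee_fin powR_ge0.
have W1 : W1p T p h.
  split.
  - by rewrite /h !C0_start subrr.
  - move=> e e0; pose B := 2 * (\sum_(j < n) \sum_k `|b j 0 k|).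
    have B0 : 0 <= B by rewrite mulr_ge0//; do 2![apply: sumr_ge0 => ? _].
    pose K := d%:R `^ p^-1 * B; have K0 : 0 <= K by rewrite mulr_ge0// powR_ge0.
    exists (e / (K + 1)); first by rewrite divr_gt0// ltr_wpDl.
    move=> m u v uv _ sm; apply: (@le_lt_trans _ _ (K * \sum_(i < m) (v i - u i))).
      rewrite mulr_sumr; apply: ler_sum => i _; have [_ [uvi _]] := uv i.
      have -> : K * (v i - u i) = d%:R `^ p^-1 * (B * `|u i - v i|).
        by rewrite /K -mulrA distrC ger0_norm// subr_ge0.
      apply: lnorm_le => //; first by rewrite mulr_ge0.
      move=> k; apply: le_trans (ramp_lipschitz n tau b (u i) (v i) k).
      rewrite le_eqVlt; apply/orP; left; apply/eqP; congr Num.norm.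
      by rewrite /h /= /ramp_shift_fun; move: (ramp_fun _ _ _) => r; rewrite !mxE; ring.
    have s0 : 0 <= \sum_(i < m) (v i - u i).
      by apply: sumr_ge0 => i _; have [_ [uvi _]] := uv i; rewrite subr_ge0.
    apply: (@le_lt_trans _ _ ((K + 1) * \sum_(i < m) (v i - u i))).
      by rewrite ler_wpM2r// lerDl.
    by rewrite mulrC -ltr_pdivlMr// ltr_wpDl.
  - rewrite /W1p_norm; move: le1 int0; case: (\int[lambda]_(t in _) _)%E => [r|//|//] _ _.
    by rewrite poweR_EFin ltry.
rewrite /cost -/h asboolT// /W1p_norm poweRVK//.
Qed.

End ramp_path.

End ramps.

(** * Refined partitions *)

Section refinements.
Context {R : realType}.
Implicit Types (T : R) (tau : nat -> R).

Definition refine_partition tau N (j : nat) : R :=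
  let k := (j %/ N.+1)%N in tau k + (j %% N.+1)%:R * ((tau k.+1 - tau k) / N.+1%:R).

Lemma refine_partitionE tau N k r : (r < N.+1)%N ->
  refine_partition tau N (k * N.+1 + r) = tau k + r%:R * ((tau k.+1 - tau k) / N.+1%:R).
Proof. by move=> rN; rewrite /refine_partition divnMDl// divn_small// addn0 modnMDl modn_small. Qed.

Lemma refine_partitionS tau N k r : (r < N.+1)%N ->
  refine_partition tau N (k * N.+1 + r).+1 = tau k + r.+1%:R * ((tau k.+1 - tau k) / N.+1%:R).
Proof.
move=> rN; have [rN'|Nr] := ltnP r.+1 N.+1; first by rewrite -addnS refine_partitionE.
have -> : r = N by apply/eqP; rewrite eqn_leq -ltnS rN -ltnS.
rewrite -addnS -[X in (_ + X)%N]mul1n -mulnDl addn1 -[X in refine_partition _ _ X]addn0.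
by rewrite refine_partitionE// mul0r addr0 mulrC divfK// addrC subrK.
Qed.

Lemma refine_partitionP T n tau N : is_partition T n tau ->
  is_partition T (n * N.+1) (refine_partition tau N).
Proof.
move=> [tau0 tauT tS]; split.
- by rewrite -[0%N]/(0 * N.+1 + 0)%N refine_partitionE// mul0r addr0.
- by rewrite -[(n * _)%N]addn0 refine_partitionE// mul0r addr0.
move=> j jn; rewrite (divn_eq j N.+1).
have rN : (j %% N.+1 < N.+1)%N by rewrite ltn_mod.
rewrite refine_partitionE// refine_partitionS// ltrD2l ltr_pM2r ?ltr_nat//.
by rewrite divr_gt0// subr_gt0; apply: tS; rewrite ltn_divLR.
Qed.

Lemma refine_cell n tau N T j : is_partition T n tau -> (j < n * N.+1)%N ->
  tau (j %/ N.+1)%N <= refine_partition tau N j /\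
  refine_partition tau N j.+1 <= tau (j %/ N.+1).+1.
Proof.
move=> [_ _ tS] jn; rewrite {2 3}(divn_eq j N.+1).
have rN : (j %% N.+1 < N.+1)%N by rewrite ltn_mod.
have kn : (j %/ N.+1 < n)%N by rewrite ltn_divLR.
have len0 : 0 <= tau (j %/ N.+1).+1 - tau (j %/ N.+1)%N by rewrite subr_ge0 ltW// tS.
rewrite refine_partitionE// refine_partitionS//; split.
  by rewrite lerDl mulr_ge0// divr_ge0.
rewrite addrC -lerBrDr mulrCA ler_piMr// ler_pdivrMr// mul1r ler_nat.
by [].
Qed.

Lemma refine_sum n tau N (G : nat -> R) :
  \sum_(j < n * N.+1) (refine_partition tau N j.+1 - refine_partition tau N j) * G (j %/ N.+1)%N =
  \sum_(k < n) (tau k.+1 - tau k) * G k.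
Proof.
rewrite -(big_mkord predT (fun j => (refine_partition tau N j.+1 - refine_partition tau N j) * G (j %/ N.+1)%N)).
rewrite big_nat_mul big_mkord; apply: eq_bigr => k _.
rewrite -[(k * N.+1)%N]add0n (big_addn 0 _ (k * N.+1)) mulSn addnK big_mkord.
rewrite (eq_bigr (fun=> (tau k.+1 - tau k) / N.+1%:R * G k)).
  by rewrite sumr_const card_ord -[_ *+ N.+1]mulr_natr mulrAC divfK.
move=> r _; rewrite addnC refine_partitionE// refine_partitionS// divnMDl// divn_small// addn0.
by congr (_ * _); rewrite -[r.+1%:R]natr1; ring.
Qed.

Lemma ramp_refine n tau N T d (b : nat -> 'rV[R]_d) j i : is_partition T n tau ->
  (j < n * N.+1)%N ->
  let rho := refine_partition tau N in
  ramp_fun (T := T) n tau b (rho j.+1) 0 i - ramp_fun (T := T) n tau b (rho j) 0 i =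
  (rho j.+1 - rho j) * b (j %/ N.+1)%N 0 i.
Proof.
move=> tP jn rho; have rP := refine_partitionP N tP.
have [c1 c2] := refine_cell tP jn; rewrite -/rho in c1 c2.
have kn : (j %/ N.+1 < n)%N by rewrite ltn_divLR.
have [_ _ rS] := rP; have rr := ltW (rS j jn); rewrite -/rho in rr.
rewrite !ramp_funE !clamp_id; [|exact: partition_itv rP (ltnW jn)|exact: partition_itv rP jn].
rewrite -sumrB (bigD1 (Ordinal kn))//= big1 ?addr0.
  rewrite /cell_time (min_idPl c2) (min_idPr (le_trans c1 rr)) (min_idPl (le_trans rr c2)).
  by rewrite (min_idPr c1) -mulrBl; congr (_ * _); ring.
move=> k kk; rewrite -mulrBl /cell_time.
have [kj|jk|kE] := ltngtP k (j %/ N.+1)%N.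
- have a1 : tau k.+1 <= tau (j %/ N.+1)%N by exact: partition_le tP kj (ltnW kn).
  have a2 : tau k <= tau k.+1 by apply: partition_le tP _ (ltn_ord k).
  rewrite !(min_idPr _) ?subrr ?mul0r//.
  + by rewrite (le_trans a2)// (le_trans a1).
  + by rewrite (le_trans a1).
  + by rewrite (le_trans a2)// (le_trans a1)// (le_trans c1).
  + by rewrite (le_trans a1)// (le_trans c1).
- have a1 : tau (j %/ N.+1).+1 <= tau k by exact: partition_le tP jk (ltnW (ltn_ord k)).
  have a2 : tau k <= tau k.+1 by apply: partition_le tP _ (ltn_ord k).
  rewrite !(min_idPl _) ?subrr ?mul0r//.
  + by rewrite (le_trans rr)// (le_trans c2).
  + by rewrite (le_trans rr)// (le_trans c2)// (le_trans a1).
  + by rewrite (le_trans c2).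
  + by rewrite (le_trans c2)// (le_trans a1).
- by move/eqP: kk; case; apply: val_inj.
Qed.

End refinements.

Lemma image_probability d1 d2 (Y1 : measurableType d1) (Y2 : measurableType d2) (R : realType)
    (m : probability Y1 R) (phi : Y1 -> Y2) : measurable_fun setT phi ->
  exists nu : probability Y2 R, forall A, nu A = m (phi @^-1` A).
Proof.
move=> mphi; pose g : {mfun Y1 >-> Y2} := HB.pack phi (isMeasurableFun.Build _ _ _ _ phi mphi).
by exists (distribution m g).
Qed.

(** The nonnegative contribution of the tag 0 is dropped, and the last cell is short of T/(M+1) by
    s; the second loss is at most T/(M+1) times G. *)
Lemma shifted_left_sum (R : realType) (T s G : R) M (c : R -> R) : 0 < T -> 0 < s < T / M.+1%:R ->
  (forall t, 0 <= t <= T -> 0 <= c t <= G) ->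
  T / M.+1%:R * \sum_(k < M.+1) c (s + k%:R * (T / M.+1%:R)) - T / M.+1%:R * G <=
  \sum_(j < M.+2) (shifted_partition T s M j.+1 - shifted_partition T s M j) * c (shifted_partition T s M j).
Proof.
move=> T0 sD cG; have /andP[s0 sD'] := sD.
rewrite [leRHS]big_ord_recl /= mul0r addr0 subr0 [X in _ <= _ + X]big_ord_recr/=.
rewrite [bump 0 M]add1n ltnn [(0 + M)%N]add0n ltnSn.
set Delta := T / M.+1%:R in sD' *.
have TE : T = Delta + M%:R * Delta.
  by rewrite -[X in X + _]mul1r -mulrDl nat1r /Delta mulrC divfK.
rewrite [\sum_(k < M.+1) _]big_ord_recr/=.
have -> : \sum_(i < M) ((if (bump 0 i < M.+1)%N then s + (bump 0 i)%:R * Delta else T) -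
   (if (0 + i < M.+1)%N then s + (0 + i)%:R * Delta else T)) * c (if (0 + i < M.+1)%N then s + (0 + i)%:R * Delta else T) =
   Delta * \sum_(i < M) c (s + i%:R * Delta).
  rewrite mulr_sumr; apply: eq_bigr => k _; rewrite /bump leq0n add1n add0n ltnS ltn_ord ltnS (ltnW (ltn_ord k)).
  by congr (_ * _); rewrite -[k.+1%:R]natr1; ring.
have /andP[a0 a1] : 0 <= c 0 <= G by apply: cG; rewrite lexx ltW.
have /andP[b0 b1] : 0 <= c (s + M%:R * Delta) <= G.
  apply: cG; rewrite addr_ge0 ?(ltW s0) ?mulr_ge0//=; last by rewrite ltW// divr_gt0.
  by rewrite [leRHS]TE lerD2r ltW.
rewrite [X in _ + (_ + (X - _) * _)]TE [Delta * (_ + _)]mulrDr; move: a0 b0 b1.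
move: (c 0) (c (s + _)) (Delta * \sum_(i < M) _) => u w v u0 w0 wG.
have h1 : 0 <= s * u by rewrite mulr_ge0// ltW.
have h2 : s * w <= Delta * G by apply: ler_pM => //; exact: ltW.
rewrite [X in _ + (_ + X * _)](_ : _ = Delta - s); last by ring.
by move: h1 h2; rewrite mulrBl; move: (s * u) (s * w) (Delta * G) (Delta * w) => *; lra.
Qed.

Lemma refine_mesh (R : realType) (T : R) n tau N j : is_partition T n tau -> (j < n * N.+1)%N ->
  refine_partition tau N j.+1 - refine_partition tau N j <= T / N.+1%:R.
Proof.
move=> tP jn; rewrite (divn_eq j N.+1).
have rN : (j %% N.+1 < N.+1)%N by rewrite ltn_mod.
have kn : (j %/ N.+1 < n)%N by rewrite ltn_divLR.
rewrite refine_partitionE// refine_partitionS// -[X in _ + X * _]natr1.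
have /andP[_ t1] := partition_itv tP kn; have /andP[t2 _] := partition_itv tP (ltnW kn).
rewrite [leLHS](_ : _ = (tau (j %/ N.+1).+1 - tau (j %/ N.+1)%N) / N.+1%:R); last by ring.
by rewrite ler_pM2r ?invr_gt0// lerBlDr (le_trans t1)// lerDl.
Qed.

(** * Adapted drifts and their couplings *)

Section drift.
Context {R : realType} {T : R} {d : nat}.
Hypothesis T0 : 0 < T.
Local Notation X := (C0_path T d).
Local Notation D := (cadlag_path T d).
Local Notation F t := (@filtration R T d t).
Local Notation lambda := (@lebesgue_measure R).
Variables (p q : R).
Hypothesis (p1 : 1 < p) (qE : q = p / (p - 1)).
Variables (f : X -> R) (ft : D -> R) (Dft : R -> D -> 'rV[R]_d).
Hypothesis hf : D1b_with p f ft Dft.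
Local Notation Df := (fun t (w : X) => Dft t (cadlag_of_C0 w)).
Variable C : R.
Hypothesis fC : forall w, `|f w| <= C * (1 + sup_lnorm T p w `^ p).
Hypothesis Dc : forall t, 0 <= t <= T -> continuous (Df t).
Hypothesis DC : forall t w, 0 <= t <= T ->
  lnorm p (Df t w) <= C * (1 + sup_lnorm T p w `^ (p - 1)).
Variable mu : probability X R.
Hypothesis hmu : (\int[mu]_w (sup_lnorm T p w `^ p)%:E < +oo)%E.
Variable oDf : R -> X -> 'rV[R]_d.
Hypothesis hoDf : optional_projection mu Df oDf.
Implicit Types (x y w : X) (s t e : R) (i : 'I_d).
Local Notation S v := (psup (T := T) v).
Local Notation h_ x y := (fun s => (y : R -> 'rV[R]_d) s - (x : R -> 'rV[R]_d) s).
Local Notation g := (projection_moment q mu oDf).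

Let p0 : 0 < p. Proof. exact: lt_trans p1. Qed.
Let q1 : 1 < q. Proof. by have [_ q1 _ _ _] := conjugate_exponent p1 qE. Qed.
Let q0 : 0 < q. Proof. exact: lt_trans q1. Qed.

(* The first-order expansion needs a finer partition than the one that carries the
   drift; this is the price of keeping the speed constant on the coarse cells. *)
Definition oscillation n tau N x : R :=
  \sum_(j < n * N.+1) (refine_partition tau N j.+1 - refine_partition tau N j) *
    \sum_i `|Df (refine_partition tau N j.+1) x 0 i - Df (tau (j %/ N.+1)%N) x 0 i| `^ q.

Lemma refine_times n tau N j : is_partition T n tau -> (j < n * N.+1)%N ->
  (0 <= refine_partition tau N j.+1 <= T) /\ (0 <= tau (j %/ N.+1)%N <= T).
Proof.
move=> tP jn; split; first exact: partition_itv (refine_partitionP N tP) jn.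
by apply: (partition_itv tP); apply: ltnW; rewrite ltn_divLR.
Qed.

Lemma diff_power_growth : exists2 C1 : R, 0 <= C1 & forall s t x i, 0 <= s <= T -> 0 <= t <= T ->
  `|Df s x 0 i - Df t x 0 i| `^ q <= C1 * (1 + S x `^ p).
Proof.
have [C1 C10 H] := coord_growth T0 p1 qE DC.
exists (2 `^ q * (C1 * 2)) => [|s t x i sT tT]; first by rewrite !mulr_ge0// powR_ge0.
apply: (@le_trans _ _ ((`|Df s x 0 i| + `|Df t x 0 i|) `^ q)).
  by apply: ge0_ler_powR; rewrite ?nnegrE ?addr_ge0 ?(ltW q0)//; exact: ler_normB.
apply: le_trans (powRD_le q0 (normr_ge0 _) (normr_ge0 _)) _.
rewrite -mulrA ler_wpM2l ?powR_ge0//; apply: le_trans (lerD (H s x i sT) (H t x i tT)) _.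
by rewrite le_eqVlt; apply/orP; left; apply/eqP; ring.
Qed.

Lemma measurable_oscillation n tau N : is_partition T n tau ->
  measurable_fun setT (oscillation n tau N).
Proof.
move=> tP; apply: measurable_sum => j; apply: measurable_funM => //.
have [t1 t2] := refine_times tP (ltn_ord j).
apply: measurable_sum => i; apply: measurable_norm_powR; apply: measurable_funB.
  exact: (measurable_Df Dc i t1).
exact: (measurable_Df Dc i t2).
Qed.

Lemma oscillation_ge0 n tau N x : is_partition T n tau -> 0 <= oscillation n tau N x.
Proof.
move=> tP; apply: sumr_ge0 => j _; apply: mulr_ge0.
  rewrite subr_ge0; have [_ _ rS] := refine_partitionP N tP; exact/ltW/rS.
by apply: sumr_ge0 => i _; exact: powR_ge0.
Qed.

Lemma oscillation_growth : exists2 C1 : R, 0 <= C1 & forall n tau N x, is_partition T n tau ->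
  oscillation n tau N x <= C1 * (1 + S x `^ p).
Proof.
have [C1 C10 H] := diff_power_growth.
exists (T * d%:R * C1) => [|n tau N x tP]; first by rewrite !mulr_ge0// ltW.
have rP := refine_partitionP N tP; have [r0 rT rS] := rP.
apply: (@le_trans _ _ (\sum_(j < n * N.+1) (refine_partition tau N j.+1 - refine_partition tau N j) *
    (d%:R * (C1 * (1 + S x `^ p))))).
  apply: ler_sum => j _; rewrite ler_wpM2l//.
    by rewrite subr_ge0 ltW//; exact: rS.
  have [t1 t2] := refine_times tP (ltn_ord j).
  apply: (@le_trans _ _ (\sum_(i < d) C1 * (1 + S x `^ p))).
    by apply: ler_sum => i _; exact: H.
  by rewrite sumr_const card_ord mulr_natl.
rewrite -mulr_suml (_ : \sum_(j < _) _ = T) ?mulrA//.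
rewrite -(big_mkord predT (fun j => refine_partition tau N j.+1 - refine_partition tau N j)).
by rewrite telescope_sumr// rT r0 subr0.
Qed.

Lemma integrable_growth_mu (c : R) : mu.-integrable setT (EFin \o (fun x => c * (1 + S x `^ p))).
Proof.
apply: integrable_realZl => //; apply: integrable_realD => //; first exact: integrable_cstT.
exact: (integrable_psup T0 p1 hmu).
Qed.

Lemma integrable_oscillation n tau N : is_partition T n tau ->
  mu.-integrable setT (EFin \o oscillation n tau N).
Proof.
move=> tP; have [C1 _ H] := oscillation_growth.
apply: (integrable_real_le _ (measurable_oscillation N tP) (integrable_growth_mu C1)) => // x _.
by rewrite ger0_norm ?oscillation_ge0//; exact: H.
Qed.

(** The bound is uniform in N. Along a sequence of counterexamples, the right end of the fine cell
    and the left end of the coarse cell around t both tend to t, so the integrand tends to 0 at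
    every continuity time of D f(x), whatever the refinements; dominated convergence is used in t
    and then under mu. *)
Lemma oscillation_small e : 0 < e -> exists2 delta : R, 0 < delta &
  forall n tau N, is_partition T n tau -> (forall j, (j < n)%N -> tau j.+1 - tau j < delta) ->
  \int[mu]_x oscillation n tau N x <= e.
Proof.
move=> e0; apply: contrapT => nd.
have /choice[v vP] : forall m : nat, exists v : nat * (nat -> R) * nat,
    [/\ is_partition T v.1.1 v.1.2, forall j, (j < v.1.1)%N -> v.1.2 j.+1 - v.1.2 j < m.+1%:R^-1 &
     e < \int[mu]_x oscillation v.1.1 v.1.2 v.2 x].
  move=> m; apply: contrapT => nv; apply: nd; exists m.+1%:R^-1 => // n tau N tP mesh.
  by rewrite leNgt; apply/negP => H; apply: nv; exists (n, tau, N).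
pose n m := (v m).1.1; pose tau m := (v m).1.2; pose N m := (v m).2.
have tP m : is_partition T (n m) (tau m) by have [] := vP m.
have mesh m j : (j < n m)%N -> tau m j.+1 - tau m j < m.+1%:R^-1.
  by have [_ H _] := vP m; exact: H.
have big m : e < \int[mu]_x oscillation (n m) (tau m) (N m) x by have [] := vP m.
have [C1 C10 H1] := oscillation_growth.
have [|||||||_ cv] := @real_dominated_cvg _ _ _ mu setT set0
  (fun m x => oscillation (n m) (tau m) (N m) x) (fun=> 0) (fun x => C1 * (1 + S x `^ p)).
- exact: measurableT.
- exact: negligible_set0.
- by move=> m; exact: measurable_oscillation.
- exact: measurable_cst.
- exact: integrable_growth_mu.
- by move=> m x _; rewrite ger0_norm ?oscillation_ge0//; exact: H1.
- move=> x _ _; have [_ _ _ Fll _] := hf.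
  have [B cB HB] := joint_cont_countable T0 x x Fll.
  have [C2 C20 H2] := diff_power_growth.
  have [||_] := @riemann_cvg R T (fun m => (n m * (N m).+1)%N)
    (fun m => refine_partition (tau m) (N m))
    (fun m j => \sum_i `|Df (refine_partition (tau m) (N m) j.+1) x 0 i - Df (tau m (j %/ (N m).+1)%N) x 0 i| `^ q)
    (fun=> 0) B (\sum_(i < d) C2 * (1 + S x `^ p)) T0 (fun m => refine_partitionP (N m) (tP m)) cB.
  + move=> m j jn; have [t1 t2] := refine_times (tP m) jn.
    rewrite ger0_norm; last by apply: sumr_ge0 => i _; exact: powR_ge0.
    by apply: ler_sum => i _; exact: H2.
  + move=> t tT nB e' e'0; have tTc : 0 <= t <= T by case/andP: tT => /ltW->.
    (* Chosen so that d terms of size e1^q add up to at most e'. *)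
    pose e1 := (e' / d.+1%:R) `^ q^-1.
    have ed : 0 < e' / d.+1%:R by rewrite divr_gt0.
    have e10 : 0 < e1 / 2 by rewrite divr_gt0// powR_gt0.
    have [eta eta0 Heta] := HB t tTc nB _ e10.
    exists (Num.bound eta^-1) => m etam j jn /andP[jt tj].
    have [t1 t2] := refine_times (tP m) jn.
    have [c1 c2] := refine_cell (tP m) jn.
    have kn : (j %/ (N m).+1 < n m)%N by rewrite ltn_divLR.
    have lt1 : tau m (j %/ (N m).+1).+1 - tau m (j %/ (N m).+1)%N < eta.
      apply: lt_trans (mesh m _ kn) _; rewrite invf_plt ?posrE//.
      apply: lt_le_trans (archi_boundP _) _; first by rewrite invr_ge0 ltW.
      by rewrite ler_nat; exact: leqW.
    have near u i : 0 <= u <= T -> `|u - t| < eta -> `|Df u x 0 i - Df t x 0 i| <= e1 / 2.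
      move=> uT ut; have := Heta u (cadlag_of_C0 x) uT ut; rewrite !stop_path_id; apply.
      by move=> r k _; rewrite subrr normr0.
    have ge0 : 0 <= \sum_i `|Df (refine_partition (tau m) (N m) j.+1) x 0 i - Df (tau m (j %/ (N m).+1)%N) x 0 i| `^ q.
      by apply: sumr_ge0 => i _; exact: powR_ge0.
    rewrite sub0r normrN ger0_norm//.
    apply: (@le_trans _ _ (\sum_(i < d) e' / d.+1%:R)); last first.
      rewrite sumr_const card_ord -[_ *+ d]mulr_natr mulrAC ler_pdivrMr// ler_wpM2l ?(ltW e'0)//.
      by rewrite ler_nat.
    apply: ler_sum => i _; have <- : e1 `^ q = e' / d.+1%:R.
      by rewrite /e1 -powRrM mulVf ?gt_eqF// powRr1// ltW.
    apply: ge0_ler_powR; rewrite ?nnegrE ?(ltW q0) ?powR_ge0//.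
    rewrite (_ : _ - _ = (Df (refine_partition (tau m) (N m) j.+1) x 0 i - Df t x 0 i) -
      (Df (tau m (j %/ (N m).+1)%N) x 0 i - Df t x 0 i)); last by ring.
    rewrite (splitr e1); apply: le_trans (ler_normB _ _) _; apply: lerD; apply: near => //.
      rewrite ger0_norm ?subr_ge0//; apply: le_lt_trans lt1.
      by apply: lerB => //; apply: ltW; exact: le_lt_trans jt.
    rewrite ler0_norm ?subr_le0; last by apply: ltW; exact: le_lt_trans jt.
    by rewrite opprB; apply: le_lt_trans lt1; rewrite lerD2r (le_trans tj).
  + by rewrite Rintegral_cst ?mul0r//; exact: measurable_itv.
rewrite Rintegral_cstT in cv; have /cvgrPdist_lt/(_ _ e0)[m _ /(_ m (leqnn m))/=] := cv.
by rewrite sub0r normrN => /(le_lt_trans (ler_norm _)) /(lt_trans (big m)); rewrite ltxx.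
Qed.

Section adapted_drift.
Variables (n : nat) (tau : nat -> R) (c : R).
Hypotheses (tP : is_partition T n tau) (c0 : 0 <= c).

Definition drift_speed x (j : nat) : 'rV[R]_d := \row_i (c * dual_power q (oDf (tau j) x 0 i)).

Definition drift x : X := ramp_path T0 (drift_speed x) tP x.

Lemma driftE x t i : drift x t 0 i =
  x t 0 i + \sum_(j < n) cell_time tau (clamp T t) j * (c * dual_power q (oDf (tau j) x 0 i)).
Proof.
rewrite /drift /= /ramp_shift_fun mxE ramp_funE; congr (_ + _).
by apply: eq_bigr => j _; rewrite mxE.
Qed.

Lemma measurable_speed j i : (j < n)%N ->
  measurable_fun setT (fun x => c * dual_power q (oDf (tau j) x 0 i)).
Proof.
move=> jn; apply: measurable_funM => //; apply: (measurableT_comp (measurable_dual_power q)).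
exact: (measurable_oDf T0 hoDf i (partition_itv tP (ltnW jn))).
Qed.

Lemma measurable_drift : measurable_fun setT drift.
Proof.
apply: measurable_fun_C0 => // t i tT; under eq_fun do rewrite driftE.
apply: measurable_funD; first exact: measurable_coord.
apply: measurable_sum => j; apply: measurable_funM => //; exact: measurable_speed.
Qed.

(** Adaptedness read as measurability on the type carrying the generated sigma-algebra, where sums
    and products are available. *)
Lemma natural_filtration_fun (r : R) (G : X -> R) :
  (forall B, measurable B -> natural_filtration r (G @^-1` B)) <->
  @measurable_fun _ _ (g_sigma_algebraType [set A | exists r' (i : 'I_d) (B : set R),
        [/\ 0 <= r' <= r, measurable B & A = [set w : X | B (w r' 0 i)]]]) R setT G.
Proof.
split=> [H _ B mB|mG B mB]; first by rewrite setTI; exact: H.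
by have := mG measurableT B mB; rewrite setTI.
Qed.

(** The j-th term vanishes until tau_j. Afterwards r > tau_j strictly, and F_{tau_j}, being an
    intersection over later times, is contained in the natural sigma-algebra at r: right continuity
    of the filtration costs nothing. *)
Lemma drift_coord_adapted r i (B : set R) : 0 <= r -> measurable B ->
  natural_filtration r [set x | B (drift x r 0 i)].
Proof.
move=> r0; move: B; apply/(@natural_filtration_fun r (fun x => drift x r 0 i)).
rewrite (_ : (fun x => _) = (fun x => x r 0 i +
   \sum_(j < n) cell_time tau (clamp T r) j * (c * dual_power q (oDf (tau j) x 0 i)))); last first.
  by apply/funext => x; rewrite driftE.
apply: measurable_funD.
  apply/(@natural_filtration_fun r (fun x : X => x r 0 i)) => B mB; apply: sub_sigma_algebra.
  by exists r, i, B; rewrite r0 lexx.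
apply: measurable_sum => j.
have [rt|tr] := leP (clamp T r) (tau j).
  have [_ _ tS] := tP.
  have ct0 : cell_time tau (clamp T r) j = 0.
    rewrite /cell_time (min_idPl rt) (min_idPl _) ?subrr//.
    exact: le_trans rt (ltW (tS j (ltn_ord j))).
  rewrite ct0 (_ : (fun x => _) = (fun=> 0)); last by apply/funext => x; rewrite mul0r.
  exact: measurable_cst.
have {}tr : tau j < r.
  apply: lt_le_trans tr _; rewrite /clamp; case: (leP T r) => rT.
    by rewrite (max_idPr (ltW T0)).
  by rewrite (max_idPr r0).
do 2![apply: measurable_funM; first exact: measurable_cst].
apply: (measurableT_comp (measurable_dual_power q)).
apply/(@natural_filtration_fun r (fun x : X => oDf (tau j) x 0 i)) => B mB.
have [_ _ oF _] := optional_projection_at T0 i hoDf (partition_itv tP (ltnW (ltn_ord j))).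
exact: (oF B mB r tr).
Qed.

Lemma drift_adapted t (U : set X) : 0 <= t -> F t U -> F t (drift @^-1` U).
Proof.
move=> t0 FU s /= ts; have := FU s ts; have s0 : 0 <= s by rewrite (le_trans t0)// ltW.
have [N0 ND NU] : sigma_algebra setT (@natural_filtration R T d s) by exact: smallest_sigma_algebra.
apply: (@smallest_sub _ _ _ [set V : set X | natural_filtration s (drift @^-1` V)]).
  split=> /=.
  - by rewrite preimage_set0.
  - by move=> A; rewrite !setTD preimage_setC -setTD; exact: ND.
  - by move=> A HA; rewrite preimage_bigcup; exact: NU.
move=> _ [r [i [B [/andP[r0 rs] mB ->]]]] /=.
have := @drift_coord_adapted r i B r0 mB; apply: (@smallest_sub _ _ _ (@natural_filtration R T d s)).
  exact: smallest_sigma_algebra.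
move=> _ [r' [i' [B' [/andP[r'0 r'r] mB' ->]]]]; apply: sub_sigma_algebra.
by exists r', i', B'; rewrite r'0 (le_trans r'r).
Qed.

Lemma measurable_graph : measurable_fun setT (fun x => (x, drift x)).
Proof. by apply: measurable_fun_pair => //; exact: measurable_drift. Qed.

(** The kernel is the Dirac mass at [drift x], so that k x U is the indicator of the preimage of U,
    an event of F_t itself; causality holds without completion. *)
Lemma drift_coupling : exists nu : probability X R, exists pi : probability (X * X)%type R,
  [/\ forall A, nu A = mu (drift @^-1` A), forall A, pi A = mu ((fun x => (x, drift x)) @^-1` A) &
      causal_coupling mu nu pi].
Proof.
have [nu nuE] := image_probability mu measurable_drift.
have [pi piE] := image_probability mu measurable_graph.
exists nu, pi; split => //; split; first by split => A _; rewrite ?nuE piE.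
exists (kdirac measurable_drift).
  move=> A B mA mB; rewrite piE.
  have mdB : measurable (drift @^-1` B).
    by rewrite -[X in measurable X]setTI; exact: measurable_drift.
  rewrite (_ : _ @^-1` _ = A `&` drift @^-1` B); last by apply/seteqP; split.
  rewrite setIC -integral_indic//; apply: eq_integral => x _.
move=> t /andP[t0 _] U FU B mB.
have FdU := drift_adapted t0 FU.
have [F0 FD _] := filtration_sigma (T := T) (d := d) t.
exists ((fun x => kdirac measurable_drift x U) @^-1` B); last first.
  by rewrite setDv setU0; exact: negligible_set0.
have dE x : kdirac measurable_drift x U = (drift x \in U)%:R%:E by rewrite /kdirac/= diracE.
(* The kernel takes the values 0 and 1 only, so the preimage of B is decided by which of the two B
   contains. *)
have [B0|nB0] := pselect (B 0%:E); have [B1|nB1] := pselect (B 1%:E).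
- rewrite (_ : _ @^-1` _ = setT); first exact: filtration_setT.
  by apply/seteqP; split => x //= _; rewrite dE; case: (_ \in _).
- rewrite (_ : _ @^-1` _ = setT `\` drift @^-1` U); first exact: FD.
  apply/seteqP; split => x /=; rewrite dE.
    by move=> BU; split => // Ux; move: BU; rewrite mem_set.
  by move=> [_ nU]; rewrite memNset.
- rewrite (_ : _ @^-1` _ = drift @^-1` U)//.
  apply/seteqP; split => x /=; rewrite dE; last by move=> Ux; rewrite mem_set.
  by case: (boolP (_ \in _)) => //; rewrite inE.
- rewrite (_ : _ @^-1` _ = set0)//.
  by apply/seteqP; split => x //=; rewrite dE; case: (_ \in _).
Qed.

Definition left_sum : R := \sum_(j < n) (tau j.+1 - tau j) * g (tau j).

Let tauT j : (j < n)%N -> 0 <= tau j <= T.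
Proof. by move=> jn; exact: partition_itv tP (ltnW jn). Qed.

Lemma speed_power (u : R) : `|c * dual_power q u| `^ p = c `^ p * `|u| `^ q.
Proof. by rewrite normrM powRM// (ger0_norm c0) (dual_power_norm _ p1 qE). Qed.

Lemma integrable_oDf_power j i : (j < n)%N ->
  mu.-integrable setT (EFin \o (fun w => `|oDf (tau j) w 0 i| `^ q)).
Proof. by move=> jn; have [] := projection_power T0 p1 qE Dc DC hmu hoDf i (tauT jn). Qed.

Lemma projection_momentE j : (j < n)%N ->
  g (tau j) = \sum_i \int[mu]_w `|oDf (tau j) w 0 i| `^ q.
Proof. by move=> jn; rewrite /projection_moment Rintegral_sum// => i; exact: integrable_oDf_power. Qed.

Lemma integrable_Df_speed s j i : 0 <= s <= T -> (j < n)%N ->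
  mu.-integrable setT (EFin \o (fun w => Df s w 0 i * (c * dual_power q (oDf (tau j) w 0 i)))).
Proof.
move=> sT jn; apply: (integrable_mul_power p1 qE).
- exact: (measurable_Df Dc).
- exact: measurable_speed.
- exact: (integrable_Df_power T0 p1 qE Dc DC hmu i sT).
- under [X in integrable _ _ X]funext => w do rewrite /= speed_power.
  by apply: integrable_realZl => //; exact: integrable_oDf_power.
Qed.

(** The speed is known at tau_j, so D f may be replaced by its projection, whose product with its
    own dual power is |oD f|^q. *)
Lemma expected_speed j i : (j < n)%N ->
  \int[mu]_w (Df (tau j) w 0 i * (c * dual_power q (oDf (tau j) w 0 i))) =
  c * \int[mu]_w `|oDf (tau j) w 0 i| `^ q.
Proof.
move=> jn; have tT := tauT jn.
have [Zi oZi oF orth] := optional_projection_at T0 i hoDf tT.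
have qi := integrable_oDf_power i jn.
have oi : mu.-integrable setT (EFin \o (fun w => oDf (tau j) w 0 i * (c * dual_power q (oDf (tau j) w 0 i)))).
  under [X in integrable _ _ X]funext => w do rewrite /= mulrCA dual_powerM//.
  exact: integrable_realZl.
have Di := integrable_Df_speed i tT jn.
have := condexp_orthogonal (G := F (tau j)) _ Zi oZi orth
  (H := fun w => c * dual_power q (oDf (tau j) w 0 i)).
move=> /(_ (@filtration_measurable _ _ _ T0 (tau j))) H.
have {}H : \int[mu]_w ((Df (tau j) w 0 i - oDf (tau j) w 0 i) * (c * dual_power q (oDf (tau j) w 0 i))) = 0.
  apply: H; last first.
    under [X in integrable _ _ X]funext => w do rewrite /= mulrBl.
    exact: integrable_realB.
  move=> B mB; apply: (oF ((fun u => c * dual_power q u) @^-1` B)).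
  have m : measurable_fun setT (fun u => c * dual_power q u).
    by apply: measurable_funM => //; exact: measurable_dual_power.
  by rewrite -[X in measurable X]setTI; exact: m.
move: H; under eq_Rintegral do rewrite mulrBl; rewrite RintegralB// => /eqP.
rewrite subr_eq0 => /eqP->; rewrite -RintegralZl//; apply: eq_Rintegral => w _.
by rewrite mulrCA dual_powerM.
Qed.

Section drift_coupling_bounds.
Variable pi : probability (X * X)%type R.
Hypothesis piE : forall A, pi A = mu ((fun x => (x, drift x)) @^-1` A).

Let pi1 A : measurable A -> pi (fst @^-1` A) = mu A.
Proof. by move=> _; rewrite piE. Qed.

(** The cost is estimated on the graph of the drift only. Off the graph the uniform distance [Psi]
    is positive, and {Psi > 0} is a measurable set whose preimage under the graph map is empty. *)
Lemma off_graph_negligible : pi.-negligible [set z | z.2 <> drift z.1].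
Proof.
pose Psi (z : X * X) := S (h_ (drift z.1) z.2).
have md u i : measurable_fun setT (fun z : X * X => drift z.1 u 0 i).
  apply: (measurableT_comp (measurable_coord T0 u i)).
  exact: (measurableT_comp measurable_drift).
have mPsi : measurable_fun setT Psi.
  apply: measurable_psup => // [z i|t i].
    rewrite (_ : (fun t => _) = (fun t => z.2 t 0 i - drift z.1 t 0 i)).
      by move=> t; apply: cvgB; exact: C0_coord_continuous.
    by apply/funext => t; rewrite !mxE.
  rewrite (_ : (fun u => _) = (fun u : X * X => u.2 t 0 i - drift u.1 t 0 i)).
    by apply: measurable_funB => //; apply: (measurableT_comp (measurable_coord T0 _ _)).
  by apply/funext => u; rewrite !mxE.
exists (Psi @^-1` `]0, +oo[%classic); split.
- by rewrite -[X in measurable X]setTI; apply: mPsi => //; exact: measurable_itv.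
- rewrite piE (_ : _ @^-1` _ = set0) ?measure0//; apply/seteqP; split => x //=.
  rewrite in_itv/= andbT ltNge => /negP; apply; apply: psup_le => // t i _.
  by rewrite !mxE subrr normr0.
move=> z /= nz; rewrite in_itv/= andbT ltNge; apply/negP => le0; apply: nz.
apply: (C0_path_eq T0) => t i tT; apply/eqP; rewrite -subr_eq0 -normr_le0.
by apply: le_trans le0; exact: psup_sub_ge.
Qed.

Lemma drift_cost : (\int[pi]_z cost T p z.1 z.2 <= (c `^ p * left_sum)%:E)%E.
Proof.
pose b w := \sum_(j < n) (tau j.+1 - tau j) * \sum_i c `^ p * `|oDf (tau j) w 0 i| `^ q.
have [_ _ tS] := tP.
have len0 (j : 'I_n) : 0 <= tau j.+1 - tau j by rewrite subr_ge0 ltW// tS.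
have b0 w : 0 <= b w.
  by apply: sumr_ge0 => j _; rewrite mulr_ge0//; apply: sumr_ge0 => i _; rewrite mulr_ge0 ?powR_ge0.
have bji (j : 'I_n) : mu.-integrable setT (EFin \o (fun w => \sum_i c `^ p * `|oDf (tau j) w 0 i| `^ q)).
  by apply: integrable_real_sum => // i; apply: integrable_realZl => //; exact: integrable_oDf_power.
have bi : mu.-integrable setT (EFin \o b).
  by apply: integrable_real_sum => // j; exact: integrable_realZl.
apply: (@le_trans _ _ (\int[pi]_z (b z.1)%:E)%E).
  apply: (lower_integral_le_ae measurableT off_graph_negligible).
  - by move=> z _; exact: cost_ge0.
  - by move=> z _; rewrite lee_fin.
  move=> z _ /contrapT ->; apply: le_trans (ramp_cost T0 (drift_speed z.1) tP z.1 p1) _.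
  rewrite lee_fin; apply: ler_sum => j _; rewrite ler_wpM2l//; apply: ler_sum => i _.
  by rewrite mxE speed_power.
rewrite (ge0_integral_image measurable_fst pi1 (g := fun w => (b w)%:E)); last 2 first.
- by apply/measurable_EFinP; exact: (integrable_real_measurable bi).
- by move=> w; rewrite lee_fin.
have -> : (\int[mu]_w (b w)%:E)%E = (\int[mu]_w b w)%:E.
  by rewrite /Rintegral fineK//; exact: integrable_fin_num.
rewrite lee_fin /b Rintegral_sum//; last by move=> j; exact: integrable_realZl.
rewrite /left_sum mulr_sumr; apply: ler_sum => j _; rewrite RintegralZl// mulrCA ler_wpM2l//.
rewrite Rintegral_sum//; last by move=> i; apply: integrable_realZl => //; exact: integrable_oDf_power.
rewrite projection_momentE// mulr_sumr; apply: ler_sum => i _; rewrite RintegralZl//.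
exact: integrable_oDf_power.
Qed.

(** On a refined cell the increment is the length times the speed of the coarse cell. Moving the
    time of D f back to the left end of the coarse cell gives the main term by [expected_speed];
    Young's inequality splits the error into oscillation and energy. *)
Lemma drift_first_order N (eta : R) : 0 < eta ->
  c * left_sum - (eta `^ q / q * \int[mu]_x oscillation n tau N x +
    (eta `^ p)^-1 / p * (c `^ p * left_sum)) <=
  \int[pi]_z first_order Dft z.1 z.2 (n * N.+1) (refine_partition tau N).
Proof.
move=> eta0; have [_ _ tS] := tP.
have rP := refine_partitionP N tP; have [_ _ rS] := rP.
set rho := refine_partition tau N.
have len0 (j : 'I_n) : 0 <= tau j.+1 - tau j by rewrite subr_ge0 ltW// tS.
pose beta w j i := c * dual_power q (oDf (tau j) w 0 i).
pose G w j := \sum_i (Df (tau j) w 0 i * beta w j i - (eta `^ p)^-1 / p * `|beta w j i| `^ p).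
pose L w := \sum_(k < n) (tau k.+1 - tau k) * G w k - eta `^ q / q * oscillation n tau N w.
have bpi (j : 'I_n) i : mu.-integrable setT (EFin \o (fun w => `|beta w j i| `^ p)).
  under [X in integrable _ _ X]funext => w do rewrite /= speed_power.
  by apply: integrable_realZl => //; exact: integrable_oDf_power.
have Dbi (j : 'I_n) i : mu.-integrable setT (EFin \o (fun w => Df (tau j) w 0 i * beta w j i)).
  exact: integrable_Df_speed (tauT (ltn_ord j)) (ltn_ord j).
have Gji (j : 'I_n) i : mu.-integrable setT (EFin \o (fun w => Df (tau j) w 0 i * beta w j i -
    (eta `^ p)^-1 / p * `|beta w j i| `^ p)).
  by apply: integrable_realB => //; exact: integrable_realZl.
have Gi (j : 'I_n) : mu.-integrable setT (EFin \o (fun w => G w j)).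
  exact: integrable_real_sum.
have oi := integrable_oscillation N tP.
have lGi (j : 'I_n) : mu.-integrable setT (EFin \o (fun w => (tau j.+1 - tau j) * G w j)).
  exact: (integrable_realZl measurableT _ (Gi j)).
have LGi : mu.-integrable setT (EFin \o (fun w => \sum_(k < n) (tau k.+1 - tau k) * G w k)).
  exact: integrable_real_sum.
have Li : mu.-integrable setT (EFin \o L).
  by apply: integrable_realB => //; exact: integrable_realZl.
have IG (j : 'I_n) : \int[mu]_w G w j = c * g (tau j) - (eta `^ p)^-1 / p * (c `^ p * g (tau j)).
  rewrite /G Rintegral_sum// projection_momentE// !mulr_sumr -sumrB; apply: eq_bigr => i _.
  rewrite RintegralB//; last exact: integrable_realZl.
  rewrite expected_speed// RintegralZl//; congr (_ - _ * _).
  by rewrite -RintegralZl//; [apply: eq_Rintegral => w _; rewrite speed_power|exact: integrable_oDf_power].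
have -> : c * left_sum - (eta `^ q / q * \int[mu]_x oscillation n tau N x +
    (eta `^ p)^-1 / p * (c `^ p * left_sum)) = \int[mu]_w L w.
  rewrite /L RintegralB//; last exact: integrable_realZl.
  rewrite [X in _ = X - _]Rintegral_sum// (RintegralZl _ _ oi)// (eq_bigr (fun j : 'I_n => c * ((tau j.+1 - tau j) * g (tau j)) -
    (eta `^ p)^-1 / p * (c `^ p * ((tau j.+1 - tau j) * g (tau j))))).
    by rewrite sumrB -!mulr_sumr -/left_sum; ring.
  by move=> j _; rewrite RintegralZl// IG; ring.
have FOi := integrable_first_order T0 p1 qE Dc DC hmu pi1 drift_cost rP.
have piE' A : measurable A -> mu ((fun x => (x, drift x)) @^-1` A) = pi A by rewrite piE.
rewrite -(Rintegral_image measurable_graph piE' FOi).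
apply: Rintegral_le_mono => //; first exact: (integrable_image measurable_graph piE' FOi).
move=> x; rewrite /L /first_order /=.
rewrite -(refine_sum n tau N (fun k => G x k)) /oscillation mulr_sumr -sumrB.
apply: ler_sum => j _; rewrite -/rho.
have dl : 0 <= rho j.+1 - rho j by rewrite subr_ge0 ltW// rS.
have dE i : dincr x (drift x) rho j i = (rho j.+1 - rho j) * beta x (j %/ N.+1)%N i.
  have -> : beta x (j %/ N.+1)%N i = drift_speed x (j %/ N.+1)%N 0 i by rewrite mxE.
  rewrite -(ramp_refine (drift_speed x) i tP (ltn_ord j)) /dincr /drift /= /ramp_shift_fun.
  by rewrite -/rho; move: (ramp_fun n tau (drift_speed x)) => r; rewrite !mxE; ring.
under [X in _ <= X]eq_bigr do rewrite dE mulrCA.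
rewrite -mulr_sumr mulrCA -mulrBr ler_wpM2l// /G mulr_sumr -sumrB; apply: ler_sum => i _.
have := young_scaled (Df (rho j.+1) x 0 i - Df (tau (j %/ N.+1)%N) x 0 i) (beta x (j %/ N.+1)%N i) p1 qE eta0 ltr01.
rewrite powR1 divr1 mul1r ler_norml => /andP[+ _]; rewrite mulrBl.
move: (eta `^ q / q * _) ((eta `^ p)^-1 / p * _) => u1 u2.
by move: (_ * beta _ _ _) (_ * beta _ _ _) => v1 v2; lra.
Qed.

End drift_coupling_bounds.

End adapted_drift.

Lemma causal_cost_le nu pi (b : \bar R) : causal_coupling mu nu pi ->
  (\int[pi]_z cost T p z.1 z.2 <= b)%E -> (causal_cost p mu nu <= b)%E.
Proof. by move=> pic; apply: le_trans; apply: ereal_inf_lbound; exists pi. Qed.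

Lemma drift_value n tau c (tP : is_partition T n tau) (nu : probability X R)
    (pi : probability (X * X)%type R) :
  0 <= c ->
  (forall A, nu A = mu (drift c tP @^-1` A)) ->
  (forall A, pi A = mu ((fun x => (x, drift c tP x)) @^-1` A)) ->
  nu.-integrable setT (EFin \o f) /\ \int[pi]_z f z.2 = \int[nu]_w f w.
Proof.
move=> c0 nuE piE; have mf := measurable_f hf.
have pi1 A : measurable A -> pi (fst @^-1` A) = mu A by rewrite piE.
have pi2 A : measurable A -> pi (snd @^-1` A) = nu A by rewrite piE nuE.
have f2i := integrable_f_snd T0 p1 hf fC hmu pi1 (drift_cost c0 piE).
have ni : nu.-integrable setT (EFin \o f).
  exact: (integrable_image_inv measurable_snd pi2 mf f2i).
by split=> //; rewrite -(Rintegral_image measurable_snd pi2 ni).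
Qed.

Local Notation I := (projection_energy q mu oDf).

(** Zero speed leaves mu unchanged; this settles the case where u or the projected energy
    vanishes. *)
Lemma robust_lower0 : exists2 nu : probability X R, (causal_cost p mu nu <= 0)%E &
  nu.-integrable setT (EFin \o f) /\ \int[nu]_w f w = \int[mu]_w f w.
Proof.
have tP := uniform_partition T0 0.
have [nu [pi [nuE piE pic]]] := @drift_coupling _ _ (0 : R) tP.
have [ni fE] := drift_value (lexx 0) nuE piE.
exists nu.
  apply: (causal_cost_le pic); apply: le_trans (drift_cost (lexx 0) piE) _.
  by rewrite powR0 ?mul0r// gt_eqF.
split=> //; apply: (@eq_trans _ _ (\int[mu]_w f (drift 0 tP w))).
  apply/esym; apply: (Rintegral_image (measurable_drift _ tP)) => // A _; exact/esym/nuE.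
apply: eq_Rintegral => w _; congr f; apply: (C0_path_eq T0) => t i _.
by rewrite driftE big1 ?addr0// => j _; rewrite mul0r mulr0.
Qed.

Lemma good_partition (u e e2 : R) : 0 < u -> 0 < e -> 0 < e2 -> 0 < I ->
  exists n tau, [/\ is_partition T n tau, 0 < left_sum n tau,
    u * I `^ q^-1 - e <= u * left_sum n tau `^ q^-1 &
    forall N, \int[mu]_x oscillation n tau N x <= e2].
Proof.
move=> u0 e0 e20 I0; have qi : 0 < q^-1 by rewrite invr_gt0.
have eu0 : 0 < e / u by rewrite divr_gt0.
have [eta eta0 Heta] := norm_powR_continuous I qi eu0.
(* [eta] controls the q-th root of the left sum, and [I / 2] keeps the left sum positive. *)
pose e1 := Num.min eta (I / 2); have e10 : 0 < e1 by rewrite lt_min eta0 divr_gt0.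
have [delta d0 Hosc] := oscillation_small e20.
have [G HG] := projection_moment_bound T0 p1 qE Dc DC hmu hoDf.
have G0 : 0 <= G by have /andP[] := HG 0 (introT andP (conj (lexx 0) (ltW T0))); exact: le_trans.
have e120 : 0 < e1 / 2 by rewrite divr_gt0.
pose M := maxn (Num.bound (T / delta)) (Num.bound (T * G / (e1 / 2))).
have TD : T / M.+1%:R < delta.
  rewrite ltr_pdivrMr// mulrC -ltr_pdivrMr//.
  apply: lt_le_trans (archi_boundP _) _; first by rewrite divr_ge0// ltW.
  by rewrite ler_nat; apply: leqW; exact: leq_maxl.
have TG : T / M.+1%:R * G <= e1 / 2.
  rewrite mulrAC ler_pdivrMr// [leRHS]mulrC -ler_pdivrMr//; apply: le_trans (ltW (archi_boundP _)) _.
    by apply: divr_ge0; [apply: mulr_ge0 => //|]; exact: ltW.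
  by rewrite ler_nat; apply: leqW; exact: leq_maxr.
have [s sD riem] := shifted_riemann_ge M T0 (measurable_projection_moment T0 q hoDf) HG e120.
have tP := shifted_partitionP sD.
exists M.+2, (shifted_partition T s M).
have SI : I - e1 <= left_sum M.+2 (shifted_partition T s M).
  apply: le_trans (shifted_left_sum T0 sD HG); rewrite -/I in riem.
  by apply: le_trans (lerB riem TG); rewrite [in leLHS](splitr e1) opprD addrA.
have e1I : e1 <= I / 2 by rewrite /e1 ge_min lexx orbT.
have Ie1 : 0 < I - e1 by rewrite subr_gt0; apply: le_lt_trans e1I _; rewrite ltr_pdivrMr// ltr_pMr// ltrDl.
split=> //; first exact: lt_le_trans SI.
  rewrite lerBlDr -lerBlDl -mulrBr -ler_pdivlMl//; rewrite mulrC.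
  have : `| `|I - e1| `^ q^-1 - `|I| `^ q^-1| <= e / u.
    apply: Heta; rewrite addrAC subrr sub0r normrN gtr0_norm// /e1 ge_min lexx//.
  rewrite (gtr0_norm Ie1) (gtr0_norm I0) distrC => /(le_trans (ler_norm _)); apply: le_trans.
  rewrite lerB//; apply: ge0_ler_powR; rewrite ?nnegrE ?(ltW qi) ?(ltW Ie1)//.
  exact: le_trans (ltW Ie1) SI.
by move=> N; apply: Hosc => // j jn; apply: le_lt_trans (shifted_partition_mesh sD jn) TD.
Qed.

(** The partition is fixed before delta; only the speed c and the refinement used in the expansion
    depend on delta. *)
Lemma robust_lower (u e : R) : 0 <= u -> 0 < e -> exists2 delta0 : R, 0 < delta0 &
  forall delta, 0 < delta < delta0 -> exists2 nu : probability X R,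
    (causal_cost p mu nu <= ((delta * u) `^ p)%:E)%E &
    nu.-integrable setT (EFin \o f) /\
    \int[mu]_w f w + delta * (u * I `^ q^-1 - e) <= \int[nu]_w f w.
Proof.
move=> u0 e0; have I_ge0 := projection_energy_ge0 T0 p1 qE Dc DC hmu hoDf.
have [uI|uI] := eqVneq (u * I `^ q^-1) 0.
  exists 1 => // delta /andP[d0 _]; have [nu nuc [ni nuE]] := robust_lower0; exists nu.
    by apply: le_trans nuc _; rewrite lee_fin powR_ge0.
  split=> //; rewrite nuE uI sub0r -[leRHS]addr0 lerD2l mulrN oppr_le0 mulr_ge0// ltW//.
have {}u0 : 0 < u.
  by rewrite lt_neqAle u0 andbT eq_sym; apply: contraNneq uI => ->; rewrite mul0r.
have I0 : 0 < I.
  rewrite lt_neqAle I_ge0 andbT eq_sym; apply: contraNneq uI => ->.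
  by rewrite powR0 ?mulr0// gt_eqF// invr_gt0.
have [_ _ pq _ pdq] := conjugate_exponent p1 qE.
have up0 : 0 < u `^ p by exact: powR_gt0.
(* With kappa = delta^(1/q) m, this value makes the energy error kappa^-p / p (delta u)^p equal to
   delta e / 8. Then kappa^q / q = delta A, and [e2] bounds the gap and oscillation errors by delta
   e / 8 as well. *)
pose mp := 8 * u `^ p / (p * e); pose m := mp `^ p^-1.
have mp0 : 0 < mp by rewrite /mp divr_gt0 ?mulr_gt0.
have m0 : 0 < m by exact: powR_gt0.
have mpE : m `^ p = mp by rewrite /m -powRrM mulVf ?gt_eqF// powRr1// ltW.
pose A := m `^ q / q; have A0 : 0 < A by rewrite divr_gt0// powR_gt0.
pose e2 := e / 8 / A; have e20 : 0 < e2 by apply: divr_gt0 => //; exact: divr_gt0.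
have e40 : 0 < e / 4 by rewrite divr_gt0.
have [n [tau [tP S0 SI Hosc]]] := good_partition u0 e40 e20 I0.
have e220 : 0 < e2 / 2 by rewrite divr_gt0.
have [K K0 Hgap] := gap_estimate T0 p1 qE hf Dc DC hmu e220.
(* For delta u below r^(1/p), the term K (delta u)^p of the gap estimate is at most e2 / 2. *)
pose r := e2 / 2 / (K + 1); have r0 : 0 < r by apply: divr_gt0 => //; exact: ltr_wpDl.
exists (r `^ p^-1 / u); first by rewrite divr_gt0// powR_gt0.
move=> delta /andP[d0 dlt].
set Sm := left_sum n tau in S0 SI.
(* The cost c^p Sm is then (delta u)^p, and the gain c Sm is delta u Sm^(1/q). *)
pose c := delta * u / Sm `^ p^-1.
have Sp0 : 0 < Sm `^ p^-1 by exact: powR_gt0.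
have c0 : 0 <= c by rewrite divr_ge0 ?powR_ge0// ltW// mulr_gt0.
have du0 : 0 < delta * u by rewrite mulr_gt0.
have cpS : c `^ p * Sm = (delta * u) `^ p.
  rewrite /c powRM ?invr_ge0 ?powR_ge0 ?(ltW du0)// -powR_inv1 ?powR_ge0// -!powRrM.
  by rewrite mulN1r mulrN mulVf ?gt_eqF// powR_inv1 ?(ltW S0)// divfK// gt_eqF.
have SE : Sm = Sm `^ p^-1 * Sm `^ q^-1.
  by rewrite -powRD ?pq ?powRr1 ?(ltW S0)//; apply/implyP => _; rewrite gt_eqF.
have cS : c * Sm = delta * (u * Sm `^ q^-1).
  by rewrite {1}SE /c mulrA divfK ?gt_eqF// mulrA.
have [nu [pi [nuE piE pic]]] := @drift_coupling _ _ c tP.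
have pia := drift_cost c0 piE; rewrite -/Sm cpS in pia.
have pi1 B : measurable B -> pi (fst @^-1` B) = mu B by rewrite piE.
have [ni fE] := drift_value c0 nuE piE.
exists nu; first exact: (causal_cost_le pic pia).
split=> //; rewrite -fE.
pose kappa := delta `^ q^-1 * m.
have k0 : 0 < kappa by rewrite mulr_gt0// powR_gt0.
have kq : kappa `^ q / q = delta * A.
  by rewrite /kappa powRM ?powR_ge0 ?(ltW m0)// -powRrM mulVf ?gt_eqF// powRr1 ?ltW// /A mulrA.
have kp : (kappa `^ p)^-1 / p * (delta * u) `^ p = delta * (e / 8).
  rewrite /kappa powRM ?powR_ge0 ?(ltW m0)// mpE -powRrM mulrC mulrC [q^-1 * p]mulrC pdq.
  rewrite powRM ?(ltW d0) ?(ltW u0)// -(mulr_powRB1 (ltW d0) p0) /mp.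
  have dp0 : delta `^ (p - 1) != 0 by rewrite gt_eqF ?powR_gt0.
  move: (delta `^ (p - 1)) dp0 (u `^ p) (gt_eqF up0) => w w0 v /negbT v0.
  by field; rewrite w0 v0 !gt_eqF.
have e'0 : 0 < delta * (e / 8) by rewrite mulr_gt0// divr_gt0.
have rmesh : vanishing_mesh (fun N => (n * N.+1)%N) (refine_partition tau).
  move=> del del0; exists (Num.bound (T / del)) => N NN j jn.
  apply: le_lt_trans (refine_mesh tP jn) _; rewrite ltr_pdivrMr// mulrC -ltr_pdivrMr//.
  apply: lt_le_trans (archi_boundP _) _; first by rewrite divr_ge0// ltW.
  by rewrite ler_nat (leq_trans NN).
have [N HN] := expected_expansion T0 p1 qE hf fC Dc DC hmu pi1 pia
  (fun N => refine_partitionP N tP) rmesh k0 e'0.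
have := HN N (leqnn N); rewrite kp kq ler_norml => /andP[+ _].
have := drift_first_order c0 piE N k0; rewrite -/Sm cS cpS kp kq.
have oscA : delta * A * \int[mu]_x oscillation n tau N x <= delta * (e / 8).
  rewrite -mulrA ler_wpM2l ?(ltW d0)//; apply: le_trans (ler_wpM2l (ltW A0) (Hosc N)) _.
  by rewrite /e2 mulrC divfK// gt_eqF.
have gapA : delta * A * \int[pi]_z gap_int T0 q Dft z.1 z.2 <= delta * (e / 8).
  rewrite -mulrA ler_wpM2l ?(ltW d0)//; apply: (@le_trans _ _ (A * e2)).
    rewrite ler_wpM2l ?(ltW A0)//; apply: le_trans (Hgap pi _ pi1 pia) _.
    rewrite [leRHS](splitr e2) lerD2l; apply: (@le_trans _ _ (K * r)).
      rewrite ler_wpM2l//; have <- : (r `^ p^-1) `^ p = r.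
        by rewrite -powRrM mulVf ?gt_eqF// powRr1// ltW.
      apply: ge0_ler_powR; rewrite ?nnegrE ?powR_ge0 ?(ltW p0) ?(ltW du0)//.
      by apply: ltW; rewrite -ltr_pdivlMr.
    by rewrite /r mulrCA ler_piMr ?(ltW e220)// ler_pdivrMr ?ltr_wpDl// mul1r lerDl.
  by rewrite /e2 mulrC divfK// gt_eqF.
have := ler_wpM2l (ltW d0) SI; rewrite mulrBr [delta * (_ - e)]mulrBr.
move: oscA gapA e'0; rewrite !mulrA.
move: (Rintegral pi _ (fun z => f z.2)) (Rintegral mu _ f) (Rintegral pi _ (fun z => first_order _ _ _ _ _)) => z1 z2 z3.
move: (_ * Rintegral mu _ _) (_ * Rintegral pi _ _) (delta * u * _) (delta * u * _) => w1 w2 w3 w4.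
lra.
Qed.

End drift.

(** * Asymptotics of the robust value *)

Section asymptotics.
Context {R : realType} {T : R} {d : nat}.
Hypothesis T0 : 0 < T.
Local Notation X := (C0_path T d).
Local Notation D := (cadlag_path T d).
Variables (p q : R).
Hypothesis (p1 : 1 < p) (qE : q = p / (p - 1)).
Variables (f : X -> R) (ft : D -> R) (Dft : R -> D -> 'rV[R]_d).
Hypothesis hf : D1b_with p f ft Dft.
Local Notation Df := (fun t (w : X) => Dft t (cadlag_of_C0 w)).
Variable C : R.
Hypothesis fC : forall w, `|f w| <= C * (1 + sup_lnorm T p w `^ p).
Hypothesis Dc : forall t, 0 <= t <= T -> continuous (Df t).
Hypothesis DC : forall t w, 0 <= t <= T ->
  lnorm p (Df t w) <= C * (1 + sup_lnorm T p w `^ (p - 1)).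
Variable mu : probability X R.
Hypothesis hmu : (\int[mu]_w (sup_lnorm T p w `^ p)%:E < +oo)%E.
Variable oDf : R -> X -> 'rV[R]_d.
Hypothesis hoDf : optional_projection mu Df oDf.
Variable L : R -> \bar R.
Hypothesis hL : penalty_spec L p.
Local Notation v := (projection_energy q mu oDf `^ q^-1).
Local Notation V := (robust_value L p mu f).
Local Notation V0 := (\int[mu]_w f w).

Let p0 : 0 < p. Proof. exact: lt_trans p1. Qed.
Let q1 : 1 < q. Proof. by have [_ q1 _ _ _] := conjugate_exponent p1 qE. Qed.
Let q0 : 0 < q. Proof. exact: lt_trans q1. Qed.
Let pi0 : 0 < p^-1. Proof. by rewrite invr_gt0. Qed.
Let qi0 : 0 < q^-1. Proof. by rewrite invr_gt0. Qed.

Lemma penalty_growth (A : R) : exists2 u1 : R, 1 <= u1 &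
  forall u, u1 <= u -> ((A * u `^ p)%:E <= L u)%E.
Proof.
have [L0 _ _ _] := hL; rewrite /limf_einf /limf_esup => /eqP; rewrite eqe_oppLR => /eqP infE.
(* The lower limit being +oo, the upper limit of - L u / u^p is -oo, so a neighbourhood of +oo keeps
   its supremum below -A. *)
have : (ereal_inf [set ereal_sup ((\- (fun u => L u * ((u `^ p)^-1)%:E))%E @` W) |
    W in (+oo%R : set_system R)] < (- A)%:E)%E by rewrite infE /= ltNyr.
move=> /ereal_inf_lt[_ [W [M [_ WM]] <-] Wlt].
exists (Num.max 1 (M + 1)); first by rewrite le_max lexx.
move=> u; rewrite ge_max => /andP[u1 Mu].
have up : 0 < u `^ p by apply: powR_gt0; exact: lt_le_trans u1.
have Wu : W u by apply: WM; apply: lt_le_trans Mu; rewrite ltrDl.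
have : (- (L u * ((u `^ p)^-1)%:E) < (- A)%:E)%E.
  by apply: le_lt_trans Wlt; apply: ereal_sup_ubound; exists u.
rewrite EFinN lteN2; case: (L u) (L0 u (le_trans ler01 u1)) => [l| |]// _; last by move=> _; rewrite leey.
by rewrite -EFinM lte_fin lee_fin ltr_pdivlMr// => /ltW.
Qed.

(** Beyond [u1] the penalty exceeds (v + 1) u^p >= u v, so such u contribute nothing positive; below
    [u1] the contribution is at most u1 v. *)
Lemma conjugate_finite : exists2 Ups : R, 0 <= Ups & conjugate L v%:E = Ups%:E.
Proof.
have [L0 _ _ L00 _] := hL; have v0 : 0 <= v by exact: powR_ge0.
have [u1 u11 Lu1] := penalty_growth (v + 1).
have ge0 : (0 <= conjugate L v%:E)%E.
  by apply: ereal_sup_ubound; exists 0 => //=; rewrite L00 mul0e sube0.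
have leB : (conjugate L v%:E <= (u1 * v)%:E)%E.
  apply: ge_ereal_sup => _ [u /= u0 <-]; have [uu1|u1u] := leP u u1.
    apply: (@le_trans _ _ (u%:E * v%:E)%E); last by rewrite -EFinM lee_fin ler_wpM2r.
    by rewrite -[leRHS]sube0; apply: leeB => //; exact: L0.
  apply: (@le_trans _ _ 0%E); last by rewrite lee_fin mulr_ge0// (le_trans ler01).
  rewrite sube_le0 -EFinM; apply: le_trans (Lu1 u (ltW u1u)); rewrite lee_fin.
  have u_ge1 : 1 <= u by exact: le_trans (ltW u1u).
  have : u <= u `^ p by rewrite -[leLHS]powRr1//; apply: ler_powR => //; exact: ltW.
  move: (u `^ p) => w uw; apply: (@le_trans _ _ ((v + 1) * u)); last by rewrite ler_wpM2l// addr_ge0.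
  by rewrite mulrC ler_wpM2r// lerDl.
exists (fine (conjugate L v%:E)); first by rewrite fine_ge0.
by rewrite fineK// ge0_fin_numE//; apply: le_lt_trans leB _; exact: ltry.
Qed.

(** Take u almost optimal in the conjugate: a measure at causal cost at most (delta u)^p is
    penalized by at most delta L(u), by monotonicity. *)
Lemma value_lower (Ups e : R) : conjugate L v%:E = Ups%:E -> 0 < e ->
  exists2 delta0 : R, 0 < delta0 & forall delta, 0 < delta < delta0 ->
    ((V0 + delta * (Ups - e))%:E <= V delta)%E.
Proof.
move=> UE e0; have [L0 _ Lmono _ _] := hL.
have e20 : 0 < e / 2 by rewrite divr_gt0.
have : ((Ups - e / 2)%:E < conjugate L v%:E)%E by rewrite UE lte_fin ltrBlDr ltrDl.
move=> /ereal_sup_gt[_ [u /= u0 <-]].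
case Lu : (L u) (L0 u u0) => [l| |]// _ H.
rewrite -EFinM -EFinB lte_fin in H.
have [delta0 d00 Hd] := robust_lower T0 p1 qE hf fC Dc DC hmu hoDf u0 e20.
exists delta0 => // delta dd; have /andP[d0 _] := dd.
have [nu nuc [ni nuv]] := Hd delta dd.
apply: le_ereal_sup_tmp; exists (\int[nu]_w (f w)%:E -
  scaled_penalty L delta (causal_cost p mu nu `^ p^-1))%E; first by exists nu.
have nuE : (\int[nu]_w (f w)%:E = (\int[nu]_w f w)%:E)%E.
  by rewrite /Rintegral fineK//; exact: integrable_fin_num.
have pen : (scaled_penalty L delta (causal_cost p mu nu `^ p^-1) <= (delta * l)%:E)%E.
  move: (causal_cost_ge0 p mu nu) nuc; case: (causal_cost p mu nu) => [a| |]//.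
  rewrite !lee_fin => a0 ale; rewrite poweR_EFin /scaled_penalty -EFinM /= EFinM.
  apply: lee_wpmul2l; first by rewrite lee_fin ltW.
  rewrite -Lu; apply: Lmono; first by rewrite divr_ge0 ?powR_ge0// ltW.
  rewrite ler_pdivrMr// mulrC; have -> : delta * u = ((delta * u) `^ p) `^ p^-1.
    by rewrite -powRrM mulfV ?gt_eqF// powRr1// mulr_ge0// ltW.
  by apply: ge0_ler_powR; rewrite ?nnegrE ?powR_ge0 ?(ltW pi0).
rewrite nuE; apply: (@le_trans _ _ ((\int[nu]_w f w)%:E - (delta * l)%:E)%E); last exact: leeB.
rewrite -EFinB lee_fin; apply: le_trans (lerB nuv (lexx _)); rewrite -addrA -mulrBr lerD2l.
rewrite ler_wpM2l ?(ltW d0)//; move: H; lra.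
Qed.

Lemma powR_inv_le (a b : R) : 0 <= a -> a <= b -> a `^ q^-1 <= b `^ q^-1.
Proof.
by move=> a0 ab; apply: ge0_ler_powR; rewrite ?nnegrE ?(ltW qi0) ?(le_trans a0).
Qed.

(** With u = a^(1/p) / delta, there are two regimes. For u <= u1 the sharp bound and the definition
    of the conjugate apply; for u > u1 a crude bound of order u^p is outweighed by L. *)
Lemma value_upper_bound (Ups e : R) : conjugate L v%:E = Ups%:E -> 0 <= Ups -> 0 < e ->
  exists2 delta0 : R, 0 < delta0 & forall delta, 0 < delta < delta0 ->
    (V delta <= (V0 + delta * (Ups + e))%:E)%E.
Proof.
move=> UE U0 e0; have [L0 _ Lmono _ _] := hL; have v0 : 0 <= v by exact: powR_ge0.
have [_ _ _ _ pdq] := conjugate_exponent p1 qE.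
(* The crude bound, with gap level 1, serves for u > u1. *)
have [K1 K10 H1] := robust_upper T0 p1 qE hf fC Dc DC hmu hoDf ltr01.
pose k1 := K1 `^ q^-1; have k10 : 0 <= k1 by exact: powR_ge0.
pose c2 := 2 `^ q^-1 : R; have c20 : 0 <= c2 by exact: powR_ge0.
(* The constant is the coefficient of u^p in the crude bound, once u and u^(p-1) u are bounded by
   u^p. *)
have [u1 u11 Lu1] := penalty_growth (v + c2 + c2 * k1).
have u10 : 0 < u1 by exact: lt_le_trans u11.
(* When K a <= eps, the error (eps + K a)^(1/q) u is at most (2 eps)^(1/q) u1 = e. *)
pose eps := (e / u1) `^ q / 2.
have eps0 : 0 < eps by rewrite divr_gt0// powR_gt0// divr_gt0.
have [K K0 H] := robust_upper T0 p1 qE hf fC Dc DC hmu hoDf eps0.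
pose r := eps / (K + 1); have r0 : 0 < r by rewrite divr_gt0// ltr_wpDl.
(* The bound 1 gives a <= u^p for the crude regime; the other gives K a <= eps when u <= u1. *)
exists (Num.min 1 (r `^ p^-1 / u1)); first by rewrite lt_min ltr01 divr_gt0// powR_gt0.
move=> delta /andP[d0]; rewrite lt_min => /andP[d1 dr].
apply: ge_ereal_sup => _ [nu _ <-].
case aE : (causal_cost p mu nu) (causal_cost_ge0 p mu nu) => [a| |]// a0; last first.
  rewrite poweRyr ?gt_eqF// /scaled_penalty gt0_mulye ?lte_fin ?invr_gt0//= gt0_muley ?lte_fin//.
  by rewrite addeNy leNye.
rewrite lee_fin in a0; pose u := a `^ p^-1 / delta.
have u0 : 0 <= u by rewrite divr_ge0 ?powR_ge0// ltW.
have apE : a `^ p^-1 = delta * u by rewrite /u mulrC divfK// gt_eqF.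
have aduE : a = (delta * u) `^ p by rewrite -apE -powRrM mulVf ?gt_eqF// powRr1.
have [ni le1] := H1 nu a aE; have [_ le2] := H nu a aE.
have -> : (\int[nu]_w (f w)%:E = (\int[nu]_w f w)%:E)%E.
  by rewrite /Rintegral fineK//; exact: integrable_fin_num.
rewrite poweR_EFin /scaled_penalty -EFinM /= -/u.
clearbody u; case Lu : (L u) (L0 u u0) => [l| |]// l0; last by rewrite gt0_muley ?lte_fin// addeNy leNye.
rewrite lee_fin in l0; rewrite -EFinM -EFinB lee_fin.
suff main : (\int[nu]_w f w - V0) <= delta * (Ups + e + l).
  by move: main; rewrite mulrDr; move: (delta * l) (delta * _) => *; lra.
have [uu1|u1u] := leP u u1.
  apply: le_trans le2 _; rewrite apE mulrCA ler_wpM2l ?(ltW d0)// mulrDl.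
  have ul : u * v - l <= Ups.
    have : (u%:E * v%:E - L u <= conjugate L v%:E)%E by apply: ereal_sup_ubound; exists u.
    by rewrite UE Lu -EFinM -EFinB lee_fin.
  have ue : (eps + K * a) `^ q^-1 * u <= e.
    have Ka : K * a <= eps.
      apply: (@le_trans _ _ (K * r)); last first.
        by rewrite /r mulrCA ler_piMr ?(ltW eps0)// ler_pdivrMr ?ltr_wpDl// mul1r lerDl.
      rewrite ler_wpM2l// aduE; have <- : (r `^ p^-1) `^ p = r.
        by rewrite -powRrM mulVf ?gt_eqF// powRr1// ltW.
      apply: ge0_ler_powR; rewrite ?nnegrE ?powR_ge0 ?(ltW p0)//.
        by rewrite mulr_ge0// ltW.
      apply: (@le_trans _ _ (delta * u1)); first by rewrite ler_wpM2l// ltW.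
      by apply: ltW; rewrite -ltr_pdivlMr.
    apply: (@le_trans _ _ (((e / u1) `^ q) `^ q^-1 * u1)).
      apply: ler_pM => //; first exact: powR_ge0.
      apply: powR_inv_le; first by rewrite addr_ge0 ?(ltW eps0)// mulr_ge0.
      apply: le_trans (lerD (lexx _) Ka) _.
      by rewrite /eps -splitr.
    rewrite -powRrM mulfV ?gt_eqF// powRr1; last by rewrite divr_ge0// ltW.
    by rewrite divfK// gt_eqF.
  rewrite mulrC in ul; move: ul ue; move: (_ * u) (_ * u) => *; lra.
apply: le_trans le1 _; rewrite apE mulrCA ler_wpM2l ?(ltW d0)// mulrDl.
apply: (@le_trans _ _ l); last by rewrite lerDr addr_ge0// ltW.
rewrite -lee_fin -Lu; apply: le_trans (Lu1 u (ltW u1u)); rewrite lee_fin !mulrDl.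
have u_ge1 : 1 <= u by exact: le_trans (ltW u1u).
have uup : u <= u `^ p by rewrite -[leLHS]powRr1//; apply: ler_powR => //; exact: ltW.
have -> : v * u + (1 + K1 * a) `^ q^-1 * u = u * v + (1 + K1 * a) `^ q^-1 * u by rewrite mulrC.
have au : a <= u `^ p.
  rewrite aduE; apply: ge0_ler_powR; rewrite ?nnegrE ?mulr_ge0 ?(ltW p0) ?(ltW d0)//.
  by rewrite ler_piMl// ltW.
have b1 : (1 + K1 * a) `^ q^-1 <= c2 * (1 + k1 * u `^ (p - 1)).
  apply: (@le_trans _ _ ((1 + K1 * u `^ p) `^ q^-1)).
    apply: powR_inv_le; first by rewrite addr_ge0// mulr_ge0.
    by rewrite lerD2l ler_wpM2l.
  apply: le_trans (powRD_le qi0 ler01 _) _; first by rewrite mulr_ge0 ?powR_ge0.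
  by rewrite powR1 powRM ?powR_ge0// -powRrM pdq.
have upE : u `^ (p - 1) * u = u `^ p by rewrite mulrC mulr_powRB1.
have := ler_wpM2r u0 b1; rewrite mulrDr mulr1 mulrDl -!mulrA upE.
have := ler_wpM2l v0 uup; have := ler_wpM2l c20 uup; rewrite (mulrC u v).
by move: (_ * u) (c2 * u) (v * u) (v * _) (c2 * _) (c2 * _) => *; lra.
Qed.

End asymptotics.

Theorem theorem4p11 (R : realType) (d : nat) (p q T : R)
  (hp : 1 < p) (hq : q = p / (p - 1)) (hT : 0 < T)
  (mu : probability (C0_path T d) R)
  (hmu : (\int[mu]_w (sup_lnorm T p w `^ p)%:E < +oo)%E)
  (L : R -> \bar R) (hL : penalty_spec L p)
  (f : C0_path T d -> R) (ft : cadlag_path T d -> R)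
  (Dft : R -> cadlag_path T d -> 'rV[R]_d) (hf : D1b_with p f ft Dft)
  (Df : R -> C0_path T d -> 'rV[R]_d)
  (hDf : Df = fun t w => Dft t (cadlag_of_C0 w))
  (C : R)
  (hfC : forall w, `|f w| <= C * (1 + sup_lnorm T p w `^ p))
  (hDfc : forall t, 0 <= t <= T -> continuous (Df t))
  (hDfC : forall t w, 0 <= t <= T ->
     lnorm p (Df t w) <= C * (1 + sup_lnorm T p w `^ (p - 1)))
  (oDf : R -> C0_path T d -> 'rV[R]_d)
  (hoDf : optional_projection mu Df oDf) :
  let V := robust_value L p mu f in
  let V0 := (\int[mu]_w (f w)%:E)%E in
  exists Upsilon : R,
    [/\ conjugate L (process_norm q mu oDf) = Upsilon%:E,
        ((V delta - V0) * (delta^-1)%:E)%E @[delta --> 0^'+] --> Upsilon%:E,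
        V0 \is a fin_num,
        (\forall delta \near 0^'+, V delta \is a fin_num) &
        (forall delta : R, fine (V delta) =
           fine V0 + Upsilon * delta +o_(delta \near 0^'+) delta)].
Proof.
move=> V V0; subst Df.
have [U U0 UE] := conjugate_finite q hp mu oDf hL.
have V0fin : V0 \is a fin_num.
  by apply: integrable_fin_num => //; exact: (integrable_f hT hp hf hfC hmu).
have sandwich (e : R) : 0 < e -> \forall delta \near 0^'+,
    0 < delta /\ ((fine V0 + delta * (U - e))%:E <= V delta <= (fine V0 + delta * (U + e))%:E)%E.
  move=> e0.
  have [d1 d10 H1] := value_lower hT hp hq hf hfC hDfc hDfC hmu hoDf hL UE e0.
  have [d2 d20 H2] := value_upper_bound hT hp hq hf hfC hDfc hDfC hmu hoDf hL UE U0 e0.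
  near=> delta; have delta0 : 0 < delta by near: delta; exact: nbhs_right_gt.
  split=> //; apply/andP; split.
    by apply: H1; rewrite delta0/=; near: delta; exact: nbhs_right_lt.
  by apply: H2; rewrite delta0/=; near: delta; exact: nbhs_right_lt.
(* The sandwich also makes V finite near 0; the limit of the difference quotient and the o(delta)
   expansion are two readings of this estimate. *)
have bound (e : R) : 0 < e -> \forall delta \near 0^'+, [/\ 0 < delta, V delta \is a fin_num &
    `|fine (V delta) - fine V0 - U * delta| <= e * delta].
  move=> e0; apply: filterS (sandwich e e0) => delta [d0]; case: (V delta) => [r| |] /andP[le1 le2]//.
  split=> //=; rewrite !lee_fin in le1 le2; rewrite ler_norml.
  by apply/andP; split; move: le1 le2; rewrite mulrBr mulrDr (mulrC delta U) (mulrC delta e);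
    move: (U * delta) (e * delta) => *; lra.
exists U; split=> //.
- by rewrite (process_normE hT hp hq hDfc hDfC hmu hoDf).
- apply/fine_cvgP; split.
    apply: filterS (bound 1 ltr01) => delta [_ Vf _].
    by rewrite fin_numM// fin_numB Vf.
  apply/cvgrPdist_le => e e0; apply: filterS (bound e e0) => delta [d0 Vf le1] /=.
  rewrite -(fineK Vf) -(fineK V0fin) -EFinB -EFinM [fine (_%:E)]/= distrC.
  rewrite (_ : _ - U = (fine (V delta) - fine V0 - U * delta) / delta).
    by rewrite normrM normfV (gtr0_norm d0) ler_pdivrMr.
  by rewrite [in RHS]mulrBl mulfK// gt_eqF.
- by apply: filterS (bound 1 ltr01) => delta [].
- have H : (fun delta => fine (V delta)) =
      (fun delta => fine V0 + U * delta) +o_ (nbhs (0 : R)^'+) id.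
    apply/eqaddoP => e e0; apply: filterS (bound e e0) => delta [d0 _ le1].
    by rewrite !fctE (gtr0_norm d0) opprD addrA.
  by move=> delta; move/(congr1 (fun h => h delta)): H.
Unshelve. all: by end_near. Qed.
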